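(* Suppose that $(\boldsymbol{u},p)\in\boldsymbol{H}^1_E(\Omega)\times Q$ is the weak solution satisfying $$a(\boldsymbol{u},\boldsymbol{v})+b(\boldsymbol{v},p)=f(\boldsymbol{v})\ \ \forall\boldsymbol{v}\in\boldsymbol{V},\qquad b(\boldsymbol{u},q)-c(p,q)=0\ \ \forall q\in Q,$$ and that $(\boldsymbol{u}_h,p_h)\in\boldsymbol{X}^h_E\times Q^h$ satisfies the locally stabilised discrete problem $$a(\boldsymbol{u}_h,\boldsymbol{v}_h)+b(\boldsymbol{v}_h,p_h)=f(\boldsymbol{v}_h)\ \ \forall\boldsymbol{v}_h\in\boldsymbol{X}^h_0,\qquad b(\boldsymbol{u}_h,q_h)-c(p_h,q_h)-\mathcal{C}_{loc}(p_h,q_h)=0\ \ \forall q_h\in Q^h .$$ Let $\eta$ be the residual error estimator and $\Theta$ the data oscillation error. Then $$\eta\lesssim|||(\boldsymbol{u}-\boldsymbol{u}_h,p-p_h)|||+\Theta .$$ This holds for both the Herrmann and the Hydrostatic formulations.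
   Context: **Domain and parameters.** $\Omega\subset\mathbb{R}^2$ is a bounded Lipschitz polygon. The Lamé coefficients satisfy $0<\mu_1<\mu<\mu_2<\infty$ and $0<\lambda<\infty$. Set $\kappa=\lambda$ (Herrmann formulation) or $\kappa=\mu+\lambda$ (Hydrostatic formulation). $\|\cdot\|_{0,\omega}$ is the $L^2(\omega)$ norm, $\|\cdot\|_0=\|\cdot\|_{0,\Omega}$, and $\boldsymbol{\varepsilon}(\boldsymbol{u})=\frac12(\nabla\boldsymbol{u}+(\nabla\boldsymbol{u})^\top)$. Boldface spaces are $\mathbb{R}^2$-valued. $\boldsymbol{H}^1_E(\Omega)=\{\boldsymbol{v}\in\boldsymbol{H}^1(\Omega):\boldsymbol{v}|_{\partial\Omega}=\boldsymbol{g}\}$, $\boldsymbol{V}=\boldsymbol{H}^1_0(\Omega)$, $Q=L^2(\Omega)$. Data: $\boldsymbol{f}\in(L^2(\Omega))^2$, and $\boldsymbol{g}\in\boldsymbol{H}^{1/2}(\partial\Omega)$ is a polynomial of degree at most one in each component, so no error is incurred in approximating the boundary condition. **Forms.** $b(\boldsymbol{v},p)=-\int_\Omega p\,\nabla\cdot\boldsymbol{v}$, $c(p,q)=\frac1\kappa\int_\Omega pq$, $f(\boldsymbol{v})=\int_\Omega\boldsymbol{f}\cdot\boldsymbol{v}$, and $a(\cdot,\cdot)$ is either $a_H(\boldsymbol{u},\boldsymbol{v})=2\mu\int_\Omega\boldsymbol{\varepsilon}(\boldsymbol{u}):\boldsymbol{\varepsilon}(\boldsymbol{v})$ (Herrmann)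 or $a_S(\boldsymbol{u},\boldsymbol{v})=2\mu\left(\int_\Omega\boldsymbol{\varepsilon}(\boldsymbol{u}):\boldsymbol{\varepsilon}(\boldsymbol{v})-\frac12\int_\Omega(\nabla\cdot\boldsymbol{u})(\nabla\cdot\boldsymbol{v})\right)$ (Hydrostatic). The corresponding stress is $\boldsymbol{\sigma}(\boldsymbol{u},p)=2\mu\boldsymbol{\varepsilon}(\boldsymbol{u})-p\boldsymbol{I}$ (Herrmann) or $\boldsymbol{\sigma}(\boldsymbol{u},p)=2\mu(\boldsymbol{\varepsilon}(\boldsymbol{u})-\frac12(\nabla\cdot\boldsymbol{u})\boldsymbol{I})-p\boldsymbol{I}$ (Hydrostatic). **Energy norm.** $|||(\boldsymbol{u},p)|||^2=2\mu\|\nabla\boldsymbol{u}\|_0^2+(2\mu)^{-1}\|p\|_0^2+\kappa^{-1}\|p\|_0^2$. **Meshes and spaces.** $\{\mathcal{T}_h\}$ is a family of shape-regular conforming triangular meshes of $\overline\Omega$ with triangles $K$ of diameter $h_K$; $\mathcal{E}_h$ is the set of all edges, and $h_E$ is the length of $E\in\mathcal{E}_h$. $\boldsymbol{X}^h_0\subset\boldsymbol{V}$ consists of the vector-valued continuous functions, piecewise linear in each component, vanishing on $\partial\Omega$; $\boldsymbol{X}^h_E\subset\boldsymbol{H}^1_E(\Omega)$ consists of those continuous piecewise linear vector functions equal to $\boldsymbol{g}$ on $\partial\Omega$. $Q^h\subset Q$ is the space of piecewise constant functions on $\mathcal{T}_h$. **Macroelements and stabilisation.** For each $\mathcal{T}_h$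 a macroelement partitioning $\mathcal{M}_h$ is chosen such that: (1) each $M\in\mathcal{M}_h$ is a connected set of adjoining elements of $\mathcal{T}_h$; (2) distinct macroelements do not overlap; (3) for any two neighbouring macroelements $M_1,M_2$ whose common interface $M_1\cap M_2$ has positive length, there is $\boldsymbol{v}\in\boldsymbol{X}^h_0$ with $\operatorname{supp}\boldsymbol{v}\subset\overline M_1\cup\overline M_2$ and $\int_{M_1\cap M_2}\boldsymbol{v}\cdot\boldsymbol{n}\,ds\ne0$; (4) $\bigcup_{M}\overline M=\overline\Omega$. $\Gamma_M$ is the set of interior interelement edges of $M$ (edges not on $\partial\Omega$, lying inside $M$ and shared by two elements of $M$). It is assumed that every macroelement belongs to one of a finite number of equivalence classes (two macroelements being equivalent if there is a continuous bijection between them mapping triangles affinely onto triangles). With $[\![\cdot]\!]$ the jump across $E$, $$\mathcal{C}_{loc}(p_h,q_h)=\frac1{2\mu}\sum_{M\in\mathcal{M}_h}\sum_{E\in\Gamma_M}h_E\int_E[\![p_h]\!][\![q_h]\!]\,ds,\qquad p_h,q_h\in Q^h .$$ **Estimator.** Let $\boldsymbol{f}_h$ be the $L^2$-projection of $\boldsymbol{f}$ onto piecewise constants, and $\rho_K=h_K(2\mu)^{-1/2}$, $\rho_E=h_E(2\mu)^{-1}$, $\rho_d=1/(\kappa^{-1}+(2\mu)^{-1})$. The residuals are $\boldsymbol{R}_K=\boldsymbol{f}_h|_K$, $R_K=\{\nabla\cdot\boldsymbol{u}_h+p_h/\kappa\}|_K$, and $\boldsymbol{R}_E=\frac12[\![-\boldsymbol{\sigma}(\boldsymbol{u}_h,p_h)\boldsymbol{n}]\!]_E$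 (the jump across $E$ of the normal stress, $\boldsymbol{n}$ a unit normal to $E$) for interior edges, $\boldsymbol{R}_E=\boldsymbol{0}$ for $E\subset\partial\Omega$. Define $\eta_{R_K}^2=\rho_K^2\|\boldsymbol{R}_K\|_{0,K}^2$, $\eta_{J_K}^2=\rho_d\|R_K\|_{0,K}^2$, $\eta_{E_K}^2=\sum_{E\in\partial K}\rho_E\|\boldsymbol{R}_E\|_{0,E}^2$, $\eta_K^2=\eta_{R_K}^2+\eta_{E_K}^2+\eta_{J_K}^2$, $\Theta_K^2=\rho_K^2\|\boldsymbol{f}-\boldsymbol{f}_h\|_{0,K}^2$, and $$\eta=\Big(\sum_{K\in\mathcal{T}_h}\eta_K^2\Big)^{1/2},\qquad\Theta=\Big(\sum_{K\in\mathcal{T}_h}\Theta_K^2\Big)^{1/2}.$$ **Notation.** $\lesssim$ denotes a bound valid up to a positive constant that is independent of the Lamé coefficients and the mesh parameters. *)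

(* Defs.v *)
From HB Require Import structures.
From mathcomp Require Import all_boot all_order all_algebra finmap.
From mathcomp Require Import all_classical all_reals all_analysis.

Set Implicit Arguments.
Unset Strict Implicit.
Unset Printing Implicit Defensive.

Import Order.TTheory GRing.Theory Num.Theory.
Import numFieldNormedType.Exports.

Local Open Scope classical_set_scope.
Local Open Scope ring_scope.

(* Points of the plane.  The library norm on a product is the sup norm, so     *)
(* all lengths below use the Euclidean norm [enorm] explicitly.                *)
Notation pt R := (R * R)%type.

Definition crd {R : realType} (i : 'I_2) (x : pt R) : R :=
  if i == 0 then x.1 else x.2.
Definition basis {R : realType} (i : 'I_2) : pt R :=
  if i == 0 then (1, 0) else (0, 1).
Definition component {R : realType} (i : 'I_2) (u : pt R -> pt R) : pt R -> R :=
  fun x => crd i (u x).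

Definition dot {R : realType} (x y : pt R) : R := x.1 * y.1 + x.2 * y.2.
Definition enorm {R : realType} (x : pt R) : R := Num.sqrt (dot x x).
Definition perp {R : realType} (x : pt R) : pt R := (x.2, - x.1).
Definition frob {R : realType} (A B : 'M[R]_2) : R :=
  \sum_(i < 2) \sum_(j < 2) A i j * B i j.
Definition mxpt {R : realType} (A : 'M[R]_2) (x : pt R) : pt R :=
  (\sum_(j < 2) A 0 j * crd j x, \sum_(j < 2) A 1 j * crd j x).

Definition leb2 {R : realType} := (@lebesgue_measure R \x @lebesgue_measure R)%E.

Definition diam {R : realType} (A : set (pt R)) : R :=
  sup [set d | exists x y, [/\ A x, A y & d = enorm (x - y)]].

(* The supremum of the diameters of the closed discs contained in A. *)
Definition indiam {R : realType} (A : set (pt R)) : R :=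
  sup [set d | 0 <= d /\ exists x, forall y, enorm (y - x) <= d / 2 -> A y].

Definition hull {R : realType} (V : {fset pt R}) : set (pt R) :=
  [set x | exists l : pt R -> R,
    [/\ forall v, v \in V -> 0 <= l v, \sum_(v <- V) l v = 1
      & x = \sum_(v <- V) l v *: v]].

Definition boundary {R : realType} (Om : set (pt R)) : set (pt R) :=
  closure Om `\` Om°.

Definition affine_on {R : realType} (D : set (pt R)) (u : pt R -> pt R) :=
  exists (A : 'M[R]_2) (b : pt R), forall x, D x -> u x = mxpt A x + b.

(* Locally, in the Cartesian coordinates given by the orthonormal frame        *)
(* (perp e, e), Om is the part of the plane above a Lipschitz graph.           *)
Definition lipschitz_boundary {R : realType} (Om : set (pt R)) :=
  forall x, boundary Om x -> exists (e : pt R) (k : R) (gam : R -> R),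
    [/\ enorm e = 1, k.-lipschitz gam
      & \forall y \near x, Om y <-> gam (dot y (perp e)) < dot y e].

Definition lipschitz_polygon {R : realType} (Om : set (pt R)) :=
  [/\ open Om, connected Om, Om !=set0 & bounded_set Om] /\
  lipschitz_boundary Om /\
  exists s : seq (pt R * pt R),
    boundary Om = [set x | exists2 ab, ab \in s & hull [fset ab.1; ab.2]%fset x].

Definition L2 {R : realType} (D : set (pt R)) (u : pt R -> R) :=
  measurable_fun D u /\ leb2.-integrable D (fun x => (u x ^+ 2)%:E).

Definition pder {R : realType} (i : 'I_2) (u : pt R -> R) : pt R -> R :=
  fun x => 'D_(basis i) u x.

Definition smooth {R : realType} (phi : pt R -> R) :=
  forall s : seq 'I_2, let psi := foldr pder phi s in
    continuous psi /\ forall i x, derivable psi x (basis i).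

Definition test_fun {R : realType} (Om : set (pt R)) (phi : pt R -> R) :=
  let S := closure [set x | phi x != 0] in
  [/\ smooth phi, compact S & S `<=` Om].

Definition weak_pder {R : realType} (Om : set (pt R)) (i : 'I_2)
    (u w : pt R -> R) :=
  forall phi, test_fun Om phi ->
    \int[leb2]_(x in Om) (u x * pder i phi x) =
    - \int[leb2]_(x in Om) (w x * phi x).

Definition H1 {R : realType} (Om : set (pt R)) (u : pt R -> R) :=
  L2 Om u /\ forall i, exists2 w, L2 Om w & weak_pder Om i u w.

(* The weak partial derivative of u : H1 (unique up to a null set). *)
Definition wD {R : realType} (Om : set (pt R)) (i : 'I_2) (u : pt R -> R)
    : pt R -> R :=
  xget (fun=> 0) [set w | L2 Om w /\ weak_pder Om i u w].

Definition H1_cvg {R : realType} (Om : set (pt R)) (phi : nat -> pt R -> R)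
    (u : pt R -> R) :=
  (\int[leb2]_(x in Om) ((phi n x - u x) ^+ 2)%:E @[n --> \oo] --> 0)%E /\
  forall i, (\int[leb2]_(x in Om)
    ((pder i (phi n) x - wD Om i u x) ^+ 2)%:E @[n --> \oo] --> 0)%E.

(* H^1_0: the closure of the test functions in H^1. *)
Definition H10 {R : realType} (Om : set (pt R)) (u : pt R -> R) :=
  H1 Om u /\ exists phi : nat -> pt R -> R,
    (forall n, test_fun Om (phi n)) /\ H1_cvg Om phi u.

(* u|_{bd Om} = g.  The trace operator is the continuous extension of the      *)
(* restriction of smooth functions to the boundary; convergence in             *)
(* L2(boundary) is tested on every segment contained in the boundary (the      *)
(* length factor makes degenerate segments irrelevant).                        *)
Definition has_trace {R : realType} (Om : set (pt R)) (u g : pt R -> R) :=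
  exists phi : nat -> pt R -> R,
    [/\ forall n, smooth (phi n), H1_cvg Om phi u
      & forall a b : pt R, hull [fset a; b]%fset `<=` boundary Om ->
        ((enorm (b - a))%:E *
         \int[lebesgue_measure]_(t in `[0%R, 1%R])
           ((phi n (a + t *: (b - a)) - g (a + t *: (b - a))) ^+ 2)%:E
           @[n --> \oo] --> 0)%E].

Definition H10v {R : realType} (Om : set (pt R)) (v : pt R -> pt R) :=
  forall i, H10 Om (component i v).

Definition H1E {R : realType} (Om : set (pt R)) (g u : pt R -> pt R) :=
  forall i, H1 Om (component i u) /\ has_trace Om (component i u) (component i g).

Definition wgrad {R : realType} (Om : set (pt R)) (u : pt R -> pt R)
    (x : pt R) : 'M[R]_2 :=
  \matrix_(i, j) wD Om j (component i u) x.

Definition sym_part {R : realType} (G : 'M[R]_2) : 'M[R]_2 :=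
  2^-1 *: (G + G^T).

Definition weps {R : realType} (Om : set (pt R)) u x : 'M[R]_2 :=
  sym_part (wgrad Om u x).
Definition wdiv {R : realType} (Om : set (pt R)) u x : R :=
  \tr (wgrad Om u x).

Inductive formulation := Herrmann | Hydrostatic.

Definition kappa {R : realType} (F : formulation) (mu lam : R) : R :=
  match F with Herrmann => lam | Hydrostatic => mu + lam end.

Definition a_form {R : realType} (F : formulation) (mu : R)
    (Om : set (pt R)) (u v : pt R -> pt R) : R :=
  match F with
  | Herrmann =>
      2 * mu * \int[leb2]_(x in Om) frob (weps Om u x) (weps Om v x)
  | Hydrostatic =>
      2 * mu * (\int[leb2]_(x in Om) frob (weps Om u x) (weps Om v x)
                - 2^-1 * \int[leb2]_(x in Om) (wdiv Om u x * wdiv Om v x))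
  end.

(* The stress as a function of the displacement gradient and the pressure. *)
Definition stress {R : realType} (F : formulation) (mu : R)
    (G : 'M[R]_2) (p : R) : 'M[R]_2 :=
  match F with
  | Herrmann => (2 * mu) *: sym_part G - p%:M
  | Hydrostatic => (2 * mu) *: (sym_part G - (2^-1 * \tr G)%:M) - p%:M
  end.

Definition b_form {R : realType} (Om : set (pt R)) (v : pt R -> pt R)
    (p : pt R -> R) : R :=
  - \int[leb2]_(x in Om) (p x * wdiv Om v x).

Definition c_form {R : realType} (kap : R) (Om : set (pt R))
    (p q : pt R -> R) : R :=
  kap^-1 * \int[leb2]_(x in Om) (p x * q x).

Definition load {R : realType} (Om : set (pt R)) (f v : pt R -> pt R) : R :=
  \int[leb2]_(x in Om) dot (f x) (v x).

Definition energy_norm {R : realType} (mu kap : R) (Om : set (pt R))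
    (u : pt R -> pt R) (p : pt R -> R) : R :=
  Num.sqrt
    (2 * mu * \int[leb2]_(x in Om) frob (wgrad Om u x) (wgrad Om u x)
     + (2 * mu)^-1 * \int[leb2]_(x in Om) (p x ^+ 2)
     + kap^-1 * \int[leb2]_(x in Om) (p x ^+ 2)).

Definition weak_solution {R : realType} (F : formulation) (mu lam : R)
    (Om : set (pt R)) (f g u : pt R -> pt R) (p : pt R -> R) :=
  [/\ H1E Om g u, L2 Om p,
      forall v, H10v Om v ->
        a_form F mu Om u v + b_form Om v p = load Om f v
    & forall q, L2 Om q ->
        b_form Om u q - c_form (kappa F mu lam) Om p q = 0].

(* A triangle or an edge is encoded by the finite set of its vertices, its     *)
(* point set being the [hull].  A mesh, or a macroelement, is a finite set of  *)
(* triangles.                                                                  *)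

Notation cell R := {fset pt R}.
Notation mesh R := {fset cell R}.

Definition region {R : realType} (M : mesh R) : set (pt R) :=
  [set x | exists2 K, K \in M & hull K x].

(* Elements are taken open: L2 functions are only constrained inside Om, and  *)
(* piecewise constants are left free on the edges, which are null sets.        *)
Definition elt {R : realType} (K : cell R) : set (pt R) := (hull K)°.

Definition conforming_mesh {R : realType} (Om : set (pt R)) (T : mesh R) :=
  [/\ forall K, K \in T -> #|` K| = 3%N /\ elt K !=set0,
      region T = closure Om
    & forall K K', K \in T -> K' \in T ->
        hull K `&` hull K' = hull (K `&` K')%fset].

Definition h_ {R : realType} (K : cell R) : R := diam (hull K).

Definition shape_regular {R : realType} (I : Type) (T : I -> mesh R) :=
  exists gam : R, forall i K, K \in T i -> h_ K <= gam * indiam (hull K).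

Definition faces {R : realType} (K : cell R) : {fset cell R} :=
  [fset E in fpowerset K | #|` E| == 2%N]%fset.
Definition edges {R : realType} (M : mesh R) : {fset cell R} :=
  (\bigcup_(K <- M) faces K)%fset.

Definition ptA {R : realType} (E : cell R) : pt R := nth 0 (enum_fset E) 0.
Definition ptB {R : realType} (E : cell R) : pt R := nth 0 (enum_fset E) 1.
Definition len {R : realType} (E : cell R) : R := enorm (ptB E - ptA E).
Definition nrm {R : realType} (E : cell R) : pt R :=
  (len E)^-1 *: perp (ptB E - ptA E).

Definition line_int {R : realType} (E : cell R) (w : pt R -> R) : R :=
  len E * \int[lebesgue_measure]_(t in `[0, 1])
            w (ptA E + t *: (ptB E - ptA E)).

(* +1 if the triangle K lies on the side of its edge E to which [nrm E]        *)
(* points, -1 if it lies on the other side.                                    *)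
Definition side {R : realType} (K E : cell R) : R :=
  Num.sg (\sum_(v <- K) dot (nrm E) (v - ptA E)).
Definition outer_nrm {R : realType} (K E : cell R) : pt R :=
  - side K E *: nrm E.

(* The value at x (possibly on an edge of K) of w restricted to K. *)
Definition trace_from {R : realType} {V : normedModType R} (K : cell R)
    (w : pt R -> V) (x : pt R) : V :=
  lim (w y @[y --> within (elt K) (nbhs x)]).

(* On an interior edge the sum has the two terms w^+ and - w^-. *)
Definition jump {R : realType} {V : normedModType R} (T : mesh R) (E : cell R)
    (w : pt R -> V) (x : pt R) : V :=
  \sum_(K <- T | (E `<=` K)%fset) side K E *: trace_from K w x.

Definition P1 {R : realType} (Om : set (pt R)) (T : mesh R)
    (v : pt R -> pt R) :=
  {within closure Om, continuous v} /\
  forall K, K \in T -> affine_on (hull K) v.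

(* X^h_E; X^h_0 is the case g = 0. *)
Definition XhE {R : realType} (Om : set (pt R)) (T : mesh R)
    (g v : pt R -> pt R) :=
  P1 Om T v /\ forall x, boundary Om x -> v x = g x.
Definition Xh0 {R : realType} (Om : set (pt R)) (T : mesh R) :=
  XhE Om T (fun=> 0).

Definition Qh {R : realType} (Om : set (pt R)) (T : mesh R) (q : pt R -> R) :=
  L2 Om q /\ forall K, K \in T -> exists c, forall x, elt K x -> q x = c.

Definition is_L2_projection {R : realType} (Om : set (pt R)) (T : mesh R)
    (f fh : pt R -> pt R) :=
  (forall i, Qh Om T (component i fh)) /\
  forall q, (forall i, Qh Om T (component i q)) ->
    \int[leb2]_(x in Om) dot (f x - fh x) (q x) = 0.

Definition adjoining {R : realType} (K K' : cell R) : bool :=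
  (faces K `&` faces K' != fset0)%fset.

Definition macro_connected {R : realType} (M : mesh R) :=
  M != fset0 /\
  forall K K', K \in M -> K' \in M -> exists s : seq (cell R),
    [/\ {subset s <= M}, path adjoining K s & last K s = K'].

Definition interface {R : realType} (M1 M2 : mesh R) : {fset cell R} :=
  (edges M1 `&` edges M2)%fset.

(* The flux of v through the interface, out of M1. *)
Definition interface_flux {R : realType} (M1 M2 : mesh R) (v : pt R -> pt R) : R :=
  \sum_(E <- interface M1 M2) \sum_(K <- M1 | (E `<=` K)%fset)
    line_int E (fun x => dot (v x) (outer_nrm K E)).

Definition macro_partition {R : realType} (Om : set (pt R)) (T : mesh R)
    (Mh : {fset mesh R}) :=
  [/\ forall M, M \in Mh -> (M `<=` T)%fset /\ macro_connected M,
      forall M1 M2, M1 \in Mh -> M2 \in Mh -> M1 != M2 ->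
        [disjoint M1 & M2]%fset,
      forall M1 M2, M1 \in Mh -> M2 \in Mh -> M1 != M2 ->
        interface M1 M2 != fset0 ->
        exists v, [/\ Xh0 Om T v,
          closure (closure Om `&` [set x | v x != 0])
            `<=` region M1 `|` region M2
        & interface_flux M1 M2 v != 0]
    & [set x | exists2 M, M \in Mh & region M x] = closure Om].

Definition macro_equiv {R : realType} (M M' : mesh R) :=
  exists phi : pt R -> pt R,
    [/\ {within region M, continuous phi},
        set_bij (region M) (region M') phi
      & forall K, K \in M -> affine_on (hull K) phi /\
          exists2 K', K' \in M' & phi @` hull K = hull K'].

Definition finitely_many_classes {R : realType} (I : Type)
    (Mh : I -> {fset mesh R}) :=
  exists s : seq (mesh R), forall i M, M \in Mh i ->
    exists2 M', M' \in s & macro_equiv M M'.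

Definition boundary_edge {R : realType} (Om : set (pt R)) (E : cell R) : bool :=
  `[< hull E `<=` boundary Om >].

Definition Gamma {R : realType} (Om : set (pt R)) (M : mesh R) : {fset cell R} :=
  [fset E in edges M | ~~ boundary_edge Om E
     && (#|` [fset K in M | (E `<=` K)%fset]| == 2%N)]%fset.

Definition C_loc {R : realType} (mu : R) (Om : set (pt R)) (T : mesh R)
    (Mh : {fset mesh R}) (p q : pt R -> R) : R :=
  (2 * mu)^-1 * \sum_(M <- Mh) \sum_(E <- Gamma Om M)
    len E * line_int E (fun x => jump T E (p : pt R -> R^o) x
                                 * jump T E (q : pt R -> R^o) x).

Definition discrete_solution {R : realType} (F : formulation) (mu lam : R)
    (Om : set (pt R)) (T : mesh R) (Mh : {fset mesh R})
    (f g uh : pt R -> pt R) (ph : pt R -> R) :=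
  [/\ XhE Om T g uh, Qh Om T ph,
      forall v, Xh0 Om T v ->
        a_form F mu Om uh v + b_form Om v ph = load Om f v
    & forall q, Qh Om T q ->
        b_form Om uh q - c_form (kappa F mu lam) Om ph q
        - C_loc mu Om T Mh ph q = 0].

(* The classical gradient, used inside the elements for piecewise linear u. *)
Definition cgrad {R : realType} (u : pt R -> pt R) (x : pt R) : 'M[R]_2 :=
  \matrix_(i, j) pder j (component i u) x.

Definition edge_residual {R : realType} (F : formulation) (mu : R)
    (Om : set (pt R)) (T : mesh R) (uh : pt R -> pt R) (ph : pt R -> R)
    (E : cell R) (x : pt R) : pt R :=
  if boundary_edge Om E then 0
  else 2^-1 *: jump T E
    (fun y => - mxpt (stress F mu (cgrad uh y) (ph y)) (nrm E)) x.

Definition eta_R2 {R : realType} (mu : R) (fh : pt R -> pt R) (K : cell R) : R :=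
  (h_ K / Num.sqrt (2 * mu)) ^+ 2 *
  \int[leb2]_(x in elt K) dot (fh x) (fh x).

Definition eta_J2 {R : realType} (mu kap : R) (uh : pt R -> pt R)
    (ph : pt R -> R) (K : cell R) : R :=
  (kap^-1 + (2 * mu)^-1)^-1 *
  \int[leb2]_(x in elt K) ((\tr (cgrad uh x) + ph x / kap) ^+ 2).

Definition eta_E2 {R : realType} (F : formulation) (mu : R) (Om : set (pt R))
    (T : mesh R) (uh : pt R -> pt R) (ph : pt R -> R) (K : cell R) : R :=
  \sum_(E <- faces K) len E / (2 * mu) *
    line_int E (fun x => let r := edge_residual F mu Om T uh ph E x in dot r r).

Definition estimator {R : realType} (F : formulation) (mu lam : R)
    (Om : set (pt R)) (T : mesh R) (fh uh : pt R -> pt R) (ph : pt R -> R) : R :=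
  Num.sqrt (\sum_(K <- T)
    (eta_R2 mu fh K + eta_E2 F mu Om T uh ph K
     + eta_J2 mu (kappa F mu lam) uh ph K)).

Definition oscillation {R : realType} (mu : R) (T : mesh R)
    (f fh : pt R -> pt R) : R :=
  Num.sqrt (\sum_(K <- T) (h_ K / Num.sqrt (2 * mu)) ^+ 2 *
    \int[leb2]_(x in elt K) dot (f x - fh x) (f x - fh x)).

(* Main.v *)
Require Import Defs.
From mathcomp Require Import all_boot all_order all_algebra finmap.
From mathcomp Require Import all_classical all_reals all_analysis.
From mathcomp Require Import measurable_realfun ring lra.
Import Order.TTheory GRing.Theory Num.Theory.
Import numFieldNormedType.Exports.

(** Every term of the estimator becomes visible when the error is tested with a
suitable function.  Let [e = u - uh], let [sigma_h] be the discrete stress and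
let [sigma_e] be the stress of the error.  Testing the momentum balance with
the field [phi c], for a vector [c] and a test function [phi], gives
([error_identity])

  int sigma_h : (c (x) grad phi) =
    int (f . c) phi - int sigma_e : (c (x) grad phi).

Since [sigma_h] is constant on every triangle, a bump [phi] isolates one
residual.

- If [phi] is a bump on a disc inside [K], the left-hand side vanishes.  With
  [c = fh] on [K], what remains bounds [|fh|^2] by the oscillation and by the
  error ([interior_residual_bound]).

- If [phi] is a radial bump at the midpoint of an interior edge, on a disc
  covered by the two adjacent triangles, Green's formula on the two half discs
  turns the left-hand side into the jump of [sigma_h n] times the integral of
  [phi] over the diameter ([half_disc_flux], [flux_across_edge]).  With [c]
  the edge residual this bounds the jump ([jump_residual_bound]).

In both cases Young's inequality absorbs [|c|^2], and the inequality
[|sigma_e|^2 <= 8 mu (2 mu |grad e|^2 + (2 mu)^-1 |p - ph|^2)]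
([frob_stress_le]) provides the weights that make the constants independent of
the Lame coefficients.  Shape regularity makes the radii of the discs
comparable to the diameters of the triangles ([inscribed_disc],
[edge_patch]).

The residual of the constraint is a linear function of the error, because
[div u + p / kappa] vanishes almost everywhere (it is square integrable, hence
an admissible test function in its own equation), and
[rho_d <= min (2 mu) kappa].

The local bounds add up: distinct triangles have disjoint interiors, and an
edge belongs to at most two triangles ([face_overlap]).

The error is measured with the weak gradient, so the argument also needs that
the weak gradient of a continuous piecewise affine function is almost
everywhere its elementwise gradient ([wD_piecewise_affine]).  This uses the
uniqueness of weak derivatives, that is, the fundamental lemma of the calculus
of variations, and one integration by parts
([integral_directional_derivative0]): a compactly supported function that is
Lipschitz along a direction and has a directional derivative almost everywhere
is such that this derivative has integral zero, since the Lebesgue measure is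
invariant under translations.  The same lemma is behind the Green formula on
half discs. *)

Set Implicit Arguments.
Unset Strict Implicit.
Unset Printing Implicit Defensive.

Local Open Scope classical_set_scope.
Local Open Scope ring_scope.

(* The canonical basis of the plane, as opposed to the bases of a topology. *)
Local Notation basis := Defs.basis.

(** * Measurable sets and translations in the plane *)

Definition box {R : realType} (a b c d : R) : set (pt R) :=
  [set x | [/\ a < x.1, x.1 < b, c < x.2 & x.2 < d]].

Lemma box_prod {R : realType} (a b c d : R) :
  box a b c d = `]a, b[%classic `*` `]c, d[%classic.
Proof.
apply/seteqP; split => [[x y] /= [h1 h2 h3 h4]|[x y] /= []].
  by split; rewrite /= in_itv /= ?h1 ?h2 ?h3 ?h4.
by rewrite !in_itv /= => /andP[h1 h2] /andP[h3 h4]; split.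
Qed.

Lemma measurable_box {R : realType} (a b c d : R) : measurable (box a b c d).
Proof. by rewrite box_prod; apply: measurableX; exact: measurable_itv. Qed.

Definition cbox {R : realType} (a b c d : R) : set (pt R) :=
  [set x | [/\ a <= x.1, x.1 <= b, c <= x.2 & x.2 <= d]].

Lemma rat_between {R : realType} (a b : R) : a < b ->
  exists q : rat, a < ratr q /\ ratr q < b.
Proof.
by move=> /rat_in_itvoo[q]; rewrite in_itv /= => /andP[? ?]; exists q.
Qed.

Lemma open_rat_box {R : realType} (A : set (pt R)) (x : pt R) : open A -> A x ->
  exists q : rat * rat * rat * rat,
    box (ratr q.1.1.1) (ratr q.1.1.2) (ratr q.1.2) (ratr q.2) x /\
    cbox (ratr q.1.1.1) (ratr q.1.1.2) (ratr q.1.2) (ratr q.2) `<=` A.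
Proof.
move=> oA Ax.
have /nbhs_ballP[e /= e0 sub] : nbhs x A by exact: open_nbhs_nbhs.
have [q1 [q1l q1r]] := @rat_between R (x.1 - e) x.1 ltac:(lra).
have [q2 [q2l q2r]] := @rat_between R x.1 (x.1 + e) ltac:(lra).
have [q3 [q3l q3r]] := @rat_between R (x.2 - e) x.2 ltac:(lra).
have [q4 [q4l q4r]] := @rat_between R x.2 (x.2 + e) ltac:(lra).
exists (q1, q2, q3, q4); split => //= y /= [h1 h2 h3 h4].
apply: sub; split => /=; rewrite /ball /= ltr_norml; apply/andP; split; lra.
Qed.

(** Rational boxes make this union countable; this is how open sets are seen to
belong to the product sigma-algebra. *)
Lemma open_bigcup_box {R : realType} (A : set (pt R)) : open A ->
  A = \bigcup_(q in [set q : rat * rat * rat * rat |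
        cbox (ratr q.1.1.1) (ratr q.1.1.2) (ratr q.1.2) (ratr q.2) `<=` A])
        box (ratr q.1.1.1) (ratr q.1.1.2) (ratr q.1.2) (ratr q.2).
Proof.
move=> oA; apply/seteqP; split=> [x /(open_rat_box oA)[q [? ?]]|x [q /= + bq]].
  by exists q.
by apply; case: bq => ? ? ? ?; split; exact: ltW.
Qed.

Lemma open_measurable2 {R : realType} (A : set (pt R)) : open A -> measurable A.
Proof.
move=> oA; rewrite (open_bigcup_box oA) bigcup_mkcond.
apply: countable_bigcupT_measurable => [|q]; first exact: countableP.
by case: ifP => _; [exact: measurable_box|exact: measurable0].
Qed.

Lemma closed_measurable2 {R : realType} (A : set (pt R)) :
  closed A -> measurable A.
Proof. by move/closed_openC/open_measurable2/measurableC; rewrite setCK. Qed.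

Lemma open_continuous_measurable2 {R : realType} (D : set (pt R))
    (f : pt R -> R) :
  open D -> {in D, continuous f} -> measurable_fun D f.
Proof.
move=> oD cf mD.
apply: (measurability _ (@RGenOpens.measurableE R)) => //.
move=> _ [_ [a [b ->] <-]]; apply: open_measurable2.
rewrite openE => x /= [Dx fx]; apply: filterI; first exact: open_nbhs_nbhs.
by apply: cf; [rewrite inE|apply: open_nbhs_nbhs; split => //; exact: interval_open].
Qed.

Lemma continuous_measurable2 {R : realType} (f : pt R -> R) : continuous f ->
  measurable_fun setT f.
Proof.
move=> cf; apply: (@open_continuous_measurable2 R setT f openT) => x _.
exact: cf.
Qed.

Lemma dot_continuous {R : realType} (n : pt R) : continuous (dot n).
Proof.
move=> x; apply: cvgD; apply: cvgM; try exact: cvg_cst.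
  exact: cvg_fst.
exact: cvg_snd.
Qed.

Lemma line_null {R : realType} (n : pt R) (c : R) : n != 0 ->
  leb2 [set x | dot n x = c] = 0%E.
Proof.
case: n => n1 n2 n0; rewrite /dot /=.
have [n20|n20] := eqVneq n2 0.
  have n10 : n1 != 0 by apply: contra n0 => /eqP ->; rewrite n20.
  have -> : [set x : pt R | n1 * x.1 + n2 * x.2 = c] = [set c / n1] `*` setT.
    apply/seteqP; split => [[x y] /= <-|[x y] /= [-> _]].
      by split => //=; rewrite n20; field.
    by rewrite n20; field.
  rewrite /leb2 product_measure1E//= ?lebesgue_measure_set1 ?mul0e//.
rewrite /leb2 /product_measure1 /=.
apply: integral0_eq => x _ /=.
have -> : xsection [set x0 : pt R | n1 * x0.1 + n2 * x0.2 = c] x =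
    [set (c - n1 * x) / n2].
  apply/seteqP; split => y /=; rewrite /xsection /= inE /=.
    by move=> <-; field.
  by move=> ->; field.
exact: lebesgue_measure_set1.
Qed.

Lemma lebesgue_shift {R : realType} (t : R) (A : set R) : measurable A ->
  lebesgue_measure ((fun x => x + t : measurableTypeR R) @^-1` A)
  = lebesgue_measure A.
Proof.
move=> mA.
have ms : measurable_fun setT (fun x : measurableTypeR R => x + t : measurableTypeR R).
  exact: measurable_funD.
have := @lebesgue_measure_unique R (pushforward lebesgue_measure (fun x : measurableTypeR R => x + t : measurableTypeR R)).
move=> /(_ ms) H; symmetry; apply: H => // X [[a b]] _ <-.
have E : (fun x => x + t) @^-1` [set` `]a, b]] = [set` `]a - t, b - t]].
  by apply/seteqP; split => x /=; rewrite !in_itv /= ltrBlDr lerBrDr.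
transitivity (lebesgue_measure [set` `]a - t, b - t]]); last first.
  by rewrite -E.
rewrite !lebesgue_measure_itv /= !lte_fin ltrD2r.
by case: ifP => // _; rewrite -!EFinB; congr EFin; ring.
Qed.

Lemma shift_measurable2 {R : realType} (v : pt R) :
  measurable_fun setT (fun x : measurableTypeR R * measurableTypeR R =>
     x + v : measurableTypeR R * measurableTypeR R).
Proof.
apply/measurable_fun_pairP; split => /=; apply: measurable_funD => //=.
Qed.

Lemma leb2_shift {R : realType} (v : pt R) (A : set (pt R)) : measurable A ->
  leb2 ((fun x => x + v) @^-1` A) = leb2 A.
Proof.
move=> mA; apply/esym.
have := @product_measure_unique _ _ _ _ R lebesgue_measure lebesgue_measure (pushforward leb2 (fun x : measurableTypeR R * measurableTypeR R => (x + v)%R : measurableTypeR R * measurableTypeR R)).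
move=> /(_ (@shift_measurable2 R v)) H; apply: H => // B C mB mC.
transitivity (leb2 (((fun x => x + v.1 : measurableTypeR R) @^-1` B) `*`
                    ((fun x => x + v.2: measurableTypeR R) @^-1` C))); first by [].
have mB' : measurable ((fun x => x + v.1 : measurableTypeR R) @^-1` B).
  by rewrite -[X in measurable X]setTI; apply: measurable_funD.
have mC' : measurable ((fun x => x + v.2 : measurableTypeR R) @^-1` C).
  by rewrite -[X in measurable X]setTI; apply: measurable_funD.
by rewrite /leb2 product_measure1E//; congr (_ * _)%E; exact: lebesgue_shift.
Qed.

(** * Integrals of directional derivatives *)

Lemma integral_preserving d (X : measurableType d) (R : realType)
    (mu : {measure set X -> \bar R}) (phi : X -> X) (f : X -> \bar R) :
  measurable_fun setT phi ->
  (forall A, measurable A -> mu (phi @^-1` A) = mu A) ->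
  mu.-integrable setT f ->
  mu.-integrable setT (f \o phi) /\
  (\int[mu]_x f (phi x) = \int[mu]_x f x)%E.
Proof.
move=> mphi muE intf.
have mf := measurable_int _ intf.
have mfv : measurable_fun setT (f \o phi) by exact: measurableT_comp.
have E g : measurable_fun setT g -> (forall x, 0 <= g x)%E ->
    (\int[mu]_x g (phi x) = \int[mu]_x g x)%E.
  move=> mg g0.
  have /(_ measurableT mg (fun y _ => g0 y)) H :=
    @ge0_integral_pushforward _ _ _ _ R _ mphi mu setT g.
  rewrite -[LHS]H.
  by apply: eq_measure_integral => A mA _; exact: muE.
split.
  move/integrableP : intf => [_ fi]; apply/integrableP; split => //.
  by rewrite (E (fun x => `|f x|%E))//; apply: measurableT_comp.
rewrite integralE [RHS]integralE; congr (_ - _)%E.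
  rewrite -(E (f^\+)%E (measurable_funepos mf))//.
  by apply: eq_integral => x _; rewrite !funeposE.
rewrite -(E (f^\-)%E (measurable_funeneg mf))//.
by apply: eq_integral => x _; rewrite !funenegE.
Qed.

(** The difference quotients [c n * (f \o phi n - f)] have integral zero, because
[phi n] preserves the measure; dominated convergence passes this to their
limit. *)
Lemma integral_preserving_quotient0 d (X : measurableType d) (R : realType)
    (mu : {measure set X -> \bar R}) (phi : nat -> X -> X) (c : nat -> R)
    (f g G : X -> R) :
  (forall n, measurable_fun setT (phi n)) ->
  (forall n A, measurable A -> mu (phi n @^-1` A) = mu A) ->
  mu.-integrable setT (EFin \o f) ->
  measurable_fun setT g ->
  mu.-integrable setT (EFin \o G) ->
  (forall n x, `|c n * (f (phi n x) - f x)| <= G x) ->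
  {ae mu, forall x, c n * (f (phi n x) - f x) @[n --> \oo] --> g x} ->
  mu.-integrable setT (EFin \o g) /\ (\int[mu]_x (g x)%:E = 0)%E.
Proof.
move=> mphi muE intf mg intG le cv.
have [intn En] : (forall n, mu.-integrable setT (EFin \o (f \o phi n))) /\
    forall n, (\int[mu]_x (f (phi n x))%:E = \int[mu]_x (f x)%:E)%E.
  split=> n;
    by have [] := @integral_preserving _ _ _ mu _ _ (mphi n) (muE n) intf.
pose h n x := c n * (f (phi n x) - f x).
have inth n : mu.-integrable setT (EFin \o h n).
  rewrite (_ : EFin \o h n = (fun x => (c n)%:E * ((EFin \o (f \o phi n)) x - (EFin \o f) x))%E).
    by apply: integrableZl => //; apply: integrableB.
  by apply/funext => x.
have int0 n : (\int[mu]_x (h n x)%:E = 0)%E.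
  have i2 : mu.-integrable setT
      (fun x => (EFin \o (f \o phi n)) x - (EFin \o f) x)%E by exact: integrableB.
  transitivity (\int[mu]_x ((c n)%:E *
      ((EFin \o (f \o phi n)) x - (EFin \o f) x)))%E; first by [].
  rewrite (integralZl measurableT i2) (integralB measurableT (intn n) intf).
  rewrite [X in (X - _)%E](En n) subee ?mule0//.
  exact: integrable_fin_num intf.
have [||||| intg _ C] := @dominated_convergence _ _ _ mu setT measurableT
  (fun n => EFin \o h n) (EFin \o g) (EFin \o G).
- by move=> n; exact: (measurable_int _ (inth n)).
- exact/measurable_EFinP.
- apply: filterS cv => x cx _ /=.
  by apply: cvg_EFin => //; exact: nearW.
- by [].
- by apply: nearW => x n _ /=; rewrite lee_fin; exact: le.
split => //.
have C0 : [sequence (\int[mu]_x (EFin \o h n) x)%E]_n @ \oo --> (0%:E : \bar R).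
  rewrite (_ : [sequence _]_n = fun=> 0%E); first exact: cvg_cst.
  by apply/funext => n; exact: int0.
exact: (cvg_unique _ C C0).
Qed.

Lemma cbox_prod {R : realType} (a b c d : R) :
  cbox a b c d = `[a, b]%classic `*` `[c, d]%classic.
Proof.
apply/seteqP; split => [[x y] /= [h1 h2 h3 h4]|[x y] /= []].
  by split; rewrite /= in_itv /= ?h1 ?h2 ?h3 ?h4.
by rewrite !in_itv /= => /andP[h1 h2] /andP[h3 h4]; split.
Qed.

Lemma measurable_cbox {R : realType} (a b c d : R) : measurable (cbox a b c d).
Proof. by rewrite cbox_prod; apply: measurableX; exact: measurable_itv. Qed.

Lemma leb2_cbox {R : realType} (a b c d : R) : a <= b -> c <= d ->
  leb2 (cbox a b c d) = ((b - a) * (d - c))%:E.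
Proof.
move=> ab cd; rewrite cbox_prod /leb2 product_measure1E//.
have E (x y : R) : x <= y -> lebesgue_measure `[x, y]%classic = (y - x)%:E.
  rewrite lebesgue_measure_itv /= lte_fin le_eqVlt => /predU1P[->|->//].
  by rewrite ltxx subrr.
by rewrite EFinM; congr (_ * _)%E; apply: E.
Qed.

Lemma integrable_scaled_indic d (X : measurableType d) (R : realType)
    (mu : {measure set X -> \bar R}) (A : set X) (B : R) :
  measurable A -> (mu A < +oo)%E ->
  mu.-integrable setT (EFin \o (fun x => B * \1_A x)).
Proof.
move=> mA Afin.
have iA : mu.-integrable setT (EFin \o (\1_A : X -> R)).
  apply/integrableP; split; first exact/measurable_EFinP/measurable_indic.
  under eq_integral => x _ do rewrite /= ger0_norm//.
  by rewrite integral_indic// setIT.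
rewrite (_ : EFin \o _ = (fun x => B%:E * (EFin \o (\1_A : X -> R)) x)%E).
  exact: integrableZl.
by apply/funext.
Qed.

Lemma integrable_bounded_on d (X : measurableType d) (R : realType)
    (mu : {measure set X -> \bar R}) (A : set X) (B : R) (f : X -> R) :
  measurable A -> (mu A < +oo)%E -> measurable_fun setT f ->
  (forall x, `|f x| <= B * \1_A x) -> mu.-integrable setT (EFin \o f).
Proof.
move=> mA Afin mf fB.
apply: (le_integrable measurableT _ _ (integrable_scaled_indic B mA Afin)).
  exact/measurable_EFinP.
by move=> x _ /=; rewrite lee_fin (le_trans (fB x))// ler_norm.
Qed.

Lemma leb2_cbox_fin {R : realType} (M : R) : (leb2 (cbox (- M) M (- M) M) < +oo)%E.
Proof.
have [M0|M0] := leP 0 M; first by rewrite leb2_cbox ?ltry//; lra.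
have -> : cbox (- M) M (- M) M = set0; last by rewrite /leb2 measure0 ltry.
by apply/seteqP; split => // x [/= h1 h2 _ _]; lra.
Qed.

Lemma leb2_ae_imp {R : realType} (P Q : pt R -> Prop) :
  (forall x, P x -> Q x) ->
  {ae leb2, forall x, P x} -> {ae leb2, forall x, Q x}.
Proof.
move=> PQ [N [mN N0 sN]]; exists N; split => // x nQ.
by apply: sN => /= Px; apply: nQ; exact: PQ.
Qed.

Lemma leb2_ae_and {R : realType} (P Q : pt R -> Prop) :
  {ae leb2, forall x, P x} -> {ae leb2, forall x, Q x} ->
  {ae leb2, forall x, P x /\ Q x}.
Proof.
move=> [N [mN N0 sN]] [M [mM M0 sM]]; exists (N `|` M); split.
- exact: measurableU.
- by rewrite /leb2 null_set_setU.
- move=> x /= nPQ; apply: contrapT => /not_orP[nN nM]; apply: nPQ; split.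
    by apply: contrapT => h; apply: nN; exact: sN.
  by apply: contrapT => h; apply: nM; exact: sM.
Qed.

(** Applies the previous lemma to the translations by [harmonic n *: d].  The
function is only asked to be Lipschitz along [d] and differentiable almost
everywhere, which covers both products with piecewise affine functions and
products with the indicator of a half plane parallel to [d]. *)
Lemma integral_directional_derivative0 {R : realType} (psi g : pt R -> R)
    (d : pt R) (L M B : R) :
  measurable_fun setT psi -> measurable_fun setT g ->
  (forall x t, `|psi (x + t *: d) - psi x| <= L * `|t|) ->
  (forall x, `|psi x| <= B) ->
  (forall x, psi x != 0 -> cbox (- M) M (- M) M x) ->
  {ae leb2, forall x, is_derive x d psi (g x)} ->
  leb2.-integrable setT (EFin \o g) /\ (\int[leb2]_x (g x)%:E = 0)%E.
Proof.
move=> mpsi mg Lip Bd Sup der.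
(* A box that contains the supports of all the difference quotients. *)
pose M' := `|M| + `|d.1| + `|d.2|.
have bound n (x : pt R) :
    `|(harmonic n)^-1 * (psi (x + harmonic n *: d) - psi x)| <=
    L * \1_(cbox (- M') M' (- M') M') x.
  have h0 : 0 < harmonic n :> R by rewrite /harmonic /= invr_gt0.
  have h1 : harmonic n <= 1 :> R.
    by rewrite /harmonic /= invf_le1// ler1n.
  rewrite indicE; have [xM|xM] := boolP (x \in _).
    rewrite mulr1 normrM gtr0_norm ?invr_gt0// mulrC ler_pdivrMr//.
    by rewrite (le_trans (Lip _ _))// gtr0_norm.
  rewrite mulr0 normr_le0 mulf_eq0 subr_eq0; apply/orP; right.
  have bM : M <= `|M| by exact: ler_norm.
  have b1 : `|harmonic n * d.1| <= `|d.1|.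
    by rewrite normrM gtr0_norm// ler_piMl.
  have b2 : `|harmonic n * d.2| <= `|d.2|.
    by rewrite normrM gtr0_norm// ler_piMl.
  have E y : cbox (- M) M (- M) M y ->
    (y = x \/ y = x + harmonic n *: d) -> False.
    move=> [c1 c2 c3 c4] yx; move/negP: xM; apply; rewrite inE.
    have := normr_ge0 d.1; have := normr_ge0 d.2.
    move: b1 b2; rewrite !ler_norml => /andP[? ?] /andP[? ?] ? ?.
    have s1 : (x + harmonic n *: d).1 = x.1 + harmonic n * d.1 by [].
    have s2 : (x + harmonic n *: d).2 = x.2 + harmonic n * d.2 by [].
    by case: yx c1 c2 c3 c4 => ->; rewrite ?s1 ?s2 => *; split; rewrite /M'; lra.
  have -> : psi x = 0.
    apply/eqP/negP => /negP p0; apply: (E x); [exact: Sup|by left].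
  apply/negPn/negP => p0; apply: (E _ (Sup _ p0)); by right.
apply: (@integral_preserving_quotient0 _ _ _ leb2
  (fun n x => x + harmonic n *: d) (fun n => (harmonic n)^-1) psi g
  (fun x => L * \1_(cbox (- M') M' (- M') M') x)).
- by move=> n; exact: shift_measurable2.
- by move=> n A mA; exact: leb2_shift.
- apply: (@integrable_bounded_on _ _ _ leb2 (cbox (- M) M (- M) M) B) => //.
  + exact: measurable_cbox.
  + exact: leb2_cbox_fin.
  + move=> x; have [p0|p0] := eqVneq (psi x) 0.
      rewrite p0 normr0 mulr_ge0// ?indicE//.
      by rewrite (le_trans _ (Bd x)).
    by rewrite indicE mem_set ?mulr1; [exact: Bd|exact: Sup].
- by [].
- apply: integrable_scaled_indic; first exact: measurable_cbox.
  exact: leb2_cbox_fin.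
- exact: bound.
- apply: leb2_ae_imp der => x [dx dv].
  have : (fun h => h^-1 *: ((psi \o shift x) (h *: d) - psi x)) @ 0^' --> g x.
    by rewrite -dv; exact: dx.
  move=> cv.
  have hc : harmonic @ \oo --> (0:R)^'.
    move=> A /= nA.
    have H : \forall n \near \oo, harmonic n != 0 :> R -> A (harmonic n).
      exact: (@cvg_harmonic R _ nA).
    suff : \forall n \near \oo, A (harmonic n) by [].
    by apply: filterS H => n; apply; apply: lt0r_neq0; rewrite /harmonic /= invr_gt0.
  have E : (fun n => (harmonic n)^-1 * (psi (x + harmonic n *: d) - psi x)) =
      (fun h => h^-1 *: ((psi \o shift x) (h *: d) - psi x)) \o harmonic.
    by apply/funext => n /=; rewrite (addrC x).
  by rewrite E; exact: cvg_comp hc cv.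
Qed.

(** * Smooth bump functions *)

(** Reduces directional derivatives to the one-variable theory. *)
Lemma is_derive_line {R : realType} (f : pt R -> R) (x v : pt R) (l : R) :
  is_derive x v f l <-> is_derive (0 : R) 1 (fun h : R => f (x + h *: v)) l.
Proof.
have E : (fun h : R => h^-1 *: ((f \o shift x) (h *: v) - f x)) =
   (fun h : R => h^-1 *: (((fun h : R => f (x + h *: v)) \o shift (0:R)) (h *: (1:R))
       - (fun h : R => f (x + h *: v)) 0)).
  apply/funext => h /=; rewrite addr0 scale0r addr0 (addrC x).
  by rewrite /GRing.scale /= mulr1.
by split => -[d1 d2]; split; move: d1 d2; rewrite /derivable /derive E.
Qed.

Lemma is_derive_comp_line {R : realType} (F : R -> R) (q : pt R -> R)
    (x v : pt R) (a b : R) :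
  is_derive (q x) 1 F a -> is_derive x v q b ->
  is_derive x v (F \o q) (a * b).
Proof.
move=> dF /is_derive_line dq; apply/is_derive_line.
have H := @is_derive1_comp R F (fun h => q (x + h *: v)) 0 a b.
by apply: H => //; rewrite scale0r addr0.
Qed.

(** The flat function [exp (-1/t)], with a polynomial factor in [1/t] that makes
the family stable under differentiation. *)
Definition ebump {R : realType} (P : {poly R}) (t : R) : R :=
  if 0 < t then P.[t^-1] * expR (- t^-1) else 0.

(** The exponential beats every power: [x ^ (i+1) <= (i+1)! exp x] at [x = 1/t]. *)
Lemma ebump_le_linear {R : realType} (P : {poly R}) :
  exists C : R, 0 <= C /\ forall t, `|ebump P t| <= C * `|t|.
Proof.
exists (\sum_(i < size P) `|P`_i| * (i.+1)`!%:R); split.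
  by apply: sumr_ge0 => i _; rewrite mulr_ge0.
move=> t; rewrite /ebump; case: ifPn => [t0|_]; last first.
  rewrite normr0 mulr_ge0// sumr_ge0// => i _; by rewrite mulr_ge0.
rewrite normrM (gtr0_norm t0) (gtr0_norm (expR_gt0 _)).
rewrite horner_coef mulr_suml.
apply: (@le_trans _ _ (\sum_(i < size P) `|P`_i| * (t^-1) ^+ i * expR (- t^-1))).
  rewrite -mulr_suml ler_wpM2r ?expR_ge0//.
  apply: (le_trans (ler_norm_sum _ _ _)); apply: ler_sum => i _.
  by rewrite normrM normrX (@gtr0_norm _ t^-1) ?invr_gt0.
apply: ler_sum => i _; rewrite -!mulrA ler_wpM2l//.
have ti : 0 < t^-1 by rewrite invr_gt0.
have H := @expR_ge1Dxn R (t^-1) i (ltW ti).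
rewrite expRN.
rewrite -(ler_pM2r (expR_gt0 (t^-1))) mulfVK ?gt_eqF ?expR_gt0//.
have f0 : 0 < (i.+1)`!%:R :> R by rewrite ltr0n fact_gt0.
have H2 : t^-1 ^+ i.+1 / (i.+1)`!%:R <= expR t^-1 by lra.
rewrite ler_pdivrMr// exprS in H2.
have -> : t^-1 ^+ i = t * (t^-1 * t^-1 ^+ i) by field; lra.
by rewrite (mulrC _ t) -mulrA ler_pM2l// [leRHS]mulrC.
Qed.

Lemma ebump_le0 {R : realType} (P : {poly R}) (t : R) : t <= 0 -> ebump P t = 0.
Proof. by move=> t0; rewrite /ebump ltNge t0. Qed.

Definition ebump_step {R : realType} (P : {poly R}) : {poly R} :=
  'X^2 * (P - P^`()).

(** At the origin, [ebump P t = t * ebump ('X * P) t] is quadratically small. *)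
Lemma is_derive_ebump {R : realType} (P : {poly R}) (t : R) :
  is_derive t 1 (ebump P) (ebump (ebump_step P) t).
Proof.
have [t0|t0|t0] := ltgtP t 0.
- rewrite (ebump_le0 _ (ltW t0)).
  have H : is_derive t 1 (cst (0 : R)) 0 by exact: is_derive_cst.
  apply: near_eq_is_derive H.
  near=> y; rewrite ebump_le0//; apply: ltW; near: y.
  exact: lt_nbhsl.
- have tn0 : t != 0 by rewrite gt_eqF.
  have dV : is_derive t (1:R) (fun y : R => y^-1) (- t ^- 2 *: 1).
    exact: (@is_deriveV _ id).
  have d1 := is_derive1_comp (is_derive_poly P t^-1) dV.
  have d2 := @is_derive1_comp R expR (fun y => - y^-1) t _ _
    (is_derive_expR (- t^-1)) (is_deriveN dV).
  have H := is_deriveM d1 d2.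
  have {}H : is_derive t 1 (fun y => P.[y^-1] * expR (- y^-1)) (ebump (ebump_step P) t).
    apply: is_derive_eq H _.
    rewrite /ebump t0 /ebump_step /GRing.scale /= !hornerE /= exprVn.
    by ring.
  apply: near_eq_is_derive H.
  near=> y; rewrite /ebump ifT//; near: y.
  exact: lt_nbhsr.
- have [C [C0 HC]] := ebump_le_linear ('X * P).
  have E h : `|ebump P h| <= C * `|h| ^+ 2.
    have [h0|h0] := leP h 0.
      by rewrite ebump_le0// normr0 mulr_ge0// exprn_ge0.
    have -> : ebump P h = h * ebump ('X * P) h.
      by rewrite /ebump h0 !hornerE /=; field; rewrite gt_eqF.
    by rewrite normrM expr2 mulrCA ler_wpM2l.
  rewrite t0 (ebump_le0 _ (lexx 0)).
  have cv : (fun h : R => h^-1 *: ((ebump P \o shift 0) (h *: 1) - ebump P 0)) @ 0^' --> (0:R).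
    apply/cvgr0Pnorm_le => e e0; near=> h.
    have hn0 : h != 0 by near: h; exact: nbhs_dnbhs_neq.
    rewrite /= addr0 (ebump_le0 _ (lexx 0)) subr0 scaler1 normrM normfV.
    rewrite mulrC ler_pdivrMr ?normr_gt0// (le_trans (E h))// expr2 mulrA.
    rewrite ler_wpM2r//.
    apply: (@le_trans _ _ ((C + 1) * `|h|)); first by rewrite ler_wpM2r//; lra.
    rewrite -ler_pdivlMl; last lra.
    near: h; apply: dnbhs0_le; rewrite mulr_gt0// invr_gt0; lra.
  split; first by apply/cvg_ex; exists 0.
  exact: cvg_lim cv.
Unshelve. all: by end_near. Qed.

Lemma smooth_continuous {R : realType} (phi : pt R -> R) :
  smooth phi -> continuous phi.
Proof. by move=> /(_ [::])[]. Qed.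

Lemma smooth_derivable {R : realType} (phi : pt R -> R) i x :
  smooth phi -> derivable phi x (basis i).
Proof. by move=> /(_ [::])[_]. Qed.

Lemma smooth_pder {R : realType} (phi : pt R -> R) i :
  smooth phi -> smooth (pder i phi).
Proof. by move=> sp s; rewrite -foldr_rcons; exact: sp. Qed.

Lemma smooth_is_derive {R : realType} (phi : pt R -> R) i x :
  smooth phi -> is_derive x (basis i) phi (pder i phi x).
Proof. by move=> sp; split => //; exact: smooth_derivable. Qed.

(** A coinduction principle for smoothness: it suffices to find a class of
continuous functions that is closed under partial derivatives. *)
Lemma smooth_coind {R : realType} (C : (pt R -> R) -> Prop) :
  (forall phi, C phi -> continuous phi /\
     forall i, exists2 dphi, C dphi &
       forall x, is_derive x (basis i) phi (dphi x)) ->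
  forall phi, C phi -> smooth phi.
Proof.
move=> HC phi Cphi s.
have : C (foldr pder phi s).
  elim: s => //= i s /HC[_ /(_ i)[dphi Cd dphiE]].
  rewrite (_ : pder i _ = dphi)//.
  by apply/funext => x; rewrite /pder; apply: (@derive_val _ _ _ _ _ _ _ (dphiE x)).
move=> /HC[cp dp]; split => // i x; have [dphi _ H] := dp i.
exact: (@ex_derive _ _ _ _ _ _ _ (H x)).
Qed.

Lemma smooth_cst {R : realType} (c : R) : smooth (fun _ : pt R => c).
Proof.
apply: (@smooth_coind R (fun f => exists c, f = cst c)); last by exists c.
move=> _ [a ->]; split; first by move=> x; exact: cvg_cst.
by move=> i; exists (cst 0); [exists 0|move=> x; exact: is_derive_cst].
Qed.

(** By the Leibniz rule the products of smooth functions are not closed under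
derivation, but their finite sums are. *)
Inductive sum_of_products {R : realType} : (pt R -> R) -> Prop :=
| ProdOfSmooth f g : smooth f -> smooth g -> sum_of_products (fun x => f x * g x)
| AddOfProds f g : sum_of_products f -> sum_of_products g ->
    sum_of_products (fun x => f x + g x).

Lemma smooth_sum_of_products {R : realType} (f : pt R -> R) :
  sum_of_products f -> smooth f.
Proof.
apply: smooth_coind => {}f; elim => {f} [f g sf sg|f g _ [cf df] _ [cg dg]].
  split=> [x|i].
    by apply: cvgM; exact: smooth_continuous.
  exists (fun x => f x * pder i g x + g x * pder i f x).
    exact: (AddOfProds (ProdOfSmooth sf (smooth_pder i sg)) (ProdOfSmooth sg (smooth_pder i sf))).
  by move=> x; exact: is_deriveM (smooth_is_derive i x sf) (smooth_is_derive i x sg).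
split=> [x|i]; first by apply: cvgD; [exact: cf|exact: cg].
have [a Ca fa] := df i; have [b Cb gb] := dg i.
exists (fun x => a x + b x); first exact: AddOfProds Ca Cb.
by move=> x; exact: is_deriveD (fa x) (gb x).
Qed.

Lemma smoothM {R : realType} (f g : pt R -> R) :
  smooth f -> smooth g -> smooth (fun x => f x * g x).
Proof.
by move=> sf sg; apply: smooth_sum_of_products; exact: ProdOfSmooth.
Qed.

Lemma smoothD {R : realType} (f g : pt R -> R) :
  smooth f -> smooth g -> smooth (fun x => f x + g x).
Proof.
move=> sf sg.
have E : (fun x => f x + g x) = (fun x => f x * 1 + g x * 1).
  by apply/funext => x; rewrite !mulr1.
rewrite E; apply: smooth_sum_of_products.
exact: (AddOfProds (ProdOfSmooth sf (smooth_cst 1)) (ProdOfSmooth sg (smooth_cst 1))).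
Qed.

Lemma is_derive_affine1 {R : realType} (a b t : R) :
  is_derive t 1 (fun h : R => a + h * b) b.
Proof.
have H := is_deriveD (is_derive_cst a t (1:R))
  (is_deriveM (is_derive_id t (1:R)) (is_derive_cst b t (1:R))).
apply: is_derive_eq H _.
by rewrite /GRing.scale /= mulr0 add0r mulr1 add0r.
Qed.

Lemma dotDr {R : realType} (n x y : pt R) : dot n (x + y) = dot n x + dot n y.
Proof. by rewrite /dot /=; ring. Qed.

Lemma dotZr {R : realType} (n x : pt R) (a : R) : dot n (a *: x) = a * dot n x.
Proof. by rewrite /dot /= /GRing.scale /=; ring. Qed.

Lemma dotC {R : realType} (x y : pt R) : dot x y = dot y x.
Proof. by rewrite /dot; ring. Qed.

Lemma dotBr {R : realType} (n x y : pt R) : dot n (x - y) = dot n x - dot n y.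
Proof. by rewrite /dot /=; ring. Qed.

Lemma is_derive_dot {R : realType} (n x v : pt R) :
  is_derive x v (dot n) (dot n v).
Proof.
apply/is_derive_line.
rewrite (_ : (fun h : R => _) = (fun h => dot n x + h * dot n v)).
  exact: is_derive_affine1.
by apply/funext => h; rewrite dotDr dotZr.
Qed.

Lemma smooth_dot {R : realType} (n : pt R) : smooth (dot n).
Proof.
apply: (@smooth_coind R (fun f => f = dot n \/ smooth f)); last by left.
move=> f [->|sf]; last first.
  split; first exact: smooth_continuous.
  move=> i; exists (pder i f); first (by right; exact: smooth_pder).
  by move=> x; exact: smooth_is_derive.
split; first exact: dot_continuous.
move=> i; exists (cst (dot n (basis i))); first by right; exact: smooth_cst.
by move=> x; exact: is_derive_dot.
Qed.

(** The class generated by [ebump P \o q] under partial derivatives. *)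
Inductive ebump_class {R : realType} (q : pt R -> R) : (pt R -> R) -> Prop :=
| SmoothMulEbump phi P : smooth phi -> ebump_class q (fun x => phi x * ebump P (q x))
| AddSmoothMulEbump f g : ebump_class q f -> ebump_class q g ->
    ebump_class q (fun x => f x + g x).

Lemma ebump_continuous {R : realType} (P : {poly R}) : continuous (ebump P).
Proof.
move=> t; apply: differentiable_continuous; apply/derivable1_diffP.
exact: (@ex_derive _ _ _ _ _ _ _ (is_derive_ebump P t)).
Qed.

Lemma is_derive_ebump_comp {R : realType} (P : {poly R}) (q : pt R -> R)
    (x v : pt R) (l : R) :
  is_derive x v q l ->
  is_derive x v (ebump P \o q) (ebump (ebump_step P) (q x) * l).
Proof. by move=> dq; apply: is_derive_comp_line => //; exact: is_derive_ebump. Qed.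

Lemma smooth_ebump_class {R : realType} (q f : pt R -> R) : smooth q ->
  ebump_class q f -> smooth f.
Proof.
move=> sq; apply: smooth_coind => {}f.
elim => {f} [phi P sp|f g _ [cf df] _ [cg dg]].
  split=> [x|i].
    apply: cvgM; first exact: smooth_continuous.
    apply: (@continuous_comp _ _ _ q (ebump P)).
      exact: smooth_continuous.
    exact: ebump_continuous.
  exists (fun x => (phi x * pder i q x) * ebump (ebump_step P) (q x) +
                   pder i phi x * ebump P (q x)).
    exact: (AddSmoothMulEbump (SmoothMulEbump q _ (smoothM sp (smooth_pder i sq)))
                 (SmoothMulEbump q P (smooth_pder i sp))).
  move=> x; have H := is_deriveM (smooth_is_derive i x sp)
    (is_derive_ebump_comp P (smooth_is_derive i x sq)).
  apply: is_derive_eq H _.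
  by rewrite /GRing.scale /=; ring.
split=> [x|i]; first by apply: cvgD; [exact: cf|exact: cg].
have [a Ca fa] := df i; have [b Cb gb] := dg i.
exists (fun x => a x + b x); first exact: AddSmoothMulEbump Ca Cb.
by move=> x; exact: is_deriveD (fa x) (gb x).
Qed.

Lemma smooth_ebump {R : realType} (P : {poly R}) (q : pt R -> R) :
  smooth q -> smooth (fun x => ebump P (q x)).
Proof.
move=> sq.
have -> : (fun x => ebump P (q x)) = (fun x => 1 * ebump P (q x)).
  by apply/funext => x; rewrite mul1r.
by apply: (smooth_ebump_class sq); apply: SmoothMulEbump; exact: smooth_cst.
Qed.

Lemma compact_cbox {R : realType} (a b c d : R) : compact (cbox a b c d).
Proof. by rewrite cbox_prod; apply: compact_setX; exact: segment_compact. Qed.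

Definition disc {R : realType} (m : pt R) (r : R) : set (pt R) :=
  [set x | dot (x - m) (x - m) <= r ^+ 2].

Lemma dot_ge0 {R : realType} (x : pt R) : 0 <= dot x x.
Proof. by rewrite /dot -!expr2 addr_ge0// sqr_ge0. Qed.

Lemma smooth_sqdist {R : realType} (m : pt R) :
  smooth (fun x => dot (x - m) (x - m)).
Proof.
have -> : (fun x : pt R => dot (x - m) (x - m)) =
    (fun x => (dot (1, 0) x + - m.1) * (dot (1, 0) x + - m.1) +
              (dot (0, 1) x + - m.2) * (dot (0, 1) x + - m.2)).
  by apply/funext => x; rewrite /dot /=; ring.
by apply: smoothD; apply: smoothM; apply: smoothD;
  first [exact: smooth_dot|exact: smooth_cst].
Qed.

Lemma closed_disc {R : realType} (m : pt R) (r : R) : closed (disc m r).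
Proof.
have -> : disc m r = (fun x => dot (x - m) (x - m)) @^-1` [set y | y <= r ^+ 2].
  by [].
apply: preimage_closed; last exact: closed_le.
by move=> x _; exact: (smooth_continuous (smooth_sqdist m)).
Qed.

Lemma disc_sub_cbox {R : realType} (m : pt R) (r : R) : 0 <= r ->
  disc m r `<=` cbox (m.1 - r) (m.1 + r) (m.2 - r) (m.2 + r).
Proof.
move=> r0 x; rewrite /disc /dot /= => H.
have h1 : `|x.1 - m.1| <= r.
  rewrite -(@ler_pXn2r _ 2) ?nnegrE//= real_normK ?num_real//.
  by have := sqr_ge0 (x.2 - m.2); move: H; rewrite -!expr2; lra.
have h2 : `|x.2 - m.2| <= r.
  rewrite -(@ler_pXn2r _ 2) ?nnegrE//= real_normK ?num_real//.
  by have := sqr_ge0 (x.1 - m.1); move: H; rewrite -!expr2; lra.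
move: h1 h2; rewrite !ler_norml => /andP[? ?] /andP[? ?]; split; lra.
Qed.

Lemma compact_disc {R : realType} (m : pt R) (r : R) : 0 <= r ->
  compact (disc m r).
Proof.
move=> r0; apply: subclosed_compact (disc_sub_cbox r0); first exact: closed_disc.
exact: compact_cbox.
Qed.

Lemma test_fun_of_disc {R : realType} (Om : set (pt R)) (m : pt R) r phi : 0 <= r ->
  smooth phi -> (forall x, phi x != 0 -> disc m r x) -> disc m r `<=` Om ->
  test_fun Om phi.
Proof.
move=> r0 sphi sup sub; have cS : closure [set x | phi x != 0] `<=` disc m r.
  apply: (@subset_trans _ (closure (disc m r))).
    by apply: closure_subset => x /= p0; exact: sup.
  by move: (@closed_disc R m r) => /closure_id <-.
split; [by []| |exact: subset_trans sub].
by apply: subclosed_compact cS; [exact: closed_closure|exact: compact_disc].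
Qed.

Definition rbump {R : realType} (m : pt R) (r : R) (x : pt R) : R :=
  ebump 1 (1 - dot (x - m) (x - m) / r ^+ 2).

(** Up to the factor [- 2 (x - m) / r ^ 2], the gradient of [rbump m r]. *)
Definition rbump' {R : realType} (m : pt R) (r : R) (x : pt R) : R :=
  ebump 'X^2 (1 - dot (x - m) (x - m) / r ^+ 2).

Lemma smooth_rbump {R : realType} (m : pt R) (r : R) : smooth (rbump m r).
Proof.
apply: smooth_ebump.
have -> : (fun x : pt R => 1 - dot (x - m) (x - m) / r ^+ 2) =
    (fun x => 1 + (- r ^- 2) * dot (x - m) (x - m)).
  by apply/funext => x; ring.
apply: smoothD; first exact: smooth_cst.
by apply: smoothM; [exact: smooth_cst|exact: smooth_sqdist].
Qed.

Lemma is_derive_sqdist {R : realType} (m x v : pt R) :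
  is_derive x v (fun x => dot (x - m) (x - m)) (2 * dot (x - m) v).
Proof.
have H1 := is_deriveD (is_derive_dot (1,0) x v) (is_derive_cst (- m.1) x v).
have H2 := is_deriveD (is_derive_dot (0,1) x v) (is_derive_cst (- m.2) x v).
have H := is_deriveD (is_deriveM H1 H1) (is_deriveM H2 H2).
rewrite (_ : (fun _ => _) = (dot (1, 0) + cst (- m.1)) * (dot (1, 0) + cst (- m.1))
   + (dot (0, 1) + cst (- m.2)) * (dot (0, 1) + cst (- m.2))).
  apply: is_derive_eq H _.
  by rewrite /GRing.scale /= /dot !addrfctE /=; ring.
by apply/funext => y; rewrite !addrfctE !mulrfctE /dot /=; ring.
Qed.

Lemma is_derive_rbump {R : realType} (m x v : pt R) (r : R) :
  is_derive x v (rbump m r) (- (2 / r ^+ 2) * dot (x - m) v * rbump' m r x).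
Proof.
have H1 := is_deriveM (is_derive_cst (- r ^- 2) x v) (is_derive_sqdist m x v).
have H2 := is_deriveD (is_derive_cst (1 : R) x v) H1.
have E : (cst 1 + cst (- r ^- 2) * (fun x => dot (x - m) (x - m))) =
   (fun x : pt R => 1 - dot (x - m) (x - m) / r ^+ 2).
  by apply/funext => y; rewrite !addrfctE !mulrfctE /=; ring.
rewrite E in H2.
have H3 := is_derive_ebump_comp 1 H2; apply: (is_derive_eq H3).
rewrite /ebump_step derivC subr0 mulr1 /rbump' /GRing.scale /=.
by ring.
Qed.

Lemma pder_rbump {R : realType} (m x : pt R) (r : R) i :
  pder i (rbump m r) x = - (2 / r ^+ 2) * dot (x - m) (basis i) * rbump' m r x.
Proof. by rewrite /pder; apply: derive_val; exact: is_derive_rbump. Qed.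

Lemma rbump_support {R : realType} (m : pt R) (r : R) (x : pt R) : 0 < r ->
  r ^+ 2 <= dot (x - m) (x - m) -> rbump m r x = 0 /\ rbump' m r x = 0.
Proof.
move=> r0 H; rewrite /rbump /rbump' !ebump_le0//.
  by rewrite subr_le0 ler_pdivlMr ?exprn_gt0// mul1r.
by rewrite subr_le0 ler_pdivlMr ?exprn_gt0// mul1r.
Qed.

Lemma rbump_ge0 {R : realType} (m : pt R) (r : R) (x : pt R) : 0 <= rbump m r x.
Proof.
rewrite /rbump /ebump; case: ifP => // _.
by rewrite hornerE mul1r expR_ge0.
Qed.

Lemma rbump_le1 {R : realType} (m : pt R) (r : R) (x : pt R) : rbump m r x <= 1.
Proof.
rewrite /rbump /ebump; case: ifP => // t0; rewrite hornerE mul1r.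
set s := (_ - _)^-1; have s0 : 0 <= s by rewrite invr_ge0 ltW.
by rewrite -[leRHS]expR0 ler_expR oppr_le0.
Qed.

Lemma rbump'_bounds {R : realType} (m : pt R) (r : R) (x : pt R) :
  0 <= rbump' m r x <= 2.
Proof.
rewrite /rbump' /ebump; case: ifP => [t0|_]; last by rewrite lexx ler0n.
set s := (_ - _)^-1; rewrite hornerXn expRN.
have s0 : 0 <= s by rewrite invr_ge0 ltW.
rewrite mulr_ge0 ?exprn_ge0 ?invr_ge0 ?expR_ge0//=; last exact: ltW.
rewrite ler_pdivrMr ?expR_gt0//.
have := @expR_ge1Dxn R s 1 s0; rewrite (_ : 2`! = 2)%N//.
by rewrite -[X in X <= _](mulfVK (_ : 2 != 0 :> R))//; lra.
Qed.

Lemma test_fun_rbump {R : realType} (Om : set (pt R)) (m : pt R) (r : R) :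
  0 < r -> disc m r `<=` Om -> test_fun Om (rbump m r).
Proof.
move=> r0 sub; apply: (test_fun_of_disc (ltW r0) _ _ sub); first exact: smooth_rbump.
move=> x; rewrite /disc /= => H; rewrite leNgt; apply/negP => h; move/negP: H; apply.
by apply/eqP; apply: (rbump_support _ (ltW h)).1.
Qed.

(** On this smaller disc the argument of [ebump] is at least [1/4]. *)
Lemma rbump_lower {R : realType} (m : pt R) (r : R) (x : pt R) : 0 < r ->
  dot (x - m) (x - m) <= 3 / 4 * r ^+ 2 ->
  expR (-4) <= rbump m r x /\ expR (-4) <= rbump' m r x.
Proof.
move=> r0 H; rewrite /rbump /rbump' /ebump; set t := 1 - _.
have t1 : t <= 1.
  by rewrite /t gerBl mulr_ge0 ?dot_ge0// invr_ge0 exprn_ge0// ltW.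
have t4 : 1 / 4 <= t.
  rewrite /t lerBrDr -lerBrDl ler_pdivrMr ?exprn_gt0//.
  by apply: (le_trans H); rewrite ler_wpM2r ?exprn_ge0 ?(ltW r0)//; lra.
have t0 : 0 < t by lra.
have E : expR (-4) <= expR (- t^-1) :> R.
  rewrite ler_expR lerN2 -(@ler_pM2r _ t)// mulVf ?gt_eqF//; lra.
rewrite t0 !hornerE; split => //.
apply: (le_trans E); rewrite ler_peMl ?expR_ge0//.
by rewrite exprVn invf_ge1 ?exprn_gt0// exprn_ile1// ltW.
Qed.

Lemma bounded_set_cbox {R : realType} (A : set (pt R)) : bounded_set A ->
  exists M, A `<=` cbox (- M) M (- M) M.
Proof.
move=> [M [Mreal HM]]; exists (M + 1) => x Ax.
have /= := HM (M + 1) _ x Ax; rewrite ltrDl ltr01 => /(_ isT).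
rewrite /Num.norm /= ge_max !ler_norml => /andP[/andP[? ?] /andP[? ?]].
by split.
Qed.

Lemma test_fun_supp_cbox {R : realType} (Om : set (pt R)) phi :
  test_fun Om phi -> exists M, forall x, phi x != 0 -> cbox (- M) M (- M) M x.
Proof.
move=> [_ cS _]; have [M HM] := bounded_set_cbox (compact_bounded cS).
by exists M => x px; apply: HM; exact: subset_closure.
Qed.

Lemma test_fun_bounded {R : realType} (Om : set (pt R)) phi :
  test_fun Om phi -> exists B, forall x, `|phi x| <= B.
Proof.
move=> [sp cS _].
have cf : compact (phi @` closure [set x | phi x != 0]).
  apply: continuous_compact => //; apply: continuous_subspaceT.
  exact: smooth_continuous.
have [M [Mreal HM]] := compact_bounded cf.
exists (`|M| + 1) => x; have [->|p0] := eqVneq (phi x) 0.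
  by rewrite normr0 addr_ge0.
apply: (HM (`|M| + 1)); first by rewrite (le_lt_trans (ler_norm M))// ltrDl.
by exists x => //; exact: subset_closure.
Qed.

(** The difference quotients of [phi] vanish near such a point. *)
Lemma pder_supp {R : realType} (phi : pt R -> R) i x :
  ~ closure [set x | phi x != 0] x -> pder i phi x = 0.
Proof.
move=> nS; rewrite /pder.
have := @near_eq_derive R _ _ phi (cst 0) x (basis i).
move=> ->; first by rewrite derive_cst.
have : nbhs x (~` closure [set x | phi x != 0]).
  by apply: open_nbhs_nbhs; split => //; apply: closed_openC; exact: closed_closure.
apply: filterS => y /= nSy; apply/eqP; apply: contrapT => p0; apply: nSy.
by apply: subset_closure; apply/negP.
Qed.

Lemma test_fun_pder {R : realType} (Om : set (pt R)) phi i :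
  test_fun Om phi -> test_fun Om (pder i phi).
Proof.
move=> [sp cS sS].
have sub : closure [set x | pder i phi x != 0] `<=` closure [set x | phi x != 0].
  rewrite [X in _ `<=` X](closure_id _).1; last exact: closed_closure.
  apply: closure_subset => x /= p0; apply: contrapT => nS.
  by rewrite (pder_supp _ nS) eqxx in p0.
split; [exact: smooth_pder| |exact: subset_trans sS].
by apply: subclosed_compact sub => //; exact: closed_closure.
Qed.

Lemma lipschitz_line {R : realType} (f df : pt R -> R) (v : pt R) (L : R) :
  (forall x, is_derive x v f (df x)) -> (forall x, `|df x| <= L) ->
  forall x t, `|f (x + t *: v) - f x| <= L * `|t|.
Proof.
move=> dfE dfL.
have key x t : 0 < t -> `|f (x + t *: v) - f x| <= L * `|t|.
  move=> t0.
  have dg s : is_derive s (1:R) (fun h => f (x + h *: v)) (df (x + s *: v)).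
    have /is_derive_line H := dfE (x + s *: v).
    have Hs : is_derive s (1:R) (fun h : R => h - s) 1.
      have := is_deriveB (is_derive_id s (1:R)) (is_derive_cst s s (1:R)).
      by rewrite subr0.
    have := @is_derive1_comp R (fun h => f (x + s *: v + h *: v)) (fun h : R => h - s) s _ _ _ Hs.
    rewrite subrr => /(_ _ H); rewrite mulr1.
    congr is_derive; apply/funext => h /=.
    by rewrite -addrA -scalerDl addrCA subrr addr0.
  have [c _] := @MVT R (fun h => f (x + h *: v)) (fun s => df (x + s *: v)) 0 t t0
    (fun s _ => dg s) ltac:(apply: derivable_within_continuous => s _; exact: (@ex_derive _ _ _ _ _ _ _ (dg s))).
  rewrite scale0r addr0 subr0 => ->.
  by rewrite normrM ler_wpM2r.
move=> x t; have [t0|t0|->] := ltgtP t 0.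
- have := key (x + t *: v) (- t); rewrite oppr_gt0 => /(_ t0).
  by rewrite -addrA -scalerDl subrr scale0r addr0 distrC normrN.
- exact: key.
- by rewrite scale0r addr0 subrr normr0 mulr0.
Qed.

Lemma test_fun_lipschitz {R : realType} (Om : set (pt R)) phi i :
  test_fun Om phi -> exists L, forall x t,
    `|phi (x + t *: basis i) - phi x| <= L * `|t|.
Proof.
move=> tp; have [L HL] := test_fun_bounded (test_fun_pder i tp).
exists L; apply: lipschitz_line HL => x; apply: smooth_is_derive.
by case: tp.
Qed.

Lemma smooth_measurable {R : realType} (phi : pt R -> R) :
  smooth phi -> measurable_fun setT phi.
Proof. by move=> sp; apply: continuous_measurable2; exact: smooth_continuous. Qed.

Lemma leb2_aeT {R : realType} (P : pt R -> Prop) :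
  (forall x, P x) -> {ae leb2, forall x, P x}.
Proof.
move=> HP; exists set0; split.
- exact: measurable0.
- exact: (measure0 leb2).
by move=> x /= nP; apply: nP; exact: HP.
Qed.

Lemma integral_pder0 {R : realType} (Om : set (pt R)) phi i :
  test_fun Om phi ->
  leb2.-integrable setT (EFin \o pder i phi) /\
  (\int[leb2]_x (pder i phi x)%:E = 0)%E.
Proof.
move=> tp; have [L HL] := test_fun_lipschitz i tp.
have [B HB] := test_fun_bounded tp; have [M HM] := test_fun_supp_cbox tp.
case: (tp) => sp _ _.
apply: (integral_directional_derivative0 _ _ HL HB HM).
- exact: smooth_measurable.
- by apply: smooth_measurable; exact: smooth_pder.
- by apply: leb2_aeT => x; exact: smooth_is_derive.
Qed.

(** * The fundamental lemma of the calculus of variations *)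

Definition boxes {R : realType} : set (set (pt R)) :=
  [set A | exists a b c d, A = box a b c d].

Lemma box_setI {R : realType} (a b c d a' b' c' d' : R) :
  box a b c d `&` box a' b' c' d' =
  box (Num.max a a') (Num.min b b') (Num.max c c') (Num.min d d').
Proof.
apply/seteqP; split => x.
  by move=> [[? ? ? ?] [? ? ? ?]]; split; rewrite ?gt_max ?lt_min; apply/andP.
by move=> []; rewrite ?gt_max ?lt_min => /andP[? ?] /andP[? ?] /andP[? ?] /andP[? ?].
Qed.

Lemma setI_closed_boxes {R : realType} : setI_closed (@boxes R).
Proof.
move=> _ _ [a [b [c [d ->]]]] [a' [b' [c' [d' ->]]]].
by rewrite box_setI; do 4!eexists.
Qed.

Lemma sigma_algebra_preimage_class {aT rT : Type} (f : aT -> rT)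
    (S : set (set aT)) :
  sigma_algebra setT S -> sigma_algebra setT [set X | S (f @^-1` X)].
Proof.
move=> [S0 SC SU]; split => /=.
- by rewrite preimage_set0.
- by move=> X SX; have := SC _ SX; rewrite !setTD.
- by move=> F SF; rewrite preimage_bigcup; exact: SU.
Qed.

(** Both coordinates are measurable for the sigma-algebra generated by boxes,
since strips are countable unions of boxes. *)
Lemma measurable_sub_boxes {R : realType} (A : set (pt R)) :
  measurable A -> <<s boxes >> A.
Proof.
have sa : sigma_algebra setT <<s @boxes R >> by exact: smallest_sigma_algebra.
have [s0 sC sU] := sa.
have bigN (y : R) : exists n : nat, - (n%:R) < y /\ y < n%:R.
  exists (Num.truncn `|y|).+1; have := truncnS_gt `|y|.
  by rewrite ltr_norml => /andP[? ?]; split.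
have H1 X : measurable X -> <<s @boxes R >> (fst @^-1` X).
  rewrite [measurable]RGenOpens.measurableE.
  apply: (@smallest_sub _ _ _ [set X : set R | <<s @boxes R >> (fst @^-1` X)]).
    exact: sigma_algebra_preimage_class.
  move=> _ [a [b ->]] /=.
  have -> : fst @^-1` `]a, b[%classic = \bigcup_n box a b (- n%:R) n%:R.
    apply/seteqP; split => x /=.
      rewrite in_itv /= => /andP[? ?]; have [n [? ?]] := bigN x.2.
      by exists n.
    by move=> [n _ []] ? ? _ _; rewrite in_itv /=; apply/andP.
  apply: sU => n; apply: sub_sigma_algebra.
  by exists a, b, (- n%:R), n%:R.
have H2 X : measurable X -> <<s @boxes R >> (snd @^-1` X).
  rewrite [measurable]RGenOpens.measurableE.
  apply: (@smallest_sub _ _ _ [set X : set R | <<s @boxes R >> (snd @^-1` X)]).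
    exact: sigma_algebra_preimage_class.
  move=> _ [a [b ->]] /=.
  have -> : snd @^-1` `]a, b[%classic = \bigcup_n box (- n%:R) n%:R a b.
    apply/seteqP; split => x /=.
      rewrite in_itv /= => /andP[? ?]; have [n [? ?]] := bigN x.1.
      by exists n.
    by move=> [n _ []] _ _ ? ?; rewrite in_itv /=; apply/andP.
  apply: sU => n; apply: sub_sigma_algebra.
  by exists (- n%:R), n%:R, a, b.
apply: smallest_sub => // X [[Y mY <-]|[Y mY <-]].
  by rewrite setTI; exact: H1.
by rewrite setTI; exact: H2.
Qed.

(** The sets on which [f] has integral zero form a Dynkin class. *)
Lemma ae_eq0_pi_system d (X : measurableType d) (R : realType)
    (mu : {measure set X -> \bar R}) (G : set (set X)) (f : X -> \bar R) :
  setI_closed G -> (forall A, measurable A -> <<s G >> A) ->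
  (forall A, G A -> measurable A) ->
  mu.-integrable setT f -> (\int[mu]_x f x = 0)%E ->
  (forall A, G A -> (\int[mu]_(x in A) f x = 0)%E) ->
  ae_eq mu setT f (cst 0%E).
Proof.
move=> GI Gm mG intf f0 fG.
suff key A : measurable A -> (\int[mu]_(x in A) f x = 0)%E.
  apply: integral_ae_eq => // E _ mE.
  by rewrite key// integral0.
move=> /Gm; rewrite -(setI_closed_g_dynkin_g_sigma_algebra GI).
suff : <<d G >> `<=` [set A | measurable A /\ (\int[mu]_(x in A) f x = 0)%E].
  by move=> sub /sub[].
apply: smallest_sub; last by move=> B GB; split; [exact: mG|exact: fG].
have mf := measurable_int _ intf.
split.
- by split.
- move=> B [mB fB]; split; first exact: measurableC.
  have := @integral_setU _ _ _ mu B (~` B) f mB (measurableC mB).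
  rewrite setUv fB add0e f0 => -> //.
  by apply/disj_set2P; rewrite setICr.
- move=> F tF HF; split; first by apply: bigcupT_measurable => n; case: (HF n).
  rewrite integral_bigcup//.
  + by apply: eseries0 => n _ _; case: (HF n).
  + by move=> n; case: (HF n).
  + apply: integrableS intf => //.
    by apply: bigcupT_measurable => n; case: (HF n).
Qed.

Lemma ebump1_limit {R : realType} (s : R) :
  (fun n => ebump 1 (n.+1%:R * s)) @ \oo --> ((0 < s)%R%:R : R).
Proof.
have [s0|s0] := ltP 0 s; last first.
  rewrite (_ : (fun _ => _) = cst 0); first exact: cvg_cst.
  by apply/funext => n; rewrite ebump_le0// mulr_ge0_le0.
have -> : (fun n => ebump 1 (n.+1%:R * s)) =
    expR \o (fun n => (- s^-1) * harmonic n).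
  apply/funext => n; rewrite /ebump mulr_gt0// hornerE mul1r /=.
  by congr expR; rewrite /harmonic /= invfM mulrC mulNr.
have H0 : (fun n => (- s^-1) * harmonic n) @ \oo --> (0 : R).
  by rewrite -(mulr0 (- s^-1)); apply: cvgM; [exact: cvg_cst|exact: cvg_harmonic].
by have := cvg_comp _ _ H0 (@continuous_expR R 0); rewrite expR0.
Qed.

Definition box_bump {R : realType} (a b c d : R) (n : nat) (x : pt R) : R :=
  ebump 1 (n.+1%:R * (x.1 - a)) * ebump 1 (n.+1%:R * (b - x.1)) *
  (ebump 1 (n.+1%:R * (x.2 - c)) * ebump 1 (n.+1%:R * (d - x.2))).

Lemma ebump1_bounds {R : realType} (t : R) : 0 <= ebump 1 t <= 1.
Proof.
rewrite /ebump; case: ifP => [t0|_]; last by rewrite lexx ler01.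
rewrite hornerE mul1r expR_ge0 /= -[leRHS]expR0 ler_expR oppr_le0.
by rewrite invr_ge0 ltW.
Qed.

Lemma smooth_box_bump {R : realType} (a b c d : R) n :
  smooth (box_bump a b c d n).
Proof.
have sm (e : R) (v : pt R) :
    smooth (fun x => ebump 1 (n.+1%:R * (dot v x + e))).
  apply: smooth_ebump; apply: smoothM; first exact: smooth_cst.
  by apply: smoothD; [exact: smooth_dot|exact: smooth_cst].
have -> : box_bump a b c d n = (fun x =>
  ebump 1 (n.+1%:R * (dot (1, 0) x + - a)) *
  ebump 1 (n.+1%:R * (dot (-1, 0) x + b)) *
  (ebump 1 (n.+1%:R * (dot (0, 1) x + - c)) *
   ebump 1 (n.+1%:R * (dot (0, -1) x + d)))).
  apply/funext => x; rewrite /box_bump /dot /=.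
  by do !(congr (_ * _)); congr (ebump _ (_ * _)); ring.
by apply: smoothM; apply: smoothM; exact: sm.
Qed.

Lemma box_bump_supp {R : realType} (a b c d : R) n x :
  box_bump a b c d n x != 0 -> box a b c d x.
Proof.
have H (s : R) : ebump 1 (n.+1%:R * s) != 0 -> 0 < s.
  rewrite ltNge; apply: contra => s0; rewrite ebump_le0//.
  by rewrite mulr_ge0_le0.
rewrite /box_bump !mulf_eq0 !negb_or => /andP[/andP[/H ? /H ?] /andP[/H ? /H ?]].
by split; lra.
Qed.

Lemma test_fun_box_bump {R : realType} (Om : set (pt R)) (a b c d : R) n :
  cbox a b c d `<=` Om -> test_fun Om (box_bump a b c d n).
Proof.
move=> sub.
have cS : closure [set x | box_bump a b c d n x != 0] `<=` cbox a b c d.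
  apply: (@subset_trans _ (closure (cbox a b c d))).
    apply: closure_subset => x /= /box_bump_supp[? ? ? ?].
    by split; exact: ltW.
  have : closed (cbox a b c d).
    by apply: compact_closed; [exact: norm_hausdorff|exact: compact_cbox].
  by move=> /closure_id <-.
split; [exact: smooth_box_bump| |exact: subset_trans sub].
by apply: subclosed_compact cS; [exact: closed_closure|exact: compact_cbox].
Qed.

Lemma box_bump_bounds {R : realType} (a b c d : R) n x :
  0 <= box_bump a b c d n x <= 1.
Proof.
have H (s t : R) : 0 <= s <= 1 -> 0 <= t <= 1 -> 0 <= s * t <= 1.
  by move=> /andP[? ?] /andP[? ?]; rewrite mulr_ge0//= mulr_ile1.
by apply: (H); apply: (H); exact: ebump1_bounds.
Qed.

(** [exp (- 1 / ((n + 1) s))] tends to 1 for [0 < s]. *)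
Lemma box_bump_limit {R : realType} (a b c d : R) (x : pt R) :
  (fun n => box_bump a b c d n x) @ \oo --> (\1_(box a b c d) x : R).
Proof.
have -> : \1_(box a b c d) x = (0 < x.1 - a)%R%:R * (0 < b - x.1)%R%:R *
    ((0 < x.2 - c)%R%:R * (0 < d - x.2)%R%:R) :> R.
  rewrite !subr_gt0 -!natrM !mulnb indicE; congr (_%:R); congr nat_of_bool.
  apply/idP/idP; first by rewrite inE => -[-> -> -> ->].
  by move=> /andP[/andP[? ?] /andP[? ?]]; rewrite inE.
by apply: cvgM; apply: cvgM; exact: ebump1_limit.
Qed.

Lemma vanishing_on_boxes {R : realType} (W : pt R -> R) (Om : set (pt R))
    (a b c d : R) :
  leb2.-integrable setT (EFin \o W) ->
  (forall phi, test_fun Om phi -> (\int[leb2]_x (W x * phi x)%:E = 0)%E) ->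
  cbox a b c d `<=` Om ->
  (\int[leb2]_(x in box a b c d) (W x)%:E = 0)%E.
Proof.
move=> iW HW sub.
have mW : measurable_fun setT W by apply/measurable_EFinP; exact: (measurable_int _ iW).
have [||||| _ _ C] := @dominated_convergence _ _ _ leb2 setT measurableT
  (fun n x => (W x * box_bump a b c d n x)%:E)
  (fun x => (W x * \1_(box a b c d) x)%:E) (fun x => `|(W x)%:E|%E).
- move=> n; apply/measurable_EFinP; apply: measurable_funM => //.
  by apply: smooth_measurable; exact: smooth_box_bump.
- apply/measurable_EFinP; apply: measurable_funM => //.
  by apply: measurable_indic; exact: measurable_box.
- apply: leb2_aeT => x _; apply: cvg_EFin; first exact: nearW.
  by apply: cvgM; [exact: cvg_cst|exact: box_bump_limit].
- exact: integrable_abse iW.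
- apply: leb2_aeT => x n _ /=; rewrite lee_fin normrM.
  have /andP[h0 h1] := box_bump_bounds a b c d n x.
  by rewrite (ger0_norm h0) ler_piMr.
have -> : (\int[leb2]_(x in box a b c d) (W x)%:E)%E =
    (\int[leb2]_x (W x * \1_(box a b c d) x)%:E)%E.
  rewrite integral_mkcond; apply: eq_integral => x _.
  rewrite patchE indicE; case: ifP => _; by rewrite ?mulr1 ?mulr0.
have C0 : [sequence (\int[leb2]_x (W x * box_bump a b c d n x)%:E)%E]_n @ \oo
    --> (0%E : \bar R).
  rewrite (_ : [sequence _]_n = fun=> 0%E); first exact: cvg_cst.
  by apply/funext => n; apply: HW; exact: test_fun_box_bump.
exact: (cvg_unique _ C C0).
Qed.

Lemma integrable_patch d (X : measurableType d) (R : realType)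
    (mu : {measure set X -> \bar R}) (D : set X) (f : X -> R) :
  measurable D ->
  mu.-integrable D (EFin \o f) <-> mu.-integrable setT (EFin \o (f \_ D)).
Proof. by move=> mD; rewrite -restrict_EFin; exact: integrable_mkcond. Qed.

Lemma leb2_ae_countable {R : realType} (U : countType) (P : U -> pt R -> Prop) :
  (forall q, {ae leb2, forall x, P q x}) -> {ae leb2, forall x, forall q, P q x}.
Proof.
move=> HP.
pose F (n : nat) : set (pt R) :=
  if choice.unpickle n is Some q then ~` [set x | P q x] else set0.
have NF : leb2.-negligible (\bigcup_n F n).
  apply: (@negligible_bigcup _ _ _ leb2) => n.
  rewrite /F; case: choice.unpickle => [q|]; first exact: HP.
  exact: (@negligible_set0 _ _ _ leb2).
apply: (@negligibleS _ _ _ leb2 _ _ _ NF) => x /= nP.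
apply: contrapT => nF; apply: nP => q; apply: contrapT => nPq; apply: nF.
by exists (choice.pickle q) => //; rewrite /F choice.pickleK.
Qed.

(** The integral of [w] vanishes on every open box whose closure lies in the
domain, because the indicator of the box is a limit of test functions.  Hence
[w] vanishes almost everywhere in each such box, and countably many of them
cover the domain. *)
Lemma fundamental_lemma_calculus_variations {R : realType} (Om : set (pt R))
    (w : pt R -> R) :
  open Om -> leb2.-integrable Om (EFin \o w) ->
  (forall phi, test_fun Om phi -> \int[leb2]_(x in Om) (w x * phi x) = 0) ->
  {ae leb2, forall x, Om x -> w x = 0}.
Proof.
move=> oOm iw Hw.
have mOm := open_measurable2 oOm.
pose W := w \_ Om.
have iW : leb2.-integrable setT (EFin \o W).
  exact: ((@integrable_patch _ _ _ leb2 Om w mOm).1 iw).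
have mW : measurable_fun setT W.
  by apply/measurable_EFinP; exact: (measurable_int _ iW).
have HW phi : test_fun Om phi -> (\int[leb2]_x (W x * phi x)%:E = 0)%E.
  move=> tp.
  have iWp : leb2.-integrable setT (EFin \o (fun x => W x * phi x)).
    have [B HB] := test_fun_bounded tp.
    apply: (@le_integrable _ _ _ leb2 setT measurableT _
      (fun x => (B%:E * (EFin \o W) x)%E)).
    - apply/measurable_EFinP; apply: measurable_funM => //.
      by apply: smooth_measurable; case: tp.
    - move=> x _ /=; rewrite lee_fin !normrM mulrC ler_wpM2r//.
      by rewrite (le_trans (HB x))// ler_norm.
    - exact: integrableZl iW.
  have E : \int[leb2]_(x in Om) (w x * phi x) = \int[leb2]_x (W x * phi x).
    rewrite Rintegral_mkcond; apply: eq_Rintegral => x _.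
    by rewrite /W !patchE; case: ifP => // _; rewrite mul0r.
  have := Hw _ tp; rewrite E /Rintegral => H.
  have fin := integrable_fin_num measurableT iWp.
  by rewrite -(fineK fin) [X in X%:E]H.
have loc (q : rat * rat * rat * rat) : {ae leb2, forall x,
    cbox (ratr q.1.1.1) (ratr q.1.1.2) (ratr q.1.2) (ratr q.2) `<=` Om ->
    box (ratr q.1.1.1) (ratr q.1.1.2) (ratr q.1.2) (ratr q.2) x -> W x = 0}.
  case: q => [[[a b] c] d] /=.
  have [sub|nsub] := pselect (cbox (ratr a) (ratr b) (ratr c) (ratr d) `<=` Om); last first.
    exact: leb2_aeT.
  set B := box _ _ _ _.
  have mB : measurable B by exact: measurable_box.
  have i0 A : boxes A -> (\int[leb2]_(x in A) ((EFin \o W) \_ B) x = 0)%E.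
    move=> bA; rewrite -integral_mkcondr.
    case: bA => a' [b' [c' [d' ->]]]; rewrite /B box_setI.
    apply: (vanishing_on_boxes iW HW) => x [].
    rewrite !ge_max !le_min => /andP[_ ?] /andP[_ ?] /andP[_ ?] /andP[_ ?].
    exact: sub.
  have iWB : leb2.-integrable setT ((EFin \o W) \_ B).
    apply: ((@integrable_mkcond _ _ _ leb2 B (EFin \o W) mB).1 _).
    by apply: (@integrableS _ _ _ leb2 setT) iW.
  have iT : (\int[leb2]_x ((EFin \o W) \_ B) x = 0)%E.
    rewrite -integral_mkcond -[X in (\int[leb2]_(x in X) _)%E]setTI.
    by rewrite setTI; exact: (vanishing_on_boxes iW HW sub).
  have := @ae_eq0_pi_system _ _ _ leb2 boxes _ setI_closed_boxes
    (@measurable_sub_boxes R) _ iWB iT i0.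
  move=> /(_ _)[].
    by move=> _ [? [? [? [? ->]]]]; exact: measurable_box.
  move=> N [mN N0 sN]; exists N; split => // x /= nx; apply: sN => /= H; apply: nx.
  move=> _ Bx; have := H I; rewrite patchE mem_set//=.
  by move=> [].
have := leb2_ae_countable loc; apply: leb2_ae_imp => x Hx Ox.
have [q [bq cq]] := open_rat_box oOm Ox.
by have := Hx q cq bq; rewrite /W patchE mem_set.
Qed.

(** * Barycentric coordinates *)

Lemma pt_eq {R : realType} (x y : pt R) : x.1 = y.1 -> x.2 = y.2 -> x = y.
Proof. by case: x y => [? ?] [? ?] /= -> ->. Qed.

Lemma pt_add1 {R : realType} (x y : pt R) : (x + y).1 = x.1 + y.1.
Proof. by []. Qed.

Lemma pt_add2 {R : realType} (x y : pt R) : (x + y).2 = x.2 + y.2.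
Proof. by []. Qed.

Lemma pt_scale1 {R : realType} (a : R) (x : pt R) : (a *: x).1 = a * x.1.
Proof. by []. Qed.

Lemma pt_scale2 {R : realType} (a : R) (x : pt R) : (a *: x).2 = a * x.2.
Proof. by []. Qed.

Definition cross {R : realType} (x y : pt R) : R := x.1 * y.2 - x.2 * y.1.

(** [p.1 v + dot (p.2 v) x] is to be the barycentric coordinate of [x] that
belongs to the vertex [v]; it is represented by its value at 0 and its
gradient. *)
Definition is_bary {R : realType} (K : cell R)
    (p : (pt R -> R) * (pt R -> pt R)) :=
  [/\ forall v w, v \in K -> w \in K -> p.1 v + dot (p.2 v) w = (v == w)%:R,
      forall x, \sum_(v <- K) (p.1 v + dot (p.2 v) x) = 1
    & forall x, \sum_(v <- K) (p.1 v + dot (p.2 v) x) *: v = x].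

Definition bary {R : realType} (K : cell R) : (pt R -> R) * (pt R -> pt R) :=
  xget (fun=> 0, fun=> 0) [set p | is_bary K p].

Definition lambda {R : realType} (K : cell R) (v x : pt R) : R :=
  (bary K).1 v + dot ((bary K).2 v) x.

Definition glambda {R : realType} (K : cell R) (v : pt R) : pt R := (bary K).2 v.

Definition triangle {R : realType} (K : cell R) :=
  #|` K| = 3%N /\ elt K !=set0.

Lemma dot_gt0 {R : realType} (n : pt R) : n != 0 -> 0 < dot n n.
Proof.
move=> n0; rewrite lt_neqAle dot_ge0 andbT eq_sym; apply: contra n0 => /eqP.
rewrite /dot -!expr2 => /eqP; rewrite paddr_eq0 ?sqr_ge0// !sqrf_eq0.
by move=> /andP[/eqP n1 /eqP n2]; apply/eqP; exact: pt_eq.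
Qed.

Lemma nbhs_line {R : realType} (A : set (pt R)) (x n : pt R) : nbhs x A ->
  exists2 e : R, 0 < e & forall s, `|s| <= e -> A (x + s *: n).
Proof.
move=> /nbhs_ballP[e /= e0 sub].
have d0 : 0 < `|n.1| + `|n.2| + 1 by rewrite ltr_wpDl// addr_ge0.
exists (e / 2 / (`|n.1| + `|n.2| + 1)); first by rewrite !divr_gt0.
move=> s; rewrite ler_pdivlMr// => sE.
apply: sub; split; rewrite /ball /= opprD addrA subrr add0r normrN normrM.
  have h : `|s| * `|n.1| <= `|s| * (`|n.1| + `|n.2| + 1).
    by rewrite ler_wpM2l//; have := normr_ge0 n.2; lra.
  by apply: le_lt_trans h (le_lt_trans sE _); lra.
have h : `|s| * `|n.2| <= `|s| * (`|n.1| + `|n.2| + 1).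
  by rewrite ler_wpM2l//; have := normr_ge0 n.1; lra.
by apply: le_lt_trans h (le_lt_trans sE _); lra.
Qed.

Lemma near_all_seq {I : eqType} {T : Type} (F : set_system T) (s : seq I)
    (P : I -> T -> Prop) : Filter F ->
  (forall i, i \in s -> \forall y \near F, P i y) ->
  \forall y \near F, forall i, i \in s -> P i y.
Proof.
move=> FF; elim: s => [|a s IH] H; first by apply: nearW => y v; rewrite in_nil.
have h1 := H a (mem_head _ _).
have h2 := IH (fun v vs => H v ltac:(by rewrite inE vs orbT)).
by apply: filterS2 h1 h2 => y y1 y2 v; rewrite inE => /orP[/eqP -> //|]; exact: y2.
Qed.

Lemma interior_line_empty {R : realType} (A : set (pt R)) (n : pt R) (c : R) :
  n != 0 -> (forall x, A x -> dot n x = c) -> A° = set0.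
Proof.
move=> n0 HA; apply/seteqP; split => // x Ax.
have [e e0 Ae] := nbhs_line n Ax.
have Ay : A (x + e *: n) by apply: Ae; rewrite gtr0_norm.
have Ax' : A x by exact: interior_subset Ax.
have := HA _ Ay; rewrite dotDr dotZr (HA _ Ax') => /eqP.
by rewrite -subr_eq0 addrAC subrr add0r mulf_eq0 gt_eqF//= gt_eqF// dot_gt0.
Qed.

Lemma dot_suml {R : realType} (s : seq (pt R)) (l : pt R -> R) (n : pt R) :
  dot n (\sum_(v <- s) l v *: v) = \sum_(v <- s) l v * dot n v.
Proof.
elim: s => [|v s IH]; first by rewrite !big_nil /dot /= !mulr0 addr0.
by rewrite !big_cons dotDr dotZr IH.
Qed.

Lemma hull_line {R : realType} (K : cell R) (n : pt R) (c : R) (x : pt R) :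
  (forall v, v \in K -> dot n v = c) -> hull K x -> dot n x = c.
Proof.
move=> HK [l [_ l1 ->]]; rewrite dot_suml.
have -> : \sum_(v <- K) l v * dot n v = \sum_(v <- K) l v * c.
  by apply: eq_big_seq => v vK; rewrite HK.
by rewrite -mulr_suml l1 mul1r.
Qed.

Lemma triangle_enum {R : realType} (K : cell R) : #|` K| = 3%N ->
  exists a b c, [/\ enum_fset K = [:: a; b; c], a != b, a != c & b != c].
Proof.
have := fset_uniq K; case: (enum_fset K) => [|a [|b [|c [|d s]]]] //=.
rewrite !inE andbT negb_or => /andP[/andP[ab ac] bc] _.
by exists a, b, c.
Qed.

Lemma big_triangle {R : realType} (V : nmodType) (K : cell R) (a b c : pt R)
    (f : pt R -> V) :
  enum_fset K = [:: a; b; c] -> \sum_(v <- K) f v = f a + f b + f c.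
Proof. by move=> ->; rewrite !big_cons big_nil addr0 addrA. Qed.

Lemma mem_triangle {R : realType} (K : cell R) (a b c v : pt R) :
  enum_fset K = [:: a; b; c] -> (v \in K) = [|| v == a, v == b | v == c].
Proof.
move=> E; have -> : (v \in K) = (v \in enum_fset K) by [].
by rewrite E !inE.
Qed.

(** Cramer's rule; the determinant is nonzero because otherwise the triangle
would lie on a line and have no interior. *)
Lemma bary_exists {R : realType} (K : cell R) : triangle K ->
  exists p, is_bary K p.
Proof.
move=> [/triangle_enum[a [b [c [E ab ac bc]]]] [x0 x0K]].
pose D := cross (b - a) (c - a).
have D0 : D != 0.
  apply/negP => /eqP D0.
  have n0 : perp (b - a) != 0.
    apply: contra ab => /eqP; rewrite /perp => -[h1 h2].
    by move: h1 h2; case: a b {E ac bc D D0} => a1 a2 [b1 b2] /= h1 h2;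
      apply/eqP; congr (_, _); lra.
  suff E0 : elt K = set0 by rewrite E0 in x0K.
  apply: (@interior_line_empty R (hull K) _ (dot (perp (b - a)) a) n0) => x.
  apply: hull_line => v; rewrite (mem_triangle _ E).
  move=> /or3P[] /eqP ->; rewrite /dot /perp //=; first by ring.
  by move: D0; rewrite /D /cross /=; lra.
pose al v := if v == a then cross b c / D else
             if v == b then cross c a / D else cross a b / D.
pose be v : pt R := if v == a then ((b.2 - c.2) / D, (c.1 - b.1) / D) else
             if v == b then ((c.2 - a.2) / D, (a.1 - c.1) / D) else
                            ((a.2 - b.2) / D, (b.1 - a.1) / D).
have [ala be_a] : al a = cross b c / D /\ be a = ((b.2 - c.2) / D, (c.1 - b.1) / D).
  by rewrite /al /be eqxx.
have [alb beb] : al b = cross c a / D /\ be b = ((c.2 - a.2) / D, (a.1 - c.1) / D).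
  by rewrite /al /be eqxx eq_sym (negbTE ab).
have [alc bec] : al c = cross a b / D /\ be c = ((a.2 - b.2) / D, (b.1 - a.1) / D).
  by rewrite /al /be [c == a]eq_sym (negbTE ac) [c == b]eq_sym (negbTE bc).
have Dne : D <> 0 by exact/eqP.
exists (al, be); split.
- move=> v w; rewrite !(mem_triangle _ E) /=.
  move=> /or3P[] /eqP -> /or3P[] /eqP ->; rewrite ?eqxx ?(negbTE ab) ?(negbTE ac)
    ?(negbTE bc) ?[b == a]eq_sym ?[c == a]eq_sym ?[c == b]eq_sym ?(negbTE ab)
    ?(negbTE ac) ?(negbTE bc) ?ala ?be_a ?alb ?beb ?alc ?bec /dot /=;
   move: D0; rewrite /D /cross /= => D0; field; exact: D0.
- move=> x; rewrite (big_triangle _ E) /= ala be_a alb beb alc bec /dot /=.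
  by move: D0; rewrite /D /cross /= => D0; field; exact: D0.
- move=> x; rewrite (big_triangle _ E) /= ala be_a alb beb alc bec /dot /=.
  clear -D0; move: D0; rewrite /D /cross.
  case: x a b c D => x1 x2 [a1 a2] [b1 b2] [c1 c2] _ /= D0.
  by apply: pt_eq; rewrite !(pt_add1, pt_add2, pt_scale1, pt_scale2) /=;
    field; exact: D0.
Qed.

Lemma baryP {R : realType} (K : cell R) : triangle K -> is_bary K (bary K).
Proof. by move=> /bary_exists[p Hp]; exact: (@xgetPex _ _ [set p | is_bary K p]) (ex_intro _ p Hp). Qed.

Lemma lambda_vertex {R : realType} (K : cell R) (v w : pt R) : triangle K ->
  v \in K -> w \in K -> lambda K v w = (v == w)%:R.
Proof. by move=> /baryP[H _ _]; exact: H. Qed.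

Lemma lambda_sum1 {R : realType} (K : cell R) (x : pt R) : triangle K ->
  \sum_(v <- K) lambda K v x = 1.
Proof. by move=> /baryP[_ H _]; exact: H. Qed.

Lemma lambda_recomb {R : realType} (K : cell R) (x : pt R) : triangle K ->
  \sum_(v <- K) lambda K v x *: v = x.
Proof. by move=> /baryP[_ _ H]; exact: H. Qed.

Lemma lambdaD {R : realType} (K : cell R) (v x y : pt R) :
  lambda K v (x + y) = lambda K v x + dot (glambda K v) y.
Proof. by rewrite /lambda /glambda dotDr addrA. Qed.

Lemma lambdaB {R : realType} (K : cell R) (v x y : pt R) :
  lambda K v x - lambda K v y = dot (glambda K v) (x - y).
Proof. by rewrite /lambda /glambda dotBr; ring. Qed.

Lemma lambda_continuous {R : realType} (K : cell R) (v : pt R) :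
  continuous (lambda K v).
Proof. by move=> x; apply: cvgD; [exact: cvg_cst|exact: dot_continuous]. Qed.

Lemma big_uniq_pred1 {R : realType} (s : seq (pt R)) (l : pt R -> R) v :
  uniq s -> \sum_(w <- s) l w * (v == w)%:R = if v \in s then l v else 0.
Proof.
elim: s => [|a s IH] /=; first by rewrite big_nil.
move=> /andP[as_ us]; rewrite big_cons IH// inE; have [->|va] := eqVneq v a.
  by rewrite mulr1 (negbTE as_) addr0.
by rewrite mulr0 add0r.
Qed.

Lemma lambda_comb {R : realType} (K F : cell R) (l : pt R -> R) (v : pt R) :
  triangle K -> (F `<=` K)%fset -> v \in K -> \sum_(w <- F) l w = 1 ->
  lambda K v (\sum_(w <- F) l w *: w) = if v \in F then l v else 0.
Proof.
move=> tK FK vK l1; rewrite /lambda dot_suml -[X in X + _]mulr1 -l1 mulr_sumr.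
rewrite -big_split /=.
rewrite -(big_uniq_pred1 l v (fset_uniq F)).
apply: eq_big_seq => w wF.
rewrite -(lambda_vertex tK vK ((fsubsetP FK) w wF)) /lambda; ring.
Qed.

Lemma hull_faceP {R : realType} (K F : cell R) (x : pt R) :
  triangle K -> (F `<=` K)%fset ->
  hull F x <-> forall v, v \in K -> 0 <= lambda K v x /\
    (v \notin F -> lambda K v x = 0).
Proof.
move=> tK FK; split.
  move=> [l [l0 l1 ->]] v vK; rewrite (lambda_comb tK FK vK l1).
  by case: ifPn => vF //; split => //; exact: l0.
move=> H; exists (lambda K ^~ x).
have sub (V : lmodType R) (f : pt R -> V) :
    \sum_(v <- K) lambda K v x *: f v = \sum_(v <- F) lambda K v x *: f v.
  rewrite (bigID (mem F)) /= [X in _ + X]big1_seq ?addr0; last first.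
    by move=> v /andP[vF vK]; rewrite (H v vK).2// scale0r.
  rewrite -big_filter; apply: perm_big; apply: uniq_perm.
  - by rewrite filter_uniq// fset_uniq.
  - exact: fset_uniq.
  - move=> v; rewrite mem_filter; apply/andP/idP => [[]//|vF].
    by split => //; exact: (fsubsetP FK).
split.
- by move=> v vF; have [] := H v ((fsubsetP FK) v vF).
- have := sub R^o (fun=> 1); rewrite /GRing.scale /=.
  under eq_bigr do rewrite mulr1; under [RHS]eq_bigr do rewrite mulr1.
  by move=> <-; exact: lambda_sum1.
- by rewrite -(sub _ id) lambda_recomb.
Qed.

Lemma hullP {R : realType} (K : cell R) (x : pt R) : triangle K ->
  hull K x <-> forall v, v \in K -> 0 <= lambda K v x.
Proof.
move=> tK; rewrite (hull_faceP _ tK (fsubset_refl K)); split => H v vK.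
  by case: (H v vK).
by split; [exact: H|rewrite vK].
Qed.

Lemma hull_subset {R : realType} (K F : cell R) : triangle K ->
  (F `<=` K)%fset -> hull F `<=` hull K.
Proof.
move=> tK FK x /(hull_faceP _ tK FK) H; apply/(hullP _ tK) => v vK.
by case: (H v vK).
Qed.

Lemma closed_hull {R : realType} (K : cell R) : triangle K -> closed (hull K).
Proof.
move=> tK.
have -> : hull K = \bigcap_(v in [set v | v \in K]) (lambda K v @^-1` [set t | 0 <= t]).
  by apply/seteqP; split => x; [move=> /(hullP _ tK) H v; exact: H|
    move=> H; apply/(hullP _ tK) => v vK; exact: H].
apply: closed_bigI => v _; apply: preimage_closed; last exact: closed_ge.
by move=> x _; exact: lambda_continuous.
Qed.

Lemma triangle_other {R : realType} (K : cell R) (v : pt R) : triangle K ->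
  v \in K -> exists2 w, w \in K & w != v.
Proof.
move=> [/triangle_enum[a [b [c [E ab ac bc]]]] _].
rewrite (mem_triangle _ E) => vK.
have [va|va] := eqVneq a v.
  by exists b; rewrite ?(mem_triangle _ E) ?eqxx ?orbT// -va eq_sym.
by exists a; rewrite ?(mem_triangle _ E) ?eqxx.
Qed.

Lemma glambda_neq0 {R : realType} (K : cell R) (v : pt R) : triangle K ->
  v \in K -> glambda K v != 0.
Proof.
move=> tK vK; have [w wK wv] := triangle_other tK vK.
apply/eqP => g0; have := lambdaB K v v w; rewrite g0 !lambda_vertex// eqxx.
rewrite eq_sym (negbTE wv) /dot /= !mul0r addr0 subr0 => /eqP.
by rewrite oner_eq0.
Qed.

(** An affine function that is nonnegative on the triangle and vanishes at an
interior point would be constant. *)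
Lemma eltP {R : realType} (K : cell R) (x : pt R) : triangle K ->
  elt K x <-> forall v, v \in K -> 0 < lambda K v x.
Proof.
move=> tK; split.
  move=> xK v vK.
  have xh : hull K x by exact: interior_subset xK.
  have := (hullP _ tK).1 xh v vK; rewrite le_eqVlt => /orP[/eqP l0|//].
  exfalso.
  have [e e0 He] := nbhs_line (glambda K v) (xK : nbhs x (hull K)).
  have Ay : hull K (x + (- e) *: glambda K v).
    by apply: He; rewrite normrN gtr0_norm.
  have := (hullP _ tK).1 Ay v vK; rewrite lambdaD -l0 add0r dotZr.
  by rewrite mulNr oppr_ge0 leNgt mulr_gt0// dot_gt0// glambda_neq0.
move=> H; suff : nbhs x (hull K) by [].
have S : nbhs x [set y | forall v, v \in enum_fset K -> 0 < lambda K v y].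
  apply: (@near_all_seq _ (pt R) (nbhs x) _ (fun v y => 0 < lambda K v y)
    (nbhs_filter x)) => v vK.
  have cl : lambda K v y @[y --> x] --> lambda K v x by exact: lambda_continuous.
  exact: (cl [set t | 0 < t] (lt_nbhsr (H v vK))).
apply: (@filterS _ (nbhs x) (nbhs_filter x) _ (hull K) _ S) => y Hy.
by apply/(hullP _ tK) => v vK; apply: ltW; exact: Hy.
Qed.

Lemma open_elt {R : realType} (K : cell R) : open (elt K).
Proof. exact: open_interior. Qed.

(** * Euclidean distances in triangles *)

Lemma enorm_ge0 {R : realType} (x : pt R) : 0 <= enorm x.
Proof. exact: sqrtr_ge0. Qed.

Lemma sqr_enorm {R : realType} (x : pt R) : enorm x ^+ 2 = dot x x.
Proof. by rewrite sqr_sqrtr// dot_ge0. Qed.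

Lemma enorm_gt0 {R : realType} (x : pt R) : x != 0 -> 0 < enorm x.
Proof. by move=> x0; rewrite sqrtr_gt0 dot_gt0. Qed.

Lemma le_enorm {R : realType} (x : pt R) (r : R) : 0 <= r ->
  (enorm x <= r) = (dot x x <= r ^+ 2).
Proof. by move=> r0; rewrite -sqr_enorm ler_pXn2r// nnegrE enorm_ge0. Qed.

Lemma cauchy_schwarz {R : realType} (x y : pt R) :
  `|dot x y| <= enorm x * enorm y.
Proof.
rewrite -(@ler_pXn2r _ 2) ?nnegrE ?mulr_ge0 ?enorm_ge0//.
rewrite real_normK ?num_real// exprMn !sqr_enorm /dot -subr_ge0.
by apply: le_trans (sqr_ge0 (x.1 * y.2 - x.2 * y.1)) _; rewrite expr2 le_eqVlt; apply/orP; left; apply/eqP; ring.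
Qed.

Lemma enormZ {R : realType} (a : R) (x : pt R) : enorm (a *: x) = `|a| * enorm x.
Proof.
rewrite /enorm; have -> : dot (a *: x) (a *: x) = a ^+ 2 * dot x x.
  by rewrite dotZr dotC dotZr; ring.
by rewrite sqrtrM ?sqr_ge0// sqrtr_sqr.
Qed.

Lemma enormN {R : realType} (x : pt R) : enorm (- x) = enorm x.
Proof. by rewrite -scaleN1r enormZ normrN1 mul1r. Qed.

Lemma discE {R : realType} (m x : pt R) (r : R) : 0 <= r ->
  disc m r x <-> enorm (x - m) <= r.
Proof. by move=> r0; rewrite le_enorm. Qed.

(** Makes the suprema [diam] and [indiam] those of bounded sets. *)
Lemma hull_bounded {R : realType} (K : cell R) :
  exists M, hull K `<=` cbox (- M) M (- M) M.
Proof.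
exists (\sum_(v <- K) (`|v.1| + `|v.2|)) => x [l [l0 l1 ->]].
have l01 v : v \in K -> 0 <= l v <= 1.
  move=> vK; rewrite l0//= -l1.
  by rewrite (big_rem v vK) /= lerDl big_seq sumr_ge0// => w wK; apply: l0; exact: mem_rem wK.
have H (f : pt R -> R) : (forall v, `|f v| <= `|v.1| + `|v.2|) ->
   `|\sum_(v <- K) l v * f v| <= \sum_(v <- K) (`|v.1| + `|v.2|).
  move=> Hf; apply: le_trans (ler_norm_sum _ _ _) _.
  rewrite big_seq [leRHS]big_seq; apply: ler_sum => v vK.
  have /andP[? ?] := l01 v vK.
  rewrite normrM ger0_norm// (le_trans _ (Hf v))// ler_piMl//.
have E1 : (\sum_(v <- K) l v *: v).1 = \sum_(v <- K) l v * v.1.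
  by elim/big_rec2: _ => //= v y1 y2 _ <-.
have E2 : (\sum_(v <- K) l v *: v).2 = \sum_(v <- K) l v * v.2.
  by elim/big_rec2: _ => //= v y1 y2 _ <-.
have := H fst (fun v => ltac:(by rewrite lerDl)).
have := H snd (fun v => ltac:(by rewrite lerDr)).
rewrite -E1 -E2 !ler_norml => /andP[? ?] /andP[? ?]; by split.
Qed.

Lemma dist_le_diam {R : realType} (K : cell R) (x y : pt R) :
  hull K x -> hull K y -> enorm (x - y) <= h_ K.
Proof.
move=> xK yK; apply: ub_le_sup; last by exists x, y.
have [M HM] := hull_bounded K.
exists (Num.sqrt ((2 * M) ^+ 2 + (2 * M) ^+ 2)) => _ [u [v [/HM[? ? ? ?] /HM[? ? ? ?] ->]]].
rewrite /enorm ler_wsqrtr// /dot -!expr2 /=.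
have B (s : R) : - (2 * M) <= s -> s <= 2 * M -> s ^+ 2 <= (2 * M) ^+ 2.
  move=> s1 s2; rewrite -[leLHS]real_normK ?num_real//.
  by rewrite ler_pXn2r ?nnegrE ?ler_norml ?s1//; lra.
by apply: lerD; apply: B; lra.
Qed.

Lemma vertex_hull {R : realType} (K : cell R) (v : pt R) :
  v \in K -> hull K v.
Proof.
move=> vK.
have H (f : pt R -> R) : \sum_(w <- K) (w == v)%:R * f w = f v.
  have := big_uniq_pred1 f v (fset_uniq K); rewrite vK => <-.
  by apply: eq_bigr => w _; rewrite mulrC eq_sym.
exists (fun w => (w == v)%:R); split => //.
- by rewrite -[RHS](H (fun=> 1)); apply: eq_bigr => w _; rewrite mulr1.
- have E1 : (\sum_(w <- K) (w == v)%:R *: w).1 = \sum_(w <- K) (w == v)%:R * w.1.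
    by elim/big_rec2: _ => //= w y1 y2 _ <-.
  have E2 : (\sum_(w <- K) (w == v)%:R *: w).2 = \sum_(w <- K) (w == v)%:R * w.2.
    by elim/big_rec2: _ => //= w y1 y2 _ <-.
  by apply: pt_eq; rewrite ?E1 ?E2 H.
Qed.

Lemma h_gt0 {R : realType} (K : cell R) : triangle K -> 0 < h_ K.
Proof.
move=> tK; case: (tK) => /triangle_enum[a [b [c [E ab _ _]]]] _.
apply: (@lt_le_trans _ _ (enorm (a - b))).
  by apply: enorm_gt0; rewrite subr_eq0.
by apply: dist_le_diam; apply: vertex_hull; rewrite (mem_triangle _ E) eqxx ?orbT.
Qed.

Lemma elt_sub_hull {R : realType} (K : cell R) : elt K `<=` hull K.
Proof. exact: interior_subset. Qed.

Lemma abs_fst_le_enorm {R : realType} (x : pt R) : `|x.1| <= enorm x.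
Proof.
rewrite -sqrtr_sqr /enorm ler_wsqrtr// /dot -!expr2.
by have := sqr_ge0 x.2; lra.
Qed.

Lemma abs_snd_le_enorm {R : realType} (x : pt R) : `|x.2| <= enorm x.
Proof.
rewrite -sqrtr_sqr /enorm ler_wsqrtr// /dot -!expr2.
by have := sqr_ge0 x.1; lra.
Qed.

Lemma hull_sub_box {R : realType} (K : cell R) (x0 : pt R) : hull K x0 ->
  hull K `<=` cbox (x0.1 - h_ K) (x0.1 + h_ K) (x0.2 - h_ K) (x0.2 + h_ K).
Proof.
move=> x0K x xK.
have := le_trans (abs_fst_le_enorm (x - x0)) (dist_le_diam xK x0K).
have := le_trans (abs_snd_le_enorm (x - x0)) (dist_le_diam xK x0K).
rewrite !ler_norml /= => /andP[? ?] /andP[? ?]; split; lra.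
Qed.

(** The supremum [indiam] need not be attained, whence the factor 2. *)
Lemma inscribed_disc {R : realType} (K : cell R) (gam : R) : triangle K ->
  h_ K <= gam * indiam (hull K) ->
  0 < gam /\ exists x0 d, [/\ 0 < d, h_ K <= 2 * gam * d
    & forall y, enorm (y - x0) <= d / 2 -> hull K y].
Proof.
move=> tK hK; have h0 := h_gt0 tK.
set S := [set d | 0 <= d /\ exists x, forall y, enorm (y - x) <= d / 2 -> hull K y].
have gi : 0 < gam * sup S by apply: lt_le_trans hK.
have hS : has_sup S.
  apply: contrapT => nS; move: gi; rewrite sup_out//; first by rewrite mulr0 ltxx.
have i0 : 0 < sup S.
  have i0 : 0 <= sup S.
    have [[d [d0 Hd]] _] := hS.
    exact: le_trans d0 (ub_le_sup hS.2 (conj d0 Hd)).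
  rewrite lt_neqAle i0 andbT eq_sym; apply/eqP => E.
  by rewrite E mulr0 ltxx in gi.
have g0 : 0 < gam by rewrite -(pmulr_lgt0 _ i0).
split => //.
have [|d [d0 [x0 Hx0]] dS] := @sup_adherent _ S (sup S / 2) _ hS.
  by rewrite divr_gt0.
exists x0, d; split => //; first lra.
apply: le_trans hK _; rewrite -/S.
have : sup S <= 2 * d by lra.
by move=> /(ler_wpM2l (ltW g0)); rewrite mulrCA mulrA.
Qed.

Lemma dotNr {R : realType} (n x : pt R) : dot n (- x) = - dot n x.
Proof. by rewrite /dot /=; ring. Qed.

(** A barycentric coordinate varies by at most 1 along the diameter of an
inscribed disc that is parallel to its gradient. *)
Lemma glambda_bound {R : realType} (K : cell R) (v x0 : pt R) (d : R) :
  triangle K -> v \in K -> 0 < d ->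
  (forall y, enorm (y - x0) <= d / 2 -> hull K y) ->
  enorm (glambda K v) * d <= 1.
Proof.
move=> tK vK d0 Hd.
set n := glambda K v.
have n0 : 0 < enorm n by apply: enorm_gt0; exact: glambda_neq0.
have le1 y : hull K y -> 0 <= lambda K v y <= 1.
  move=> yK; have H := (hullP _ tK).1 yK; rewrite H//= -(lambda_sum1 y tK).
  rewrite (big_rem v vK) /= lerDl big_seq sumr_ge0// => w wK; apply: H.
  exact: mem_rem wK.
pose u := (d / 2 / enorm n) *: n.
have uE : enorm u = d / 2.
  rewrite enormZ gtr0_norm ?divr_gt0// divfK ?gt_eqF//.
have h1 : hull K (x0 + u) by apply: Hd; rewrite addrAC subrr add0r uE.
have h2 : hull K (x0 - u) by apply: Hd; rewrite addrAC subrr add0r enormN uE.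
have /andP[_ l1] := le1 _ h1; have /andP[l2 _] := le1 _ h2.
have : lambda K v (x0 + u) - lambda K v (x0 - u) <= 1 by lra.
rewrite !lambdaD dotNr -/n /u dotZr -sqr_enorm.
have -> : d / 2 / enorm n * enorm n ^+ 2 = enorm n * (d / 2).
  by field; rewrite gt_eqF.
lra.
Qed.

(** * Edges and the triangles on their two sides *)

Lemma facesP {R : realType} (K E : cell R) :
  reflect ((E `<=` K)%fset /\ #|` E| = 2%N) (E \in faces K).
Proof.
rewrite /faces !inE /= fpowersetE.
by apply: (iffP andP) => -[? /eqP ?].
Qed.

Lemma edge_enum {R : realType} (E : cell R) : #|` E| = 2%N ->
  enum_fset E = [:: ptA E; ptB E] /\ ptA E != ptB E.
Proof.
rewrite /ptA /ptB; have := fset_uniq E.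
case: (enum_fset E) => [|a [|b [|c s]]] //=.
by rewrite inE andbT => ab _.
Qed.

Lemma mem_edge {R : realType} (E : cell R) (v : pt R) : #|` E| = 2%N ->
  (v \in E) = (v == ptA E) || (v == ptB E).
Proof.
move=> /edge_enum[EE _]; have -> : (v \in E) = (v \in enum_fset E) by [].
by rewrite EE !inE.
Qed.

Lemma ptA_in {R : realType} (E : cell R) : #|` E| = 2%N -> ptA E \in E.
Proof. by move=> E2; rewrite mem_edge// eqxx. Qed.

Lemma ptB_in {R : realType} (E : cell R) : #|` E| = 2%N -> ptB E \in E.
Proof. by move=> E2; rewrite mem_edge// eqxx orbT. Qed.

Lemma len_gt0 {R : realType} (E : cell R) : #|` E| = 2%N -> 0 < len E.
Proof.
by move=> /edge_enum[_ AB]; apply: enorm_gt0; rewrite subr_eq0 eq_sym.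
Qed.

Lemma dot_perp {R : realType} (x : pt R) : dot (perp x) x = 0.
Proof. by rewrite /dot /=; ring. Qed.

Lemma dot_nrm_edge {R : realType} (E : cell R) : dot (nrm E) (ptB E - ptA E) = 0.
Proof. by rewrite /nrm dotC dotZr dotC dot_perp mulr0. Qed.

Lemma dot_nrm_nrm {R : realType} (E : cell R) : #|` E| = 2%N ->
  dot (nrm E) (nrm E) = 1.
Proof.
move=> E2; have l0 := len_gt0 E2.
rewrite {2}/nrm dotZr dotC {1}/nrm dotZr.
have -> : dot (perp (ptB E - ptA E)) (perp (ptB E - ptA E)) = len E ^+ 2.
  by rewrite /len sqr_enorm /dot /=; ring.
by field; rewrite gt_eqF.
Qed.

Lemma opposite_vertex {R : realType} (K E : cell R) : #|` K| = 3%N ->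
  E \in faces K -> exists c, [/\ c \in K, c \notin E
    & forall v, v \in K -> v \in E \/ v = c].
Proof.
move=> K3 /facesP[EK E2].
have : #|` (K `\` E)%fset| = 1%N by rewrite cardfsD (fsetIidPr EK) K3 E2.
move=> /eqP /cardfs1P[c Hc].
have : c \in (K `\` E)%fset by rewrite Hc inE.
rewrite in_fsetD => /andP[cE cK]; exists c; split => // v vK.
have [vE|vE] := boolP (v \in E); [by left|right].
have : v \in (K `\` E)%fset by rewrite in_fsetD vE.
by rewrite Hc inE => /eqP.
Qed.

(** The signed distance to the line of an edge is proportional to the barycentric
coordinate of the opposite vertex [c]: both are affine and vanish on the edge.
This makes [side] a sign of [lambda K c]. *)
Lemma side_lambda {R : realType} (K E : cell R) : triangle K -> E \in faces K ->
  exists c h, [/\ c \in K, c \notin E, forall v, v \in K -> v \in E \/ v = c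
    & [/\ 0 < h, side K E = 1 \/ side K E = -1
    & forall x, side K E * dot (nrm E) (x - ptA E) = h * lambda K c x]].
Proof.
move=> tK EK; case: (tK) => K3 _.
have [c [cK cE Hc]] := opposite_vertex K3 EK.
have [_ E2] := facesP _ _ EK.
set n := nrm E.
have zero v : v \in E -> dot n (v - ptA E) = 0.
  rewrite mem_edge// => /orP[] /eqP ->; last exact: dot_nrm_edge.
  by rewrite subrr /dot /= !mulr0 addr0.
have only (f : pt R -> R) : (forall v, v \in E -> f v = 0) ->
    \sum_(v <- K) f v = f c.
  move=> f0; rewrite (big_rem c cK) /= big_seq big1 ?addr0// => v.
  rewrite mem_rem_uniq ?fset_uniq// inE => /andP[vc vK].
  by case: (Hc v vK) => [/f0//|/eqP]; rewrite (negbTE vc).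
have E1 x : dot n (x - ptA E) = lambda K c x * dot n (c - ptA E).
  have R1 : dot n x = \sum_(v <- K) lambda K v x * dot n v.
    by rewrite -dot_suml lambda_recomb.
  have R2 : dot n (ptA E) = \sum_(v <- K) lambda K v x * dot n (ptA E).
    by rewrite -mulr_suml lambda_sum1// mul1r.
  rewrite [LHS]dotBr R1 [X in _ - X]R2 -sumrB.
  rewrite (only (fun v => lambda K v x * dot n v - lambda K v x * dot n (ptA E))).
    by rewrite -mulrBr dotBr.
  by move=> v vE; rewrite -mulrBr -dotBr zero// mulr0.
have cn0 : dot n (c - ptA E) != 0.
  apply/eqP => c0; have := E1 (ptA E + n).
  rewrite c0 mulr0 addrAC subrr add0r dot_nrm_nrm// => /eqP.
  by rewrite oner_eq0.
have sE : side K E = Num.sg (dot n (c - ptA E)) by rewrite /side only.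
exists c, `|dot n (c - ptA E)|; split => //; split.
- by rewrite normr_gt0.
- rewrite sE; case: (sgrP (dot n (c - ptA E))) => [c0|_|_]; [|by left|by right].
  by rewrite c0 eqxx in cn0.
- by move=> x; rewrite sE E1 normrEsg; ring.
Qed.

Definition mid {R : realType} (E : cell R) : pt R := 2^-1 *: (ptA E + ptB E).

Lemma dot_nrm_mid {R : realType} (E : cell R) (x : pt R) :
  dot (nrm E) (x - mid E) = dot (nrm E) (x - ptA E).
Proof.
have := dot_nrm_edge E; rewrite !dotBr /mid dotZr dotDr; lra.
Qed.

Lemma lambda_mid {R : realType} (K E : cell R) v : triangle K -> E \in faces K ->
  v \in E -> lambda K v (mid E) = 2^-1.
Proof.
move=> tK /facesP[EK E2] vE; have [EE AB] := edge_enum E2.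
have vK := fsubsetP EK _ vE.
have A := lambda_vertex tK vK (fsubsetP EK _ (ptA_in E2)).
have B := lambda_vertex tK vK (fsubsetP EK _ (ptB_in E2)).
have : lambda K v (mid E) = 2^-1 * (lambda K v (ptA E) + lambda K v (ptB E)).
  rewrite /lambda /mid dotZr dotDr; lra.
rewrite A B; move: vE; rewrite mem_edge// => /orP[] /eqP ->.
  by rewrite eqxx (negbTE AB) addr0 mulr1.
by rewrite eqxx eq_sym (negbTE AB) add0r mulr1.
Qed.

Lemma lambda_near_mid {R : realType} (K E : cell R) v (x : pt R) (r : R) :
  triangle K -> E \in faces K -> v \in E -> enorm (glambda K v) * r <= 4^-1 ->
  enorm (x - mid E) <= r -> 0 < lambda K v x.
Proof.
move=> tK EK vE gr xr.
have := lambdaB K v x (mid E); rewrite (lambda_mid tK EK vE).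
have := cauchy_schwarz (glambda K v) (x - mid E); rewrite ler_norml => /andP[+ _].
have := ler_wpM2l (enorm_ge0 (glambda K v)) xr; lra.
Qed.

(** Near the midpoint of an edge, the barycentric coordinates of the two end
points stay positive, as they equal [1/2] at the midpoint; only the sign of the
third one matters. *)
Lemma half_disc {R : realType} (K E : cell R) (x : pt R) (r : R) :
  triangle K -> E \in faces K ->
  (forall v, v \in K -> enorm (glambda K v) * r <= 4^-1) ->
  enorm (x - mid E) <= r ->
  (0 < side K E * dot (nrm E) (x - ptA E) -> elt K x) /\
  (0 <= side K E * dot (nrm E) (x - ptA E) -> hull K x).
Proof.
move=> tK EK gr xr; have [EsK _] := facesP _ _ EK.
have [c [h [cK cE Hc [h0 _ ->]]]] := side_lambda tK EK.
rewrite pmulr_rgt0// pmulr_rge0//.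
have H v : v \in E -> 0 < lambda K v x.
  by move=> vE; apply: (lambda_near_mid tK EK vE _ xr); apply: gr; exact: (fsubsetP EsK).
split => lc.
  by apply/(eltP _ tK) => v /Hc[/H//|->].
by apply/(hullP _ tK) => v /Hc[/H/ltW//|->].
Qed.

Lemma hull_side {R : realType} (K E : cell R) (x : pt R) :
  triangle K -> E \in faces K -> hull K x ->
  0 <= side K E * dot (nrm E) (x - ptA E).
Proof.
move=> tK EK xK; have [c [h [cK cE Hc [h0 _ ->]]]] := side_lambda tK EK.
by rewrite mulr_ge0 ?(ltW h0)//; apply: (hullP _ tK).1.
Qed.

Lemma mesh_triangle {R : realType} (Om : set (pt R)) (T : mesh R) K :
  conforming_mesh Om T -> K \in T -> triangle K.
Proof. by move=> [H _ _] /H. Qed.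

(** An interior point of both triangles lies in the hull of their common vertices
and has positive coordinates at all the vertices. *)
Lemma elt_disjoint {R : realType} (Om : set (pt R)) (T : mesh R) (K K' : cell R) x :
  conforming_mesh Om T -> K \in T -> K' \in T -> elt K x -> elt K' x -> K = K'.
Proof.
move=> mT KT K'T xK xK'; have tK := mesh_triangle mT KT.
have tK' := mesh_triangle mT K'T; case: (mT) => _ _ conf.
have : hull (K `&` K')%fset x.
  by rewrite -conf//; split; exact: elt_sub_hull.
move=> /(hull_faceP _ tK (fsubsetIl _ _)) H.
have KK' : (K `<=` K')%fset.
  apply/fsubsetP => v vK; have [vI|vI] := boolP (v \in (K `&` K')%fset).
    by move: vI; rewrite in_fsetI => /andP[].
  have := (eltP _ tK).1 xK v vK; rewrite (H v vK).2// ltxx.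
  by [].
by apply/eqP; rewrite eqEfcard KK' tK.1 tK'.1 leqnn.
Qed.

Lemma exists_radius {R : realType} (K : cell R) :
  exists2 r, 0 < r & forall v s, v \in K -> 0 <= s -> s <= r -> enorm (glambda K v) * s <= 4^-1.
Proof.
pose S := \sum_(v <- K) enorm (glambda K v).
have S0 : 0 <= S by apply: sumr_ge0 => v _; exact: enorm_ge0.
exists (4^-1 / (1 + S)); first by rewrite divr_gt0//; lra.
move=> v s vK s0; rewrite ler_pdivlMr; last lra.
apply: le_trans; rewrite mulrC ler_wpM2l//.
rewrite (le_trans (_ : _ <= S)) ?lerDr// /S (big_rem v vK) /= lerDl.
by apply: sumr_ge0 => w _; exact: enorm_ge0.
Qed.

Lemma enorm_nrm {R : realType} (E : cell R) : #|` E| = 2%N -> enorm (nrm E) = 1.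
Proof. by move=> E2; rewrite /enorm dot_nrm_nrm// sqrtr1. Qed.

(** Two triangles on the same side of a common edge overlap near its midpoint. *)
Lemma same_side_unique {R : realType} (Om : set (pt R)) (T : mesh R)
    (K K' E : cell R) : conforming_mesh Om T -> K \in T -> K' \in T ->
  E \in faces K -> E \in faces K' -> side K E = side K' E -> K = K'.
Proof.
move=> mT KT K'T EK EK' sKK'; have tK := mesh_triangle mT KT.
have tK' := mesh_triangle mT K'T.
have [_ E2] := facesP _ _ EK.
have [r r0 Hr] := exists_radius K; have [r' r'0 Hr'] := exists_radius K'.
pose s := Num.min r r'.
have s0 : 0 < s by rewrite lt_min r0.
have sr : s <= r by rewrite ge_min lexx.
have sr' : s <= r' by rewrite ge_min lexx orbT.
pose x := mid E + (side K E * s) *: nrm E.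
have sgn : side K E * side K E = 1.
  by have [c [h [_ _ _ [_ [->|->] _]]]] := side_lambda tK EK; ring.
have xm : enorm (x - mid E) <= s.
  rewrite /x addrAC subrr add0r enormZ enorm_nrm// mulr1 normrM (gtr0_norm s0).
  have -> : `|side K E| = 1 by apply/eqP; rewrite -sqr_norm_eq1// expr2 sgn.
  by rewrite mul1r.
have pos : 0 < side K E * dot (nrm E) (x - ptA E).
  rewrite -dot_nrm_mid /x addrAC subrr add0r dotZr dot_nrm_nrm// mulr1.
  by rewrite mulrA sgn mul1r.
apply: (@elt_disjoint _ Om T K K' x) => //.
  apply: (half_disc tK EK _ xm).1 => // v vK; apply: Hr => //; exact: ltW.
apply: (half_disc tK' EK' _ xm).1; last by rewrite -sKK'.
by move=> v vK; apply: Hr' => //; exact: ltW.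
Qed.

Lemma nbhs_edisc {R : realType} (y : pt R) (d : R) : 0 < d ->
  nbhs y [set z | enorm (z - y) < d].
Proof.
move=> d0.
have cv : (fun z : pt R => dot (z - y) (z - y)) z @[z --> y] --> dot (y - y) (y - y).
  exact: (smooth_continuous (smooth_sqdist y)).
have : dot (y - y) (y - y) < d ^+ 2.
  by rewrite subrr /dot /= !mulr0 addr0 exprn_gt0.
move=> /lt_nbhsl H; apply: (@filterS _ (nbhs y) (nbhs_filter y) _ _ _ (cv _ H)) => z /=.
by rewrite -sqr_enorm ltr_pXn2r// nnegrE ?enorm_ge0// ltW.
Qed.

(** Below a boundary point, in the local graph coordinates, there are points that
are not limits of points of the domain. *)
Lemma lipschitz_regular_open {R : realType} (Om : set (pt R)) :
  open Om -> lipschitz_boundary Om -> (closure Om)° `<=` Om.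
Proof.
move=> oOm lip x xc; apply: contrapT => nx.
have bx : boundary Om x.
  by split; [exact: interior_subset xc|move=> /interior_subset].
have [e [k [g [e1 gL near_x]]]] := lip x bx.
have nxg := nbhs_singleton near_x.
have gx : dot x e <= g (dot x (perp e)).
  by rewrite leNgt; apply/negP => /nxg.
have U0 : nbhs x ((closure Om)° `&`
    [set y | Om y <-> g (dot y (perp e)) < dot y e]°).
  apply: filterI; first by apply: open_nbhs_nbhs; split => //; exact: open_interior.
  by apply: open_nbhs_nbhs; split => //; exact: open_interior.
have [s s0 Hs] := nbhs_line e U0.
(* A point strictly below the graph. *)
pose y := x + (- s) *: e.
have [yc yU] : ((closure Om)° `&` [set y | Om y <-> g (dot y (perp e)) < dot y e]°) y.
  by apply: Hs; rewrite normrN gtr0_norm.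
have k0 : 0 < 1 + `|k| by rewrite ltr_pwDl.
have Hk a b : `|g a - g b| <= k * `|a - b|.
  by have := gL (a, b); rewrite /=; apply.
have ycl : closure Om y by exact: interior_subset yc.
have d0 : 0 < s / (1 + `|k|) / 2 by rewrite !divr_gt0.
have nb : nbhs y ([set z | enorm (z - y) < s / (1 + `|k|) / 2] `&`
    [set y | Om y <-> g (dot y (perp e)) < dot y e]).
  by apply: filterI; [exact: nbhs_edisc|exact: yU].
have [z [Oz [/= zy zU]]] := ycl _ nb.
have := zU.1 Oz; apply/negP; rewrite -leNgt.
have ee : dot e e = 1 by rewrite -sqr_enorm e1 expr1n.
have epe : dot e (perp e) = 0 by rewrite dotC dot_perp.
have pe1 : enorm (perp e) = 1 by rewrite -e1 /enorm /dot /=; congr Num.sqrt; ring.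
have h1 := cauchy_schwarz e (z - y).
have h2 := cauchy_schwarz (perp e) (z - y).
rewrite e1 mul1r in h1; rewrite pe1 mul1r in h2.
have h3 := Hk (dot z (perp e)) (dot y (perp e)).
have E1 : dot z (perp e) - dot y (perp e) = dot (perp e) (z - y).
  by rewrite dotBr !(dotC (perp e)).
rewrite E1 in h3.
have E2 : dot y e = dot x e - s.
  by rewrite dotC /y dotDr dotZr ee dotC; ring.
have E3 : dot y (perp e) = dot x (perp e).
  by rewrite dotC /y dotDr dotZr (dotC (perp e) e) epe dotC; ring.
have E4 : dot z e = dot y e + dot e (z - y) by rewrite dotBr !(dotC e); ring.
rewrite E4 E2; rewrite E3 in h3.
have h4 : k * `|dot (perp e) (z - y)| <= `|k| * enorm (z - y).
  by apply: le_trans (ler_wpM2r _ (ler_norm k)) _ => //; rewrite ler_wpM2l.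
have h5 : (1 + `|k|) * enorm (z - y) <= s / 2.
  apply: le_trans (ler_wpM2l (ltW k0) (ltW zy)) _.
  by rewrite le_eqVlt; apply/orP; left; apply/eqP; field; rewrite gt_eqF.
move: h1 h3; rewrite !ler_norml => /andP[_ h1] /andP[h3 _].
have := enorm_ge0 (z - y); lra.
Qed.

Lemma elt_sub_domain {R : realType} (Om : set (pt R)) (T : mesh R) (K : cell R) :
  open Om -> lipschitz_boundary Om -> conforming_mesh Om T -> K \in T ->
  elt K `<=` Om.
Proof.
move=> oOm lip [_ rT _] KT.
apply: subset_trans (lipschitz_regular_open oOm lip).
apply: interiorS; rewrite -rT => x xK; by exists K.
Qed.

(** The edge has a point in the domain.  Points slightly beyond the edge are still
in the domain, so they belong to a triangle of the mesh; this triangle contains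
a relative interior point of the edge, hence, by conformity, the edge. *)
Lemma two_sides {R : realType} (Om : set (pt R)) (T : mesh R) (K E : cell R) :
  open Om -> conforming_mesh Om T -> K \in T -> E \in faces K ->
  ~ hull E `<=` boundary Om ->
  exists K', [/\ K' \in T, E \in faces K' & side K' E = - side K E].
Proof.
move=> oOm mT KT EK nb; have tK := mesh_triangle mT KT.
have [EsK E2] := facesP _ _ EK; case: (mT) => _ rT conf.
have [x xE nbx] : exists2 x, hull E x & ~ boundary Om x.
  by apply: contrapT => H; apply: nb => x xE; apply: contrapT => bx; apply: H; exists x.
have xc : closure Om x.
  by rewrite -rT; exists K => //; exact: (hull_subset tK EsK).
have xO : nbhs x Om.
  by have : Om° x by apply: contrapT => n; apply: nbx.
have [c [h [cK cE Hc [h0 sg sl]]]] := side_lambda tK EK.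
have [t0 t00 Ht] := nbhs_line (mid E - x) xO.
pose t := Num.min t0 1.
have tp : 0 < t by rewrite lt_min t00 ltr01.
have t1 : t <= 1 by rewrite ge_min lexx orbT.
(* Moving towards the midpoint makes the coordinates at both ends positive. *)
pose y := x + t *: (mid E - x).
have Oy : Om y by apply: Ht; rewrite gtr0_norm// ge_min lexx.
have xL := (hull_faceP x tK EsK).1 xE.
have lc : dot (nrm E) (y - ptA E) = 0.
  have cx : lambda K c x = 0 by apply: (xL c cK).2.
  have dx : dot (nrm E) (x - ptA E) = 0.
    have := sl x; rewrite cx mulr0 => /eqP; rewrite mulf_eq0 => /orP[/eqP|/eqP//].
    by case: sg => -> /eqP; rewrite ?oppr_eq0 oner_eq0.
  have dm : dot (nrm E) (mid E - ptA E) = 0.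
    by rewrite -dot_nrm_mid subrr /dot /= !mulr0 addr0.
  have -> : dot (nrm E) (y - ptA E) = (1 - t) * dot (nrm E) (x - ptA E) +
      t * dot (nrm E) (mid E - ptA E).
    by rewrite /y; move: (nrm E) (ptA E) (mid E) => n a m; rewrite /dot /=
      /GRing.scale /=; ring.
  by rewrite dx dm !mulr0 addr0.
have lE v : v \in E -> 0 < lambda K v y.
  move=> vE; have vK := fsubsetP EsK _ vE.
  rewrite /y lambdaD dotZr -lambdaB (lambda_mid tK EK vE).
  by have := (xL v vK).1; nra.
have cy : lambda K c y = 0.
  have := sl y; rewrite lc mulr0 => /esym/eqP; rewrite mulf_eq0 gt_eqF//=.
  by move=> /eqP.
have yK : hull K y.
  by apply/(hullP _ tK) => v /Hc[/lE/ltW//|->]; rewrite cy.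
have nby : nbhs y (Om `&` [set z | forall K', K' \in enum_fset T ->
    ~ hull K' y -> ~ hull K' z]).
  apply: filterI; first exact: open_nbhs_nbhs.
  apply: (@near_all_seq _ (pt R) (nbhs y) _ (fun K' z => ~ hull K' y -> ~ hull K' z)
    (nbhs_filter y)) => K' K'T.
  have [yK'|yK'] := pselect (hull K' y).
    by apply: (@filterS _ (nbhs y) (nbhs_filter y) _ _ _ filterT).
  have : nbhs y (~` hull K').
    apply: open_nbhs_nbhs; split => //; apply: closed_openC; apply: closed_hull.
    exact: mesh_triangle mT K'T.
  by apply: (@filterS _ (nbhs y) (nbhs_filter y)) => z nz _.
have [s s0 Hs] := nbhs_line ((- side K E) *: nrm E) nby.
have [Oz zT] := Hs s (ltac:(by rewrite gtr0_norm)).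
set z := y + _ in Oz zT.
have [K' K'T zK'] : region T z by rewrite rT; exact: subset_closure.
have yK' : hull K' y by apply: contrapT => n; exact: (zT K' K'T n).
have tK' := mesh_triangle mT K'T.
have : hull (K `&` K')%fset y by rewrite -conf.
move=> /(hull_faceP _ tK (fsubsetIl _ _)) yI.
have EK' : E \in faces K'.
  apply/facesP; split => //; apply/fsubsetP => v vE.
  have [|vI] := boolP (v \in (K `&` K')%fset).
    by rewrite in_fsetI => /andP[].
  have := lE v vE; rewrite (yI v (fsubsetP EsK _ vE)).2// ltxx.
  by [].
exists K'; split => //.
have := hull_side tK' EK' zK'.
have -> : dot (nrm E) (z - ptA E) = - (s * side K E).
  have -> : dot (nrm E) (z - ptA E) =
      dot (nrm E) (y - ptA E) - s * side K E * dot (nrm E) (nrm E).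
    by rewrite /z; move: (nrm E) (ptA E) (side K E) => n a q; rewrite /dot /=
      /GRing.scale /=; ring.
  by rewrite lc dot_nrm_nrm// mulr1 sub0r.
have [_ [_ [_ _ _ [_ sg' _]]]] := side_lambda tK' EK'.
by case: sg => ->; case: sg' => ->; rewrite ?opprK => //; nra.
Qed.

Lemma sum_interior_edge {R : realType} (V : nmodType) (Om : set (pt R))
    (T : mesh R) (K1 K2 E : cell R) (f : cell R -> V) :
  conforming_mesh Om T -> K1 \in T -> K2 \in T ->
  E \in faces K1 -> E \in faces K2 -> side K1 E = 1 -> side K2 E = -1 ->
  \sum_(K <- T | (E `<=` K)%fset) f K = f K1 + f K2.
Proof.
move=> mT K1T K2T EK1 EK2 s1 s2.
have [sE1 E2] := facesP _ _ EK1; have [sE2 _] := facesP _ _ EK2.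
have K12 : K1 != K2.
  apply/eqP => e; move: s2; rewrite -e s1 => /eqP.
  by rewrite -addr_eq0 -[1]/(1%:R) -natrD pnatr_eq0.
have tri K : K \in T -> (E `<=` K)%fset -> K = K1 \/ K = K2.
  move=> KT sE; have EK : E \in faces K by apply/facesP.
  have tK := mesh_triangle mT KT.
  have [_ [_ [_ _ _ [_ sg _]]]] := side_lambda tK EK.
  case: sg => s; [left|right];
    by apply: (same_side_unique mT KT _ EK) => //; rewrite s ?s1 ?s2.
rewrite (big_rem K1 K1T) /= sE1; congr (_ + _).
have K2r : K2 \in rem K1 (enum_fset T).
  by rewrite mem_rem_uniq ?fset_uniq// inE eq_sym K12.
rewrite (big_rem K2 K2r) /= sE2 -[RHS]addr0; congr (_ + _).
rewrite big_seq_cond big1// => K /andP[].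
rewrite mem_rem_uniq ?rem_uniq ?fset_uniq// inE => /andP[n2].
rewrite mem_rem_uniq ?fset_uniq// inE => /andP[n1 KT] sE.
by case: (tri K KT sE) => e; [rewrite e eqxx in n1|rewrite e eqxx in n2].
Qed.

Lemma interior_edge_pair {R : realType} (Om : set (pt R)) (T : mesh R) (K E : cell R) :
  open Om -> conforming_mesh Om T -> K \in T -> E \in faces K ->
  ~~ boundary_edge Om E ->
  exists K1 K2, [/\ K1 \in T, K2 \in T, E \in faces K1, E \in faces K2
    & side K1 E = 1 /\ side K2 E = -1].
Proof.
move=> oOm mT KT EK /asboolP nb.
have [K' [K'T EK' sE]] := two_sides oOm mT KT EK nb.
have tK := mesh_triangle mT KT.
have [_ [_ [_ _ _ [_ sg _]]]] := side_lambda tK EK.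
case: sg => s; first by exists K, K'; rewrite sE s.
by exists K', K; rewrite sE s opprK.
Qed.

(** The map [K |-> side K E] is injective on the triangles that contain [E]. *)
Lemma card_edge_elements {R : realType} (Om : set (pt R)) (T : mesh R) (E : cell R) :
  conforming_mesh Om T -> #|` E| = 2%N ->
  (count (fun K : cell R => (E `<=` K)%fset) (enum_fset T) <= 2)%N.
Proof.
move=> mT E2; rewrite -size_filter.
pose s := [seq K <- enum_fset T | (E `<=` K)%fset]; rewrite -/s.
have inj : {in s &, injective (side (R := R) ^~ E)}.
  move=> K K'; rewrite !mem_filter => /andP[EK KT] /andP[EK' K'T].
  by apply: (same_side_unique mT KT K'T); apply/facesP.
have us : uniq s by rewrite filter_uniq// fset_uniq.
rewrite -(size_map (side (R := R) ^~ E)).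
have um : uniq [seq side K E | K <- s] by rewrite map_inj_in_uniq.
apply: (@uniq_leq_size _ _ [:: 1; -1]) => // _ /mapP[K + ->].
rewrite mem_filter => /andP[EK KT].
have tK := mesh_triangle mT KT.
have EKf : E \in faces K by apply/facesP.
have [_ [_ [_ _ _ [_ sg _]]]] := side_lambda tK EKf.
by case: sg => ->; rewrite !inE eqxx ?orbT.
Qed.

(** * Square integrable functions and weak derivatives *)

(** The same notion as [L2] over an arbitrary measure space; the lemmas on [L2]
are instances of lemmas on [sqint]. *)
Definition sqint d (X : measurableType d) (R : realType)
    (mu : {measure set X -> \bar R}) (D : set X) (u : X -> R) :=
  measurable_fun D u /\ mu.-integrable D (fun x => (u x ^+ 2)%:E).

Section square_integrable.
Context d (X : measurableType d) (R : realType).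
Variables (mu : {measure set X -> \bar R}) (D : set X).
Hypothesis mD : measurable D.
Implicit Types u v : X -> R.

Lemma sqint_mul u v : sqint mu D u -> sqint mu D v ->
  mu.-integrable D (EFin \o (fun x => u x * v x)).
Proof.
move=> [mu_ iu] [mv iv].
apply: (le_integrable mD _ _ (integrableD mD iu iv)).
  by apply/measurable_EFinP; exact: measurable_funM.
move=> x _ /=; rewrite lee_fin.
rewrite [leRHS]ger0_norm ?addr_ge0 ?sqr_ge0//.
rewrite normrM -(real_normK (num_real (u x))) -(real_normK (num_real (v x))).
have := sqr_ge0 (`|u x| - `|v x|); rewrite sqrrB.
have := mulr_ge0 (normr_ge0 (u x)) (normr_ge0 (v x)); lra.
Qed.

Lemma sqintD u v : sqint mu D u -> sqint mu D v ->
  sqint mu D (fun x => u x + v x).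
Proof.
move=> su sv; have iuv := sqint_mul su sv; case: su sv => [mu_ iu] [mv iv].
split; first exact: measurable_funD.
have := integrableD mD (integrableD mD iu iv) (integrableZl mD 2 iuv).
congr (_.-integrable _ _); apply/funext => x /=.
by rewrite -!EFinM -!EFinD; congr EFin; ring.
Qed.

Lemma sqintZ (c : R) u : sqint mu D u -> sqint mu D (fun x => c * u x).
Proof.
move=> [mu_ iu]; split; first exact: measurable_funM.
have := integrableZl mD (c ^+ 2) iu.
congr (_.-integrable _ _); apply/funext => x /=.
by rewrite -!EFinM exprMn.
Qed.

Lemma sqint_bounded u (B : R) : (mu D < +oo)%E -> measurable_fun D u ->
  (forall x, D x -> `|u x| <= B) -> sqint mu D u.
Proof.
move=> Dfin mu_ uB; split => //.
have iB : mu.-integrable D (EFin \o cst (B ^+ 2)).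
  apply/integrableP; split; first exact/measurable_EFinP/measurable_cst.
  rewrite (eq_integral (cst ((B ^+ 2)%:E))).
    by rewrite integral_cst// lte_mul_pinfty// ?lee_fin ?sqr_ge0.
  by move=> x _ /=; rewrite ger0_norm ?sqr_ge0.
apply: (le_integrable mD _ _ iB).
  by apply/measurable_EFinP; exact: measurable_funX.
move=> x Dx /=; rewrite lee_fin !normrX.
by rewrite lerXn2r ?nnegrE// (le_trans (uB x Dx))// ler_norm.
Qed.

Lemma Rintegral_ae_eq (u v : X -> R) : measurable_fun D u -> measurable_fun D v ->
  {ae mu, forall x, D x -> u x = v x} ->
  \int[mu]_(x in D) u x = \int[mu]_(x in D) v x.
Proof.
move=> mu_ mv uv; rewrite /Rintegral; congr fine.
apply: ae_eq_integral => //; [exact/measurable_EFinP..|].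
by apply: filterS uv => x H Dx; rewrite H.
Qed.

End square_integrable.

Section L2_toolkit.
Context (R : realType) (Om : set (pt R)).
Hypothesis mOm : measurable Om.
Implicit Types u v : pt R -> R.

Lemma L2M u v : L2 Om u -> L2 Om v ->
  leb2.-integrable Om (EFin \o (fun x => u x * v x)).
Proof. exact: (@sqint_mul _ _ _ leb2 Om mOm u v). Qed.

Lemma L2D u v : L2 Om u -> L2 Om v -> L2 Om (fun x => u x + v x).
Proof. exact: (@sqintD _ _ _ leb2 Om mOm u v). Qed.

Lemma L2Z (c : R) u : L2 Om u -> L2 Om (fun x => c * u x).
Proof. exact: (@sqintZ _ _ _ leb2 Om mOm c u). Qed.

Lemma L2B u v : L2 Om u -> L2 Om v -> L2 Om (fun x => u x - v x).
Proof.
move=> Lu Lv; have := L2D Lu (L2Z (-1) Lv).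
by congr L2; apply/funext => x; rewrite mulN1r.
Qed.

Lemma L2_bounded u (B : R) : (leb2 Om < +oo)%E -> measurable_fun Om u ->
  (forall x, Om x -> `|u x| <= B) -> L2 Om u.
Proof. exact: (@sqint_bounded _ _ _ leb2 Om mOm u B). Qed.

End L2_toolkit.

Lemma leb2_bounded_fin {R : realType} (Om : set (pt R)) : measurable Om ->
  bounded_set Om -> (leb2 Om < +oo)%E.
Proof.
move=> mOm /bounded_set_cbox[M HM].
apply: le_lt_trans (leb2_cbox_fin M).
by apply: (@le_measure _ _ _ leb2) => //; rewrite inE//; exact: measurable_cbox.
Qed.

Section weak_derivatives.
Context (R : realType) (Om : set (pt R)).
Hypotheses (oOm : open Om) (bOm : bounded_set Om).
Let mOm : measurable Om := open_measurable2 oOm.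
Let finOm : (leb2 Om < +oo)%E := leb2_bounded_fin mOm bOm.

Lemma L2_cst (c : R) : L2 Om (fun=> c).
Proof.
by apply: (L2_bounded mOm (B := `|c|) finOm) => //; exact: measurable_cst.
Qed.

Lemma L2_integrable u : L2 Om u -> leb2.-integrable Om (EFin \o u).
Proof.
move=> Lu; have := L2M mOm Lu (L2_cst 1).
by congr (_.-integrable _ _); apply/funext => x /=; rewrite mulr1.
Qed.

Lemma test_fun_L2 (phi : pt R -> R) : test_fun Om phi -> L2 Om phi.
Proof.
move=> tp; have [B HB] := test_fun_bounded tp.
apply: (L2_bounded mOm (B := B) finOm) => //.
by apply: measurable_funTS; apply: smooth_measurable; case: tp.
Qed.

Lemma weak_pder_unique i u w w' : L2 Om w -> L2 Om w' ->
  weak_pder Om i u w -> weak_pder Om i u w' ->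
  {ae leb2, forall x, Om x -> w x = w' x}.
Proof.
move=> Lw Lw' Hw Hw'.
have LB := L2B mOm Lw Lw'.
have := @fundamental_lemma_calculus_variations R Om (fun x => w x - w' x) oOm
  (L2_integrable LB).
move=> H; apply: leb2_ae_imp (H _) => [x E Ox|phi tp].
  by apply/eqP; rewrite -subr_eq0 E.
have Lp := test_fun_L2 tp.
under eq_Rintegral do rewrite mulrBl.
have E := Hw _ tp; rewrite (Hw' _ tp) in E.
rewrite (@RintegralB _ _ _ leb2)//; [|exact: L2M|exact: L2M].
by rewrite -(oppr_inj E) subrr.
Qed.

Lemma wD_spec i u : H1 Om u -> L2 Om (wD Om i u) /\ weak_pder Om i u (wD Om i u).
Proof.
move=> [_ /(_ i)[w Lw Hw]].
exact: (@xgetPex _ _ [set w | L2 Om w /\ weak_pder Om i u w] (ex_intro _ w (conj Lw Hw))).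
Qed.

(** This is what makes the choice in the definition of [wD] harmless. *)
Lemma wD_eq i u w : H1 Om u -> L2 Om w -> weak_pder Om i u w ->
  {ae leb2, forall x, Om x -> wD Om i u x = w x}.
Proof. by move=> /(wD_spec i)[Lu wu] Lw Hw; exact: (weak_pder_unique Lu Lw wu Hw). Qed.

Lemma weak_pderB i u v w z : L2 Om u -> L2 Om v -> L2 Om w -> L2 Om z ->
  weak_pder Om i u w -> weak_pder Om i v z ->
  weak_pder Om i (fun x => u x - v x) (fun x => w x - z x).
Proof.
move=> Lu Lv Lw Lz Hw Hz phi tp.
have Lp := test_fun_L2 tp; have Ldp := test_fun_L2 (test_fun_pder i tp).
under eq_Rintegral do rewrite mulrBl.
under [in RHS]eq_Rintegral do rewrite mulrBl.
rewrite !(@RintegralB _ _ _ leb2)//; try exact: L2M.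
by rewrite (Hw _ tp) (Hz _ tp) opprB opprK addrC.
Qed.

Lemma H1B u v : H1 Om u -> H1 Om v -> H1 Om (fun x => u x - v x).
Proof.
move=> Hu Hv; split; first exact: L2B Hu.1 Hv.1.
move=> i; have [Lu wu] := wD_spec i Hu; have [Lv wv] := wD_spec i Hv.
exists (fun x => wD Om i u x - wD Om i v x); first exact: L2B.
exact: weak_pderB Hu.1 Hv.1 Lu Lv wu wv.
Qed.

Lemma wDB i u v : H1 Om u -> H1 Om v ->
  {ae leb2, forall x, Om x -> wD Om i (fun x => u x - v x) x =
    wD Om i u x - wD Om i v x}.
Proof.
move=> Hu Hv; have [Lu wu] := wD_spec i Hu; have [Lv wv] := wD_spec i Hv.
apply: wD_eq; [exact: H1B|exact: L2B|].
exact: weak_pderB Hu.1 Hv.1 Lu Lv wu wv.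
Qed.

Lemma test_funM (phi psi : pt R -> R) : smooth phi -> test_fun Om psi ->
  test_fun Om (fun x => phi x * psi x).
Proof.
move=> sp [sq cS sS].
have sub : closure [set x | phi x * psi x != 0] `<=` closure [set x | psi x != 0].
  by apply: closure_subset => x /=; rewrite mulf_eq0 negb_or => /andP[].
split; [exact: smoothM| |exact: subset_trans sS].
by apply: subclosed_compact sub => //; exact: closed_closure.
Qed.

Lemma test_fun_zero (phi : pt R -> R) x : test_fun Om phi -> ~ Om x -> phi x = 0.
Proof.
move=> [_ _ sS] nx; apply/eqP; apply: contrapT => /negP p0; apply: nx; apply: sS.
exact: subset_closure.
Qed.

Lemma test_fun_pder_zero (phi : pt R -> R) i x : test_fun Om phi -> ~ Om x ->
  pder i phi x = 0.
Proof. by move=> tp; apply: test_fun_zero; exact: test_fun_pder. Qed.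

Lemma Rintegral_setT_zero (f : pt R -> R) : (forall x, ~ Om x -> f x = 0) ->
  \int[leb2]_(x in Om) f x = \int[leb2]_x f x.
Proof.
move=> f0; rewrite Rintegral_mkcond; congr Rintegral; apply/funext => x.
rewrite patchE; case: ifPn => // xO; rewrite f0//.
by move=> Ox; rewrite mem_set in xO.
Qed.

Lemma weak_pder_test (phi : pt R -> R) i : test_fun Om phi ->
  weak_pder Om i phi (pder i phi).
Proof.
move=> tp psi tq.
have [sp _ _] := tp; have [sq _ _] := tq.
have tpq : test_fun Om (fun x => phi x * psi x) by exact: test_funM.
have [_ I0] := integral_pder0 i tpq.
have E : pder i (fun x => phi x * psi x) =
    (fun x => phi x * pder i psi x + pder i phi x * psi x).
  apply/funext => x.
  have H := is_deriveM (smooth_is_derive i x sp) (smooth_is_derive i x sq).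
  rewrite {1}/pder (@derive_val _ _ _ _ _ _ _ H) /GRing.scale /=.
  by rewrite [psi x * _]mulrC.
have Lp := test_fun_L2 tp; have Lq := test_fun_L2 tq.
have Ldp := test_fun_L2 (test_fun_pder i tp).
have Ldq := test_fun_L2 (test_fun_pder i tq).
apply/eqP; rewrite -addr_eq0; apply/eqP.
rewrite -(@RintegralD _ _ _ leb2)//; [|exact: L2M|exact: L2M].
rewrite Rintegral_setT_zero; last first.
  by move=> x nx; rewrite (test_fun_zero tq nx) (test_fun_pder_zero i tq nx) !mulr0 addr0.
by rewrite /Rintegral; move: I0; rewrite E => ->.
Qed.

Lemma test_fun_H1 (phi : pt R -> R) : test_fun Om phi -> H1 Om phi.
Proof.
move=> tp; split; first exact: test_fun_L2.
move=> i; exists (pder i phi); last exact: weak_pder_test.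
by apply: test_fun_L2; exact: test_fun_pder.
Qed.

Lemma wD_test (phi : pt R -> R) i : test_fun Om phi ->
  {ae leb2, forall x, Om x -> wD Om i phi x = pder i phi x}.
Proof.
move=> tp; apply: wD_eq; [exact: test_fun_H1| |exact: weak_pder_test].
by apply: test_fun_L2; exact: test_fun_pder.
Qed.

Lemma test_fun_H10 (phi : pt R -> R) : test_fun Om phi -> H10 Om phi.
Proof.
move=> tp; split; first exact: test_fun_H1.
exists (fun=> phi); split => //; split.
  under eq_fun do under eq_integral do rewrite subrr expr0n /=.
  by rewrite integral0; exact: cvg_cst.
move=> i; rewrite (_ : (fun _ => _) = cst 0%E); first exact: cvg_cst.
apply/funext => n.
have [Lw _] := wD_spec i (test_fun_H1 tp).
have Ld := test_fun_L2 (test_fun_pder i tp).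
have LB := L2B mOm Ld Lw.
transitivity (\int[leb2]_(x in Om) (cst 0%E x : \bar R))%E; last exact: integral0.
apply: (@ae_eq_integral _ _ _ leb2) => //.
  by apply/measurable_EFinP; apply: measurable_funX; case: LB.
apply: leb2_ae_imp (wD_test i tp) => x H Ox.
by rewrite (H Ox) subrr expr0n.
Qed.

End weak_derivatives.

(** * Weak gradients of continuous piecewise affine functions *)

(** Stated for the right end of an interval; a change of signs gives the left end. *)
Lemma le_limit_left {R : realType} (F : R -> R) (a p : R) :
  continuous F -> a < p -> (forall t, a <= t -> t < p -> F t <= 0) -> F p <= 0.
Proof.
move=> cF ap H; rewrite leNgt; apply/negP => Fp.
have := cF p _ (lt_nbhsr Fp).
move=> /nbhs_ballP[e /= e0 sub].
pose t := Num.max a (p - e / 2).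
have at_ : a <= t by rewrite le_max lexx.
have tp : t < p by rewrite gt_max ap/= ltrBlDr ltrDl divr_gt0.
have pt : p - e / 2 <= t by rewrite le_max lexx orbT.
have : 0 < F t by apply: sub; rewrite /ball /= ltr_norml; apply/andP; split; lra.
by rewrite ltNge H.
Qed.

Lemma inf_mem_closed {R : realType} (B : set R) : closed B -> has_inf B ->
  B (inf B).
Proof.
move=> cB hB; suff : closure B (inf B) by rewrite -((closure_id B).1 cB).
move=> U /nbhs_ballP[e /= e0 sub].
have [t Bt te] := inf_adherent e0 hB.
exists t; split => //; apply: sub; rewrite /ball /= ltr_norml.
have := ge_inf hB.2 Bt; move=> h; apply/andP; split; lra.
Qed.

Lemma sup_mem_closed {R : realType} (B : set R) : closed B -> has_sup B ->
  B (sup B).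
Proof.
move=> cB [B0 uB]; suff : closure B (sup B) by rewrite -((closure_id B).1 cB).
exact: closure_sup.
Qed.

(** Induction on the cover: between the first and the last time in [S i] only the
end points matter, and the remaining two intervals are covered by the other
sets. *)
Lemma lipschitz_closed_cover {R : realType} {I : eqType} (s : seq I)
    (S : I -> set R) (g : R -> R) (L : R) :
  0 <= L -> continuous g ->
  (forall i, i \in s -> closed (S i) /\
     forall r t, S i r -> S i t -> `|g r - g t| <= L * `|r - t|) ->
  forall a b, a <= b ->
  (forall t, a <= t -> t <= b -> exists2 i, i \in s & S i t) ->
  `|g a - g b| <= L * (b - a).
Proof.
move=> L0 cg; elim: s => [|i s IH] HS a b ab cov.
  by have [] := cov a (lexx a) ab.
have [cA LA] := HS i (mem_head _ _).
have {}IH := IH (fun j js => HS j ltac:(by rewrite inE js orbT)).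
pose B := S i `&` `[a, b]%classic.
have [B0|B0] := eqVneq B set0.
  apply: IH => // t at_ tb; have [j + Ct] := cov t at_ tb; rewrite inE => /orP[/eqP ji|js]; last by exists j.
  rewrite ji in Ct.
  have : B t by split => //=; rewrite in_itv /= at_.
  by rewrite B0.
have hB : has_sup B /\ has_inf B.
  split; split; try exact/set0P; [exists b|exists a] => t [_ /=]; by rewrite in_itv => /andP[].
have cB : closed B by apply: closedI => //; exact: interval_closed.
have [Ap apb] : B (inf B) by exact: inf_mem_closed cB hB.2.
have [Aq aqb] : B (sup B) by exact: sup_mem_closed cB hB.1.
set p := inf B in Ap apb; set q := sup B in Aq aqb.
have pq : p <= q by apply: ge_inf; [exact: hB.2.2|split].
move: apb aqb; rewrite /= !in_itv /= => /andP[ap pb] /andP[aq qb].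
have H1 : `|g a - g p| <= L * (p - a).
  have [->|pa] := eqVneq a p; first by rewrite !subrr normr0 mulr0.
  have {}pa : a < p by rewrite lt_neqAle pa.
  rewrite -subr_le0.
  apply: (@le_limit_left R (fun t => `|g a - g t| - L * (t - a)) a p) => //.
    move=> t; apply: cvgB.
      by apply: cvg_norm; apply: cvgB; [exact: cvg_cst|exact: cg].
    by apply: cvgM; [exact: cvg_cst|apply: cvgB; [exact: cvg_id|exact: cvg_cst]].
  move=> t at_ tp; rewrite subr_le0; apply: IH => // r as_ st.
  have [j + Cs] := cov r as_ ltac:(lra); rewrite inE => /orP[/eqP ji|js]; last by exists j.
  rewrite ji in Cs; have : p <= r.
    apply: ge_inf; first exact: hB.2.2.
    by split => //=; rewrite in_itv /= as_/=; lra.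
  lra.
have H2 : `|g q - g b| <= L * (b - q).
  have [->|qb'] := eqVneq q b; first by rewrite !subrr normr0 mulr0.
  have {}qb' : q < b by rewrite lt_neqAle qb'.
  rewrite -subr_le0.
  have := @le_limit_left R (fun t => `|g (- t) - g b| - L * (b + t)) (- b) (- q).
  rewrite opprK; apply => //.
  - move=> t; apply: cvgB.
      apply: cvg_norm; apply: cvgB; last exact: cvg_cst.
      apply: (@continuous_comp _ _ _ -%R g); [exact: opp_continuous|exact: cg].
    by apply: cvgM; [exact: cvg_cst|apply: cvgD; [exact: cvg_cst|exact: cvg_id]].
  - by rewrite ltrN2.
  - move=> t bt tq; rewrite subr_le0 -[t in b + t]opprK; apply: IH; first lra.
    move=> r ts sb.
    have [j + Cs] := cov r ltac:(lra) sb; rewrite inE => /orP[/eqP ji|js]; last by exists j.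
    rewrite ji in Cs; have : r <= q.
      apply: ub_le_sup; first exact: hB.1.2.
      by split => //=; rewrite in_itv /= sb andbT; lra.
    lra.
have H3 := LA p q Ap Aq; rewrite (ler0_norm (_ : p - q <= 0)) in H3; last lra.
apply: le_trans (ler_distD (g p) _ _) _.
have := ler_distD (g q) (g p) (g b); lra.
Qed.

Lemma leb2_ae_all_seq {R : realType} {I : eqType} (s : seq I) (P : I -> pt R -> Prop) :
  (forall i, i \in s -> {ae leb2, forall x, P i x}) ->
  {ae leb2, forall x, forall i, i \in s -> P i x}.
Proof.
elim: s => [|a s IH] H; first by apply: leb2_aeT => x i; rewrite in_nil.
have h1 := H a (mem_head _ _).
have h2 := IH (fun v vs => H v ltac:(by rewrite inE vs orbT)).
apply: leb2_ae_imp (leb2_ae_and h1 h2) => x [x1 x2] i.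
by rewrite inE => /orP[/eqP ->|/x2].
Qed.

Lemma ae_off_line {R : realType} (n : pt R) (c : R) : n != 0 ->
  {ae leb2, forall x, dot n x <> c}.
Proof.
move=> n0; exists [set x | dot n x = c]; split.
- apply: closed_measurable2.
  apply: (@preimage_closed _ _ (dot n) [set t | t = c]); last exact: (@closed_eq _ c).
  by move=> x _; exact: dot_continuous.
- exact: line_null.
- by move=> x /= /contrapT.
Qed.

Lemma ae_in_elements {R : realType} (Om : set (pt R)) (T : mesh R) :
  conforming_mesh Om T ->
  {ae leb2, forall x, Om x -> exists2 K, K \in T & elt K x}.
Proof.
move=> mT; case: (mT) => _ rT _.
have : {ae leb2, forall x, forall K, K \in enum_fset T ->
    forall v, v \in enum_fset K -> lambda K v x <> 0}.
  apply: leb2_ae_all_seq => K KT; apply: leb2_ae_all_seq => v vK.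
  have tK := mesh_triangle mT KT.
  apply: leb2_ae_imp (ae_off_line (- (bary K).1 v) (glambda_neq0 tK vK)) => x nx l0.
  by apply: nx; move: l0; rewrite /lambda /glambda; lra.
apply: leb2_ae_imp => x H Ox.
have [K KT xK] : region T x by rewrite rT; exact: subset_closure.
exists K => //; have tK := mesh_triangle mT KT; apply/(eltP _ tK) => v vK.
rewrite lt_neqAle ((hullP _ tK).1 xK)// andbT eq_sym; apply/eqP.
exact: H KT _ vK.
Qed.

Lemma uniform_bound_seq {R : realType} {I : eqType} (s : seq I) (P : I -> R -> Prop) :
  (forall i L L', L <= L' -> P i L -> P i L') ->
  (forall i, i \in s -> exists L, P i L) ->
  exists2 L, 0 <= L & forall i, i \in s -> P i L.
Proof.
move=> mono; elim: s => [|a s IH] H; first by exists 0.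
have [L1 PL1] := H a (mem_head _ _).
have [L2 L20 PL2] := IH (fun v vs => H v ltac:(by rewrite inE vs orbT)).
exists (Num.max L1 L2); first by rewrite le_max L20 orbT.
move=> i; rewrite inE => /orP[/eqP ->|si].
  by apply: mono PL1; rewrite le_max lexx.
by apply: mono (PL2 i si); rewrite le_max lexx orbT.
Qed.

Section piecewise_affine.
Context (R : realType) (Om : set (pt R)) (T : mesh R).
Hypotheses (oOm : open Om) (bOm : bounded_set Om).
Hypothesis mT : conforming_mesh Om T.
Variables (u : pt R -> R) (a : cell R -> R) (be : cell R -> pt R).
Hypothesis uE : forall K x, K \in T -> hull K x -> u x = a K + dot (be K) x.
Hypothesis cu : {within closure Om, continuous u}.
Let mOm : measurable Om := open_measurable2 oOm.
Let finOm : (leb2 Om < +oo)%E := leb2_bounded_fin mOm bOm.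

Lemma piecewise_affine_continuous x : Om x -> {for x, continuous u}.
Proof.
move=> Ox.
have xcl : (closure Om)° x.
  by apply: (interiorS (@subset_closure _ Om)); rewrite ((interior_id Om).1 oOm).
have oi : open (closure Om)° by exact: open_interior.
have cui : {within (closure Om)°, continuous u}.
  exact: continuous_subspaceW (@interior_subset _ _) cu.
by move: cui; rewrite continuous_open_subspace// => /(_ x); apply; rewrite inE.
Qed.

Lemma piecewise_affine_measurable : measurable_fun Om u.
Proof.
apply: open_continuous_measurable2 => // x; rewrite inE => Ox.
exact: piecewise_affine_continuous.
Qed.

Lemma piecewise_affine_bounded : exists2 B, 0 <= B &
  forall K, K \in enum_fset T -> forall x, hull K x -> `|u x| <= B.
Proof.
apply: uniform_bound_seq => [K L L' LL' H x xK|K KT].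
  exact: le_trans (H x xK) LL'.
have [M HM] := hull_bounded K.
exists (`|a K| + (`|(be K).1| + `|(be K).2|) * M) => x xK.
rewrite (uE KT xK) (le_trans (ler_normD _ _))// lerD2l.
have [? ? ? ?] := HM _ xK.
rewrite (le_trans (ler_normD _ _))// mulrDl !normrM.
by apply: lerD; rewrite ler_wpM2l// ler_norml; apply/andP.
Qed.

Lemma region_cover x : Om x -> exists2 K, K \in T & hull K x.
Proof. by case: mT => _ rT _ Ox; apply: (_ : region T x); rewrite rT; exact: subset_closure. Qed.

Lemma piecewise_affine_L2 : L2 Om u.
Proof.
have [B B0 HB] := piecewise_affine_bounded.
apply: (L2_bounded mOm (B := B) finOm); first exact: piecewise_affine_measurable.
by move=> x /region_cover[K KT xK]; exact: HB KT _ xK.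
Qed.

Definition pw_pder (i : 'I_2) (x : pt R) : R :=
  \sum_(K <- T) \1_(elt K) x * dot (be K) (basis i).

Lemma pw_pder_elt i K x : K \in T -> elt K x ->
  pw_pder i x = dot (be K) (basis i).
Proof.
move=> KT xK; rewrite /pw_pder (big_rem K KT) /= indicE mem_set// mul1r.
rewrite big_seq big1 ?addr0// => K'; rewrite mem_rem_uniq ?fset_uniq// inE.
move=> /andP[KK' K'T]; rewrite indicE memNset ?mul0r// => xK'.
by move/eqP: KK'; apply; exact: (elt_disjoint mT K'T KT xK' xK).
Qed.

Lemma measurable_pw_pder i : measurable_fun setT (pw_pder i).
Proof.
apply: measurable_sum => K; apply: measurable_funM => //.
by apply: measurable_indic; apply: open_measurable2; exact: open_elt.
Qed.

Lemma pw_pder_L2 i : L2 Om (pw_pder i).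
Proof.
apply: (L2_bounded mOm (B := \sum_(K <- T) `|dot (be K) (basis i)|) finOm).
  by apply: measurable_funTS; exact: measurable_pw_pder.
move=> x _; rewrite (le_trans (ler_norm_sum _ _ _))//.
apply: ler_sum => K _; rewrite normrM ler_piMl// indicE ger0_norm//.
by case: (_ \in _).
Qed.

(** The product of [u] with a test function is Lipschitz along every line, since
a segment is covered by its finitely many closed intersections with the
triangles and with the zero set of the test function.  Its derivative is known
off the edges, so [integral_directional_derivative0] applies. *)
Lemma weak_pder_piecewise_affine i : weak_pder Om i u (pw_pder i).
Proof.
move=> phi tp; have [sp _ sS] := tp.
pose e : pt R := basis i.
pose psi x := u x * phi x.
pose g x := pw_pder i x * phi x + u x * pder i phi x.
have [Bu Bu0 HBu] := piecewise_affine_bounded.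
have [Bp HBp] := test_fun_bounded tp.
have [Lp HLp] := test_fun_lipschitz i tp.
have [M HM] := test_fun_supp_cbox tp.
have inOm x : phi x != 0 -> Om x.
  by move=> p0; apply: contrapT => nx; rewrite (test_fun_zero tp nx) eqxx in p0.
have cphi : continuous phi by exact: smooth_continuous.
have cpsi : continuous psi.
  move=> x; have [xS|xS] := pselect (closure [set x | phi x != 0] x).
    apply: cvgM; last exact: cphi.
    by apply: piecewise_affine_continuous; exact: sS.
  have nx : nbhs x (~` closure [set x | phi x != 0]).
    by apply: open_nbhs_nbhs; split => //; apply: closed_openC; exact: closed_closure.
  have zero y : ~ closure [set x | phi x != 0] y -> psi y = 0.
    move=> ny; rewrite /psi; have [->|p0] := eqVneq (phi y) 0; first by rewrite mulr0.
    by exfalso; apply: ny; exact: subset_closure.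
  rewrite /continuous_at (zero x xS); apply: cvg_near_cst.
  by apply: (@filterS _ (nbhs x) (nbhs_filter x) _ _ _ nx) => y /zero ->.
have Bp0 : 0 <= Bp by rewrite (le_trans _ (HBp 0)).
have psiB x : `|psi x| <= Bu * Bp.
  rewrite /psi; have [->|p0] := eqVneq (phi x) 0.
    by rewrite mulr0 normr0 mulr_ge0.
  have [K KT xK] := region_cover (inOm x p0).
  by rewrite normrM ler_pM// (HBu K).
have [L L0 HL] : exists2 L, 0 <= L & forall K, K \in enum_fset T ->
    forall y s, hull K y -> hull K (y + s *: e) ->
    `|psi (y + s *: e) - psi y| <= L * `|s|.
  apply: uniform_bound_seq => [K L L' LL' H y s yK ysK|K KT].
    by apply: le_trans (H y s yK ysK) _; rewrite ler_wpM2r.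
  exists (`|dot (be K) e| * Bp + Bu * Lp) => y s yK ysK.
  have -> : psi (y + s *: e) - psi y =
      (u (y + s *: e) - u y) * phi (y + s *: e) + u y * (phi (y + s *: e) - phi y).
    by rewrite /psi; ring.
  rewrite (le_trans (ler_normD _ _))// [leRHS]mulrDl; apply: lerD.
    rewrite (uE KT ysK) (uE KT yK) dotDr dotZr.
    have -> : a K + (dot (be K) y + s * dot (be K) e) - (a K + dot (be K) y) =
      s * dot (be K) e by ring.
    by rewrite !normrM [leRHS]mulrC -mulrA ler_wpM2l// ler_wpM2l.
  by rewrite normrM -mulrA; apply: ler_pM => //; exact: HBu KT _ yK.
have lipsi x t : `|psi (x + t *: e) - psi x| <= L * `|t|.
  have key y s : 0 <= s -> `|psi (y + s *: e) - psi y| <= L * `|s|.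
    move=> s0.
    pose G (r : R) := psi (y + r *: e).
    have cline : continuous (fun r : R => y + r *: e : pt R).
      move=> r; apply: cvgD; first exact: cvg_cst.
      by apply: cvgZr_tmp; exact: cvg_id.
    have cG : continuous G.
      move=> r; apply: (@continuous_comp _ _ _ (fun r : R => y + r *: e : pt R) psi).
        exact: cline.
      exact: cpsi.
    pose pre (A : set (pt R)) : set R := [set r | A (y + r *: e)].
    (* The index None stands for the zero set of phi, where psi vanishes. *)
    pose S (o : option (cell R)) := pre
      (if o is Some K then hull K else [set z | phi z = 0]).
    have cpre A : closed A -> closed (pre A).
      move=> cA; exact: (@preimage_closed _ _ (fun r : R => y + r *: e : pt R) A
        (fun r _ => cline r) cA).
    have := @lipschitz_closed_cover R _ (None :: map Some (enum_fset T)) S G L L0 cG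
      _ 0 s s0 _.
    rewrite /G scale0r addr0 subr0 distrC (ger0_norm s0); apply.
    - move=> o; rewrite inE => /orP[/eqP ->|/mapP[K KT ->]]; split.
      + apply: cpre; apply: (@preimage_closed _ _ phi [set t | t = 0]).
          by move=> z _; exact: cphi.
        exact: (@closed_eq _ 0).
      + move=> r r' /= zr zr'; rewrite /psi zr zr' !mulr0 subrr normr0.
        by rewrite mulr_ge0.
      + by apply: cpre; apply: closed_hull; exact: mesh_triangle mT KT.
      + move=> r r' rK r'K; have := HL K KT (y + r' *: e) (r - r') r'K.
        by rewrite -addrA -scalerDl [r' + _]addrC subrK; apply.
    - move=> r _ _; have [z|p0] := eqVneq (phi (y + r *: e)) 0.
        by exists None => //; rewrite inE eqxx.
      have [K KT rK] := region_cover (inOm _ p0).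
      by exists (Some K) => //; rewrite inE map_f ?orbT.
  have [t0|t0] := leP 0 t; first exact: key.
  have := key (x + t *: e) (- t); rewrite oppr_ge0 => /(_ (ltW t0)).
  by rewrite -addrA -scalerDl subrr scale0r addr0 distrC normrN.
have mpsi : measurable_fun setT psi by exact: continuous_measurable2.
have gE : g = (fun x => pw_pder i x * phi x + (u \_ Om) x * pder i phi x).
  apply/funext => x; rewrite /g patchE; case: ifPn => // xO.
  rewrite (test_fun_pder_zero i tp) ?mulr0// => Ox.
  by rewrite mem_set in xO.
have mg : measurable_fun setT g.
  rewrite gE; apply: measurable_funD; apply: measurable_funM.
  - exact: measurable_pw_pder.
  - exact: smooth_measurable.
  - apply: (measurable_restrictT u mOm).1; exact: piecewise_affine_measurable.
  - by apply: smooth_measurable; exact: smooth_pder.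
have der : {ae leb2, forall x, is_derive x e psi (g x)}.
  apply: leb2_ae_imp (ae_in_elements mT) => x Hx.
  have [xS|xS] := pselect (closure [set x | phi x != 0] x).
    have [K KT xK] := Hx (sS _ xS).
    have H := is_deriveM (is_deriveD (is_derive_cst (a K) x e)
      (is_derive_dot (be K) x e)) (smooth_is_derive i x sp).
    rewrite /g (pw_pder_elt i KT xK).
    apply: (@near_eq_is_derive _ _ _ ((cst (a K) + dot (be K)) * phi)).
      have nK : nbhs x (elt K) by apply: open_nbhs_nbhs; split => //; exact: open_elt.
      apply: (@filterS _ (nbhs x) (nbhs_filter x) _ _ _ nK) => y yK.
      by rewrite /psi (uE KT (elt_sub_hull yK)).
    apply: (is_derive_eq H).
    rewrite (uE KT (elt_sub_hull xK)) /GRing.scale /= add0r addrC.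
    by rewrite [phi x * _]mulrC.
  have zero : phi x = 0.
    by apply/eqP; apply: contrapT => /negP p0; apply: xS; exact: subset_closure.
  rewrite /g (pder_supp i xS) zero !mulr0 addr0.
  have d0 : is_derive x e (cst (0 : R)) 0 by exact: is_derive_cst.
  apply: near_eq_is_derive d0.
  have nx : nbhs x (~` closure [set x | phi x != 0]).
    by apply: open_nbhs_nbhs; split => //; apply: closed_openC; exact: closed_closure.
  apply: (@filterS _ (nbhs x) (nbhs_filter x) _ _ _ nx) => y ny.
  rewrite /psi; have [->|p0] := eqVneq (phi y) 0; first by rewrite mulr0.
  by exfalso; apply: ny; exact: subset_closure.
have supp x : psi x != 0 -> cbox (- M) M (- M) M x.
  by rewrite /psi mulf_eq0 negb_or => /andP[_ /HM].
have [_ I0] := integral_directional_derivative0 mpsi mg lipsi psiB supp der.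
have Lphi := test_fun_L2 oOm bOm tp.
have Ldphi := test_fun_L2 oOm bOm (test_fun_pder i tp).
apply/eqP; rewrite -addr_eq0 addrC; apply/eqP.
rewrite -(@RintegralD _ _ _ leb2)//; last 2 first.
  exact: L2M (pw_pder_L2 i) Lphi.
  exact: L2M piecewise_affine_L2 Ldphi.
rewrite Rintegral_setT_zero; first by rewrite /Rintegral I0.
by move=> x nx; rewrite (test_fun_zero tp nx) (test_fun_pder_zero i tp nx) !mulr0 addr0.
Qed.

Lemma piecewise_affine_H1 : H1 Om u.
Proof.
split; first exact: piecewise_affine_L2.
by move=> i; exists (pw_pder i); [exact: pw_pder_L2|exact: weak_pder_piecewise_affine].
Qed.

Lemma wD_piecewise_affine i :
  {ae leb2, forall x, Om x -> wD Om i u x = pw_pder i x}.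
Proof.
apply: wD_eq => //; [exact: piecewise_affine_H1|exact: pw_pder_L2|].
exact: weak_pder_piecewise_affine.
Qed.

End piecewise_affine.

(** * Stresses and square integrable matrix fields *)

Lemma sum_ord2 {V : nmodType} (f : 'I_2 -> V) : \sum_(i < 2) f i = f 0 + f 1.
Proof.
rewrite big_ord_recl big_ord1; congr (f _ + f _); exact: val_inj.
Qed.

Lemma frobE {R : realType} (A B : 'M[R]_2) :
  frob A B = A 0 0 * B 0 0 + A 0 1 * B 0 1 + (A 1 0 * B 1 0 + A 1 1 * B 1 1).
Proof. by rewrite /frob !sum_ord2. Qed.

Lemma mxtrace2 {R : realType} (A : 'M[R]_2) : \tr A = A 0 0 + A 1 1.
Proof. exact: sum_ord2. Qed.

Lemma ord2P (i : 'I_2) : i = 0 \/ i = 1.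
Proof. by case: i => [[|[|n]] Hi] //; [left|right]; exact: val_inj. Qed.

(** Unifies the two formulations: they differ by the coefficient of the product
of the divergences. *)
Lemma frob_stress {R : realType} (F : formulation) (mu : R) (G V : 'M[R]_2) (p : R) :
  frob (stress F mu G p) V =
  2 * mu * (frob (sym_part G) (sym_part V) -
    (if F is Herrmann then 0 else 2^-1) * (\tr G * \tr V)) - p * \tr V.
Proof.
by case: F; rewrite !frobE !mxtrace2 /stress /sym_part !mxE /=;
  rewrite ?mxtrace2 ?mulr1n ?mulr0n; field.
Qed.

Lemma stressB {R : realType} (F : formulation) (mu : R) (G G' : 'M[R]_2) (p p' : R) :
  stress F mu (G - G') (p - p') = stress F mu G p - stress F mu G' p'.
Proof.
apply/matrixP => i j; case: F; rewrite /stress /sym_part !mxE /= ?mxtrace2 ?mxE;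
  by case: (i == j); rewrite ?mulr1n ?mulr0n; ring.
Qed.

(** The weights of the energy norm appear here: the square of the stress is at
most a multiple of [mu] times the energy density. *)
Lemma frob_stress_le {R : realType} (F : formulation) (mu : R) (G : 'M[R]_2) (p : R) :
  0 < mu ->
  frob (stress F mu G p) (stress F mu G p) <=
  8 * mu * (2 * mu * frob G G + (2 * mu)^-1 * p ^+ 2).
Proof.
move=> mu0; set x := 2 * mu.
have x0 : 0 < x by rewrite mulr_gt0.
have -> : 8 * mu * (x * frob G G + x^-1 * p ^+ 2) = 4 * x ^+ 2 * frob G G + 4 * p ^+ 2.
  by rewrite /x; field; rewrite gt_eqF.
case: F; rewrite !frobE /stress /sym_part !mxE /= ?mxtrace2 -/x ?mulr1n ?mulr0n.
  set a := G 0 0; set b := G 0 1; set c := G 1 0; set e := G 1 1.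
  have := sqr_ge0 (x * a + p); have := sqr_ge0 (x * e + p).
  have := sqr_ge0 (x * b - x * c); have := sqr_ge0 (x * a); have := sqr_ge0 (x * e).
  have := sqr_ge0 (x * b); have := sqr_ge0 (x * c); have := sqr_ge0 p.
  nra.
set a := G 0 0; set b := G 0 1; set c := G 1 0; set e := G 1 1.
have := sqr_ge0 (x * a + x * e).
have := sqr_ge0 (x * b - x * c); have := sqr_ge0 (x * a); have := sqr_ge0 (x * e).
have := sqr_ge0 (x * b); have := sqr_ge0 (x * c); have := sqr_ge0 p.
nra.
Qed.

Lemma mul_young {R : realType} (a b t : R) : 0 < t ->
  `|a * b| <= t * (a * a) + b * b / (4 * t).
Proof.
move=> t0.
have -> : t * (a * a) + b * b / (4 * t) = ((2 * t * a) ^+ 2 + b ^+ 2) / (4 * t).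
  by field; rewrite gt_eqF.
rewrite ler_pdivlMr ?mulr_gt0//.
rewrite -[X in _ * X]gtr0_norm ?mulr_gt0// -normrM ler_norml.
have := sqr_ge0 (2 * t * a + b); have := sqr_ge0 (2 * t * a - b).
by rewrite sqrrB sqrrD => h1 h2; apply/andP; split; lra.
Qed.

Lemma frob_young {R : realType} (A B : 'M[R]_2) (t : R) : 0 < t ->
  `|frob A B| <= t * frob A A + frob B B / (4 * t).
Proof.
move=> t0.
rewrite !frobE; rewrite (le_trans (ler_normD _ _))//.
apply: le_trans (lerD (ler_normD _ _) (ler_normD _ _)) _.
have := mul_young (A 0 0) (B 0 0) t0; have := mul_young (A 0 1) (B 0 1) t0.
have := mul_young (A 1 0) (B 1 0) t0; have := mul_young (A 1 1) (B 1 1) t0; rewrite !mulrDl; lra.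
Qed.

Lemma dot_young {R : realType} (a b : pt R) (t : R) : 0 < t ->
  `|dot a b| <= t * dot a a + dot b b / (4 * t).
Proof.
move=> t0.
rewrite /dot; rewrite (le_trans (ler_normD _ _))//.
have := mul_young a.1 b.1 t0; have := mul_young a.2 b.2 t0; rewrite !mulrDl; lra.
Qed.

Lemma frob_ge0 {R : realType} (A : 'M[R]_2) : 0 <= frob A A.
Proof. by rewrite frobE -!expr2 !addr_ge0// sqr_ge0. Qed.

(** The gradient of the vector field [x |-> phi x *: c]. *)
Definition tens {R : realType} (c : pt R) (phi : pt R -> R) (x : pt R) : 'M[R]_2 :=
  \matrix_(i, j) (crd i c * pder j phi x).

Definition L2m {R : realType} (Om : set (pt R)) (M : pt R -> 'M[R]_2) :=
  forall i j, L2 Om (fun x => M x i j).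

Section L2_matrices.
Context (R : realType) (Om : set (pt R)).
Hypotheses (oOm : open Om) (bOm : bounded_set Om).
Let mOm : measurable Om := open_measurable2 oOm.
Implicit Types A B : pt R -> 'M[R]_2.

Lemma integrableD2 (g h : pt R -> R) : leb2.-integrable Om (EFin \o g) ->
  leb2.-integrable Om (EFin \o h) ->
  leb2.-integrable Om (EFin \o (fun x => g x + h x)).
Proof. by move=> ig ih; exact: (@integrableD _ _ _ leb2 _ mOm _ _ ig ih). Qed.

Lemma integrableZ2 (c : R) (g : pt R -> R) : leb2.-integrable Om (EFin \o g) ->
  leb2.-integrable Om (EFin \o (fun x => c * g x)).
Proof. by move=> ig; exact: (@integrableZl _ _ _ leb2 _ mOm c _ ig). Qed.

Lemma frob_integrable A B : L2m Om A -> L2m Om B ->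
  leb2.-integrable Om (EFin \o (fun x => frob (A x) (B x))).
Proof.
move=> LA LB.
under eq_fun do rewrite frobE.
by do !apply: integrableD2; exact: L2M.
Qed.

Lemma L2_mxtrace A : L2m Om A -> L2 Om (fun x => \tr (A x)).
Proof. by move=> LA; under eq_fun do rewrite mxtrace2; exact: L2D. Qed.

Lemma L2m_sym A : L2m Om A -> L2m Om (fun x => sym_part (A x)).
Proof.
move=> LA i j; rewrite (_ : (fun x => _) = (fun x => 2^-1 * (A x i j + A x j i))).
  by apply: L2Z => //; exact: L2D.
by apply/funext => x; rewrite /sym_part !mxE.
Qed.

Lemma L2m_stress F mu A (p : pt R -> R) : L2m Om A -> L2 Om p ->
  L2m Om (fun x => stress F mu (A x) (p x)).
Proof.
move=> LA Lp i j.
pose k : R := if F is Herrmann then 0 else 2^-1.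
rewrite (_ : (fun x => _) = (fun x => 2 * mu * sym_part (A x) i j +
   ((- (2 * mu * k) * (i == j)%:R) * \tr (A x) + (- (i == j)%:R) * p x))).
  apply: L2D => //; first by apply: L2Z => //; exact: L2m_sym.
  by apply: L2D => //; apply: L2Z => //; exact: L2_mxtrace.
apply/funext => x; rewrite /k => {k}; case: F; rewrite /stress !mxE /=;
  by case: (i == j); rewrite ?mulr1n ?mulr0n; ring.
Qed.

Lemma L2m_tens c phi : test_fun Om phi -> L2m Om (tens c phi).
Proof.
move=> tp i j; under eq_fun do rewrite mxE.
by apply: L2Z => //; apply: test_fun_L2 => //; exact: test_fun_pder.
Qed.

Lemma L2_dot (g h : pt R -> pt R) : (forall i, L2 Om (component i g)) ->
  (forall i, L2 Om (component i h)) ->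
  leb2.-integrable Om (EFin \o (fun x => dot (g x) (h x))).
Proof.
move=> Lg Lh; apply: integrableD2.
  exact: (L2M mOm (Lg 0) (Lh 0)).
exact: (L2M mOm (Lg 1) (Lh 1)).
Qed.

End L2_matrices.

(** * The momentum balance in terms of the stress *)

Lemma crd_scale {R : realType} (i : 'I_2) (a : R) (x : pt R) :
  crd i (a *: x) = a * crd i x.
Proof. by rewrite /crd; case: ifP. Qed.

Section weak_identity.
Context (R : realType) (Om : set (pt R)).
Hypotheses (oOm : open Om) (bOm : bounded_set Om).
Let mOm : measurable Om := open_measurable2 oOm.

Lemma test_fun_component (c : pt R) phi i : test_fun Om phi ->
  test_fun Om (component i (fun x => phi x *: c)).
Proof.
move=> tp; have := test_funM (smooth_cst (crd i c)) tp.
by congr test_fun; apply/funext => x; rewrite /component crd_scale mulrC.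
Qed.

Lemma pder_component (c : pt R) phi i j x : test_fun Om phi ->
  pder j (component i (fun x => phi x *: c)) x = crd i c * pder j phi x.
Proof.
move=> [sp _ _].
have H := is_deriveM (is_derive_cst (crd i c) x (basis j)) (smooth_is_derive j x sp).
have -> : component i (fun x => phi x *: c) = cst (crd i c) * phi.
  by apply/funext => y; rewrite /component crd_scale mulrC mulrfctE.
by rewrite /pder (@derive_val _ _ _ _ _ _ _ H) /GRing.scale /= mulr0 addr0.
Qed.

Lemma ae_matrix (P : 'I_2 -> 'I_2 -> pt R -> Prop) :
  (forall i j, {ae leb2, forall x, P i j x}) ->
  {ae leb2, forall x, forall i j, P i j x}.
Proof.
move=> H.
apply: leb2_ae_imp (leb2_ae_and (leb2_ae_and (H 0 0) (H 0 1))
  (leb2_ae_and (H 1 0) (H 1 1))) => x [[? ?] [? ?]] i j.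
by case: (ord2P i) => ->; case: (ord2P j) => ->.
Qed.

Lemma wgrad_test (c : pt R) phi : test_fun Om phi ->
  {ae leb2, forall x, Om x -> wgrad Om (fun x => phi x *: c) x = tens c phi x}.
Proof.
move=> tp.
have H := @ae_matrix (fun i j x => Om x ->
  wD Om j (component i (fun x => phi x *: c)) x = crd i c * pder j phi x).
apply: leb2_ae_imp (H _) => [x E Ox|i j].
  by apply/matrixP => i j; rewrite !mxE E.
apply: leb2_ae_imp (wD_test oOm bOm j (test_fun_component c i tp)) => x E Ox.
by rewrite (E Ox) pder_component.
Qed.

Lemma H10v_test (c : pt R) phi : test_fun Om phi -> H10v Om (fun x => phi x *: c).
Proof. by move=> tp i; apply: test_fun_H10 => //; exact: test_fun_component. Qed.

Lemma L2m_wgrad (u : pt R -> pt R) : (forall i, H1 Om (component i u)) ->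
  L2m Om (wgrad Om u).
Proof.
move=> Hu i j; under eq_fun do rewrite mxE.
by have [] := wD_spec j (Hu i).
Qed.

Lemma H10v_H1 v : H10v Om v -> forall i, H1 Om (component i v).
Proof. by move=> Hv i; case: (Hv i). Qed.

Lemma Rint_ae_eq (g h : pt R -> R) : leb2.-integrable Om (EFin \o g) ->
  leb2.-integrable Om (EFin \o h) ->
  {ae leb2, forall x, Om x -> g x = h x} ->
  \int[leb2]_(x in Om) g x = \int[leb2]_(x in Om) h x.
Proof.
move=> ig ih; apply: (@Rintegral_ae_eq _ _ _ leb2 _ mOm).
  by apply/measurable_EFinP; exact: (measurable_int _ ig).
by apply/measurable_EFinP; exact: (measurable_int _ ih).
Qed.

Lemma RintD (g h : pt R -> R) : leb2.-integrable Om (EFin \o g) ->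
  leb2.-integrable Om (EFin \o h) ->
  \int[leb2]_(x in Om) (g x + h x) =
  \int[leb2]_(x in Om) g x + \int[leb2]_(x in Om) h x.
Proof. exact: (@RintegralD _ _ _ leb2 _ _ _ mOm). Qed.

Lemma RintZ (c : R) (g : pt R -> R) : leb2.-integrable Om (EFin \o g) ->
  \int[leb2]_(x in Om) (c * g x) = c * \int[leb2]_(x in Om) g x.
Proof. exact: (@RintegralZl _ _ _ leb2 _ _ c mOm). Qed.

(** The bilinear forms are the virtual work of the stress. *)
Lemma forms_stress (F : formulation) (mu : R) (u v : pt R -> pt R) (p : pt R -> R) :
  (forall i, H1 Om (component i u)) -> (forall i, H1 Om (component i v)) ->
  L2 Om p ->
  a_form F mu Om u v + b_form Om v p =
  \int[leb2]_(x in Om) frob (stress F mu (wgrad Om u x) (p x)) (wgrad Om v x).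
Proof.
move=> Hu Hv Lp; have Lu := L2m_wgrad Hu; have Lv := L2m_wgrad Hv.
pose k : R := if F is Herrmann then 0 else 2^-1.
have i1 := frob_integrable oOm (L2m_sym oOm Lu) (L2m_sym oOm Lv).
have i2 := L2M mOm (L2_mxtrace oOm Lu) (L2_mxtrace oOm Lv).
have i3 := L2M mOm Lp (L2_mxtrace oOm Lv).
under [RHS]eq_Rintegral do rewrite frob_stress -/k.
transitivity (\int[leb2]_(x in Om) ((2 * mu) * frob (weps Om u x) (weps Om v x) +
    ((- (2 * mu * k)) * (wdiv Om u x * wdiv Om v x) + (-1) * (p x * wdiv Om v x)))).
  rewrite RintD; [|exact: integrableZ2|by apply: integrableD2 => //; exact: integrableZ2].
  rewrite RintD; [|exact: integrableZ2|exact: integrableZ2].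
  rewrite !RintZ// /a_form /b_form /k; case: F {k}; ring.
by apply: eq_Rintegral => x _; rewrite /weps /wdiv; ring.
Qed.

Lemma weak_identity F mu lam f g u p c phi :
  (forall i, L2 Om (component i f)) ->
  weak_solution F mu lam Om f g u p -> test_fun Om phi ->
  \int[leb2]_(x in Om) frob (stress F mu (wgrad Om u x) (p x)) (tens c phi x) =
  \int[leb2]_(x in Om) (dot (f x) c * phi x).
Proof.
move=> Lf [Hu Lp weak _] tp.
have Hu1 i : H1 Om (component i u) by case: (Hu i).
have := weak _ (H10v_test c tp).
rewrite forms_stress//; last exact: H10v_H1 (H10v_test c tp).
rewrite /load => E.
have -> : \int[leb2]_(x in Om) (dot (f x) c * phi x) =
    \int[leb2]_(x in Om) dot (f x) (phi x *: c).
  by apply: eq_Rintegral => x _; rewrite dotZr mulrC.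
rewrite -E; apply: Rint_ae_eq.
- apply: frob_integrable => //; last exact: L2m_tens.
  by apply: L2m_stress => //; exact: L2m_wgrad.
- apply: frob_integrable => //.
    by apply: L2m_stress => //; exact: L2m_wgrad.
  by apply: L2m_wgrad; exact: H10v_H1 (H10v_test c tp).
- by apply: leb2_ae_imp (wgrad_test c tp) => x H Ox; rewrite (H Ox).
Qed.

End weak_identity.

(** * Integrals against radial bumps *)

Section local_integrals.
Context (R : realType).
Implicit Types (A B D : set (pt R)) (g h : pt R -> R).

Lemma Rint_restrict A B g : A `<=` B -> (forall x, ~ A x -> g x = 0) ->
  \int[leb2]_(x in B) g x = \int[leb2]_(x in A) g x.
Proof.
move=> AB g0; rewrite Rintegral_mkcond [RHS]Rintegral_mkcond.
congr Rintegral; apply/funext => x; rewrite !patchE.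
case: ifPn => xB; case: ifPn => xA //.
- by rewrite g0// => /mem_set; apply/negP.
- by move/negP: xB; case; apply/mem_set/AB/set_mem.
Qed.

Lemma Rint_subset A B g : measurable A -> measurable B -> A `<=` B ->
  leb2.-integrable B (EFin \o g) -> (forall x, B x -> 0 <= g x) ->
  \int[leb2]_(x in A) g x <= \int[leb2]_(x in B) g x.
Proof.
move=> mA mB AB ig g0; rewrite /Rintegral fine_le//.
- by apply: (@integrable_fin_num _ _ _ leb2) => //; exact: (@integrableS _ _ _ leb2 B).
- exact: (@integrable_fin_num _ _ _ leb2).
- apply: (@ge0_subset_integral _ _ _ leb2) => //.
  exact: (measurable_int _ ig).
Qed.

Lemma leb2_square (a b e : R) : 0 <= e ->
  leb2 (cbox (a - e) (a + e) (b - e) (b + e)) = (4 * e ^+ 2)%:E.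
Proof. by move=> e0; rewrite leb2_cbox; [congr EFin; ring|lra|lra]. Qed.

Lemma integrable_cst_fin B (a c : R) : measurable B -> leb2 B = a%:E ->
  leb2.-integrable B (EFin \o fun=> c) /\ \int[leb2]_(x in B) c = c * a.
Proof.
move=> mB E; split.
  apply/integrableP; split; first exact/measurable_EFinP/measurable_cst.
  rewrite (eq_integral (cst (`|c|%:E)))// (@integral_cst _ _ _ leb2)//.
  by rewrite [X in (_ * X < _)%E]E -EFinM ltry.
rewrite (@Rintegral_cst _ _ _ leb2)//; congr (_ * _).
by rewrite [X in fine X]E.
Qed.

Lemma measurable_disc (m : pt R) r : measurable (disc m r).
Proof. by apply: closed_measurable2; exact: closed_disc. Qed.

Lemma leb2_disc_le (m : pt R) r : 0 <= r ->
  (leb2 (disc m r) < +oo)%E /\ fine (leb2 (disc m r)) <= 4 * r ^+ 2.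
Proof.
move=> r0.
have le : (leb2 (disc m r) <= (4 * r ^+ 2)%:E)%E.
  have -> : (4 * r ^+ 2)%:E =
      leb2 (cbox (m.1 - r) (m.1 + r) (m.2 - r) (m.2 + r)).
    by rewrite leb2_cbox; [congr EFin; ring|lra|lra].
  apply: (@le_measure _ _ _ leb2) => //; rewrite ?inE.
  - exact: measurable_disc.
  - exact: measurable_cbox.
  - exact: disc_sub_cbox.
have fin : (leb2 (disc m r) < +oo)%E by apply: le_lt_trans le (ltry _).
split => //; rewrite -lee_fin fineK//.
by rewrite ge0_fin_numE//; exact: (measure_ge0 leb2).
Qed.

Lemma integrable_cst_disc (m : pt R) r (c : R) : 0 <= r ->
  leb2.-integrable (disc m r) (EFin \o fun=> c).
Proof.
move=> r0; have [fin _] := leb2_disc_le m r0.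
apply/integrableP; split; first exact/measurable_EFinP/measurable_cst.
rewrite (eq_integral (cst (`|c|%:E)))//.
rewrite (@integral_cst _ _ _ leb2)//; last exact: measurable_disc.
by rewrite lte_mul_pinfty// lee_fin.
Qed.

Lemma Rint_le_disc (m : pt R) r g (C : R) : 0 <= r -> 0 <= C ->
  leb2.-integrable (disc m r) (EFin \o g) ->
  \int[leb2]_(x in disc m r) (g x + C) <=
  \int[leb2]_(x in disc m r) g x + C * (4 * r ^+ 2).
Proof.
move=> r0 C0 ig; have [fin le] := leb2_disc_le m r0.
rewrite (@RintegralD _ _ _ leb2)//; last 2 first.
  exact: measurable_disc.
  exact: integrable_cst_disc.
rewrite lerD2l (@Rintegral_cst _ _ _ leb2); last exact: measurable_disc.
by rewrite ler_wpM2l.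
Qed.

Lemma rbump_grad_off (m : pt R) r x v : 0 < r -> ~ disc m r x ->
  - (2 / r ^+ 2) * dot (x - m) v * rbump' m r x = 0.
Proof.
move=> r0 nd; rewrite (rbump_support r0 _).2 ?mulr0//.
by apply: ltW; rewrite ltNge; apply/negP.
Qed.

Lemma rbump_grad_bound (m : pt R) r x v : 0 < r ->
  `|- (2 / r ^+ 2) * dot (x - m) v * rbump' m r x| <= 4 / r * enorm v.
Proof.
move=> r0; have [xd|xd] := pselect (disc m r x); last first.
  by rewrite rbump_grad_off// normr0 mulr_ge0 ?enorm_ge0// divr_ge0// ltW.
have /andP[b0 b2] := rbump'_bounds m r x.
have xm : enorm (x - m) <= r by apply/discE => //; exact: ltW.
have q0 : 0 <= 2 / r ^+ 2 by rewrite divr_ge0// exprn_ge0// ltW.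
rewrite !normrM normrN (ger0_norm b0) (ger0_norm q0).
have h1 : `|dot (x - m) v| <= r * enorm v.
  by apply: le_trans (cauchy_schwarz _ _) _; rewrite ler_wpM2r ?enorm_ge0.
have -> : 4 / r * enorm v = 2 / r ^+ 2 * (r * enorm v) * 2 by field; rewrite gt_eqF.
by apply: ler_pM => //; [rewrite mulr_ge0|rewrite ler_wpM2l].
Qed.

Lemma enorm_basis (i : 'I_2) : enorm (basis i : pt R) = 1.
Proof.
by rewrite /enorm /dot /Defs.basis; case: ifP => _ /=;
  rewrite !mulr0 mulr1 ?addr0 ?add0r sqrtr1.
Qed.

Lemma pder_rbump_bound (m : pt R) r j x : 0 < r ->
  `|pder j (rbump m r) x| <= 4 / r.
Proof.
by move=> r0; rewrite pder_rbump; have := rbump_grad_bound m x (basis j) r0;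
  rewrite enorm_basis mulr1.
Qed.

Lemma frob_tens_bound (m c : pt R) r x : 0 < r ->
  frob (tens c (rbump m r) x) (tens c (rbump m r) x) <= 32 * dot c c / r ^+ 2.
Proof.
move=> r0.
have B j : pder j (rbump m r) x ^+ 2 <= 16 / r ^+ 2.
  have -> : 16 / r ^+ 2 = (4 / r) ^+ 2 by rewrite expr_div_n; congr (_ / _); ring.
  rewrite -[leLHS]real_normK ?num_real// lerXn2r ?nnegrE//.
    by rewrite divr_ge0// ltW.
  exact: pder_rbump_bound.
have -> : frob (tens c (rbump m r) x) (tens c (rbump m r) x) =
    dot c c * (pder 0 (rbump m r) x ^+ 2 + pder 1 (rbump m r) x ^+ 2).
  rewrite frobE /tens !mxE /crd /= /dot.
  by move: (pder 0 _ x) (pder 1 _ x) => a b; ring.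
have -> : 32 * dot c c / r ^+ 2 = dot c c * (16 / r ^+ 2 + 16 / r ^+ 2) by ring.
by rewrite ler_wpM2l ?dot_ge0// lerD.
Qed.

Lemma frob_tens_off (m c : pt R) r x (S : 'M[R]_2) : 0 < r -> ~ disc m r x ->
  frob S (tens c (rbump m r) x) = 0.
Proof.
move=> r0 nd; rewrite frobE /tens !mxE !pder_rbump !rbump_grad_off//.
by rewrite !mulr0 !addr0.
Qed.

Section on_domain.
Variable Om : set (pt R).
Hypotheses (oOm : open Om) (bOm : bounded_set Om).
Let mOm : measurable Om := open_measurable2 oOm.
Variables (m : pt R) (r : R).
Hypotheses (r0 : 0 < r) (dOm : disc m r `<=` Om).

Let idisc g : leb2.-integrable Om (EFin \o g) ->
  leb2.-integrable (disc m r) (EFin \o g).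
Proof.
move=> ig; apply: (@integrableS _ _ _ leb2 Om) => //; exact: measurable_disc.
Qed.

(** The integrand lives on a disc of area at most [4 r ^ 2], which accounts for
the contribution of the constant [C]. *)
Lemma local_bound g h (C : R) : 0 <= C ->
  leb2.-integrable Om (EFin \o g) -> leb2.-integrable Om (EFin \o h) ->
  (forall x, ~ disc m r x -> g x = 0) ->
  (forall x, disc m r x -> `|g x| <= h x + C) ->
  `|\int[leb2]_(x in Om) g x| <= \int[leb2]_(x in disc m r) h x + C * (4 * r ^+ 2).
Proof.
move=> C0 ig ih g0 gh; rewrite (Rint_restrict dOm g0).
have md := measurable_disc m r.
apply: le_trans (@le_normr_Rintegral _ _ _ leb2 _ _ md (idisc ig)) _.
apply: le_trans (Rint_le_disc (ltW r0) C0 (idisc ih)).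
apply: (@le_Rintegral _ _ _ leb2) => //.
- exact: (@integrable_norm _ _ _ leb2 _ _ (idisc ig)).
- exact: (@integrableD _ _ _ leb2 _ md _ _ (idisc ih) (integrable_cst_disc m C (ltW r0))).
Qed.

(** Young's inequality with a free parameter; the gradient of the bump is at most
[4 / r], and the disc has area of order [r ^ 2], so that the factor of [dot c c]
does not depend on [r]. *)
Lemma stress_bound (S : pt R -> 'M[R]_2) (c : pt R) (t : R) : 0 < t ->
  L2m Om S ->
  `|\int[leb2]_(x in Om) frob (S x) (tens c (rbump m r) x)| <=
  t * \int[leb2]_(x in disc m r) frob (S x) (S x) + 32 * dot c c / t.
Proof.
move=> t0 LS; have tp := test_fun_rbump r0 dOm.
have iSS := frob_integrable oOm LS LS.
have C0 : 0 <= 8 * dot c c / (t * r ^+ 2).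
  by rewrite divr_ge0 ?mulr_ge0 ?dot_ge0// ?exprn_ge0 ltW.
have := @local_bound (fun x => frob (S x) (tens c (rbump m r) x))
  (fun x => t * frob (S x) (S x)) _ C0 (frob_integrable oOm LS (L2m_tens oOm bOm c tp))
  (integrableZ2 oOm t iSS).
rewrite (@RintegralZl _ _ _ leb2 _ _ t (measurable_disc m r) (idisc iSS)).
have -> : 8 * dot c c / (t * r ^+ 2) * (4 * r ^+ 2) = 32 * dot c c / t.
  by field; rewrite !gt_eqF.
apply=> [x nd|x _]; first exact: frob_tens_off.
apply: le_trans (frob_young _ _ t0) _; rewrite lerD2l.
have -> : 8 * dot c c / (t * r ^+ 2) = 32 * dot c c / r ^+ 2 / (4 * t).
  by field; rewrite !gt_eqF.
rewrite ler_wpM2r ?invr_ge0 ?mulr_ge0 ?(ltW t0)//.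
exact: frob_tens_bound.
Qed.

Lemma load_bound (f : pt R -> pt R) (c : pt R) (t : R) : 0 < t ->
  (forall i, L2 Om (component i f)) ->
  `|\int[leb2]_(x in Om) (dot (f x) c * rbump m r x)| <=
  t * \int[leb2]_(x in disc m r) dot (f x) (f x) + r ^+ 2 * dot c c / t.
Proof.
move=> t0 Lf; have tp := test_fun_rbump r0 dOm.
have isqdiff := L2_dot oOm Lf Lf.
have C0 : 0 <= dot c c / (4 * t) by rewrite divr_ge0 ?dot_ge0 ?mulr_ge0// ltW.
have Ldot : L2 Om (fun x => dot (f x) c).
  rewrite /dot; have := L2D mOm (L2Z mOm c.1 (Lf 0)) (L2Z mOm c.2 (Lf 1)).
  by congr L2; apply/funext => x; rewrite /component /crd /=; ring.
have := @local_bound (fun x => dot (f x) c * rbump m r x)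
  (fun x => t * dot (f x) (f x)) _ C0 (L2M mOm Ldot (test_fun_L2 oOm bOm tp))
  (integrableZ2 oOm t isqdiff).
rewrite (@RintegralZl _ _ _ leb2 _ _ t (measurable_disc m r) (idisc isqdiff)).
have -> : dot c c / (4 * t) * (4 * r ^+ 2) = r ^+ 2 * dot c c / t.
  by field; rewrite gt_eqF.
apply=> [x nd|x _].
  rewrite (rbump_support r0 _).1 ?mulr0//.
  by apply: ltW; rewrite ltNge; apply/negP.
apply: le_trans (dot_young _ _ t0).
rewrite normrM ler_piMr// ger0_norm ?rbump_ge0//; exact: rbump_le1.
Qed.

Lemma integral_rbump_lower :
  expR (-4) * r ^+ 2 <= \int[leb2]_(x in Om) rbump m r x.
Proof.
pose B := cbox (m.1 - r / 2) (m.1 + r / 2) (m.2 - r / 2) (m.2 + r / 2).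
have mB : measurable B by exact: measurable_cbox.
have Bd x : B x -> dot (x - m) (x - m) <= 3 / 4 * r ^+ 2.
  move=> [? ? ? ?]; rewrite /dot /= -!expr2.
  have S (s : R) : - (r / 2) <= s -> s <= r / 2 -> s ^+ 2 <= (r / 2) ^+ 2.
    move=> s1 s2; rewrite -[leLHS]real_normK ?num_real//.
    by rewrite lerXn2r ?nnegrE ?ler_norml ?s1// divr_ge0// ltW.
  have := S (x.1 - m.1) ltac:(lra) ltac:(lra).
  have := S (x.2 - m.2) ltac:(lra) ltac:(lra).
  have : 0 <= r ^+ 2 by exact: sqr_ge0.
  rewrite expr_div_n; lra.
have BO : B `<=` Om.
  move=> x Bx; apply: dOm; rewrite /disc /=; apply: le_trans (Bd x Bx) _.
  have : 0 <= r ^+ 2 by exact: sqr_ge0.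
  lra.
have tp := test_fun_rbump r0 dOm.
have ip := L2_integrable oOm bOm (test_fun_L2 oOm bOm tp).
apply: le_trans (Rint_subset mB mOm BO ip (fun x _ => rbump_ge0 m r x)).
have E : leb2 B = (r ^+ 2)%:E.
  by rewrite /B leb2_square ?divr_ge0 ?ltW//; congr EFin; field.
have [ic <-] := integrable_cst_fin (expR (-4)) mB E.
apply: (@le_Rintegral _ _ _ leb2) => //.
  exact: (@integrableS _ _ _ leb2 Om).
by move=> x Bx; have [] := rbump_lower r0 (Bd x Bx).
Qed.

End on_domain.
End local_integrals.

(** * Green formula on a half disc *)

Definition half_plane {R : realType} (n m : pt R) : set (pt R) :=
  [set x | 0 < dot n (x - m)].

Lemma measurable_half_plane {R : realType} (n m : pt R) : measurable (half_plane n m).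
Proof.
rewrite /half_plane; have -> : [set x | 0 < dot n (x - m)] = [set x | dot n m < dot n x].
  by apply/seteqP; split => x /=; rewrite dotBr subr_gt0.
apply: open_measurable2; apply: (@open_comp _ _ (dot n) [set t | dot n m < t]).
  by move=> x _; exact: dot_continuous.
exact: open_gt.
Qed.

Lemma sqr_dotD {R : realType} (y n : pt R) (a : R) :
  dot (y + a *: n) (y + a *: n) = dot y y + 2 * a * dot y n + a ^+ 2 * dot n n.
Proof. by rewrite /dot !pt_add1 !pt_add2 !pt_scale1 !pt_scale2; ring. Qed.

Section half_disc_flux.
Context (R : realType) (Om : set (pt R)).
Hypotheses (oOm : open Om) (bOm : bounded_set Om).
Let mOm : measurable Om := open_measurable2 oOm.
Variables (n m : pt R) (r : R).
Hypotheses (n1 : dot n n = 1) (r0 : 0 < r) (dOm : disc m r `<=` Om).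
Let tp : test_fun Om (rbump m r) := test_fun_rbump r0 dOm.
Let chi : pt R -> R := \1_(half_plane n m).

Let dir (v x : pt R) := v.1 * pder 0 (rbump m r) x + v.2 * pder 1 (rbump m r) x.

Let dirE v x : dir v x = - (2 / r ^+ 2) * dot (x - m) v * rbump' m r x.
Proof. by rewrite /dir !pder_rbump /dot /=; ring. Qed.

Let is_derive_dir v x : is_derive x v (rbump m r) (dir v x).
Proof. by rewrite dirE; exact: is_derive_rbump. Qed.

Let measurable_chi : measurable_fun setT chi.
Proof. by apply: measurable_indic; exact: measurable_half_plane. Qed.

Let chi01 x : chi x = 0 \/ chi x = 1.
Proof. by rewrite /chi indicE; case: (x \in _); [right|left]. Qed.

Let L2_chi : L2 Om chi.
Proof.
apply: (@L2_bounded _ _ mOm _ 1).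
- exact: leb2_bounded_fin.
- exact: measurable_funTS.
- by move=> x _; case: (chi01 x) => ->; rewrite ?normr0 ?normr1 ?ler01.
Qed.

Let integrable_chi_dir v : leb2.-integrable Om (EFin \o (fun x => chi x * dir v x)).
Proof.
apply: (L2M mOm L2_chi); apply: L2D => //; apply: L2Z => //;
  apply: test_fun_L2 => //; exact: test_fun_pder.
Qed.

(** The half plane is invariant under translations along its edge, so that its
    indicator passes through the tangential derivative. *)
Let tangential_flux : \int[leb2]_(x in Om) (chi x * dir (perp n) x) = 0.
Proof.
have chi_shift x t : chi (x + t *: perp n) = chi x.
  rewrite /chi !indicE; congr ((_ : bool)%:R); apply/idP/idP => /set_mem h; apply/mem_set;
    move: h; rewrite /half_plane /= !dotBr dotDr dotZr;
    by rewrite [dot n (perp n)]dotC dot_perp mulr0 addr0.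
rewrite Rintegral_setT_zero; last first.
  by move=> x nO; rewrite /dir !(test_fun_pder_zero _ tp nO) !mulr0 addr0 mulr0.
have [M supp] := test_fun_supp_cbox tp.
have dbd x : `|dir (perp n) x| <= 4 / r * enorm (perp n).
  by rewrite dirE; exact: rbump_grad_bound.
have lip := lipschitz_line (is_derive_dir (perp n)) dbd.
have [] := @integral_directional_derivative0 R (fun x => chi x * rbump m r x)
  (fun x => chi x * dir (perp n) x) (perp n) (4 / r * enorm (perp n)) M 1.
- by apply: measurable_funM => //; apply: smooth_measurable; case: tp.
- apply: measurable_funM => //; apply: measurable_funD;
    apply: measurable_funM => //; apply: smooth_measurable;
    by apply: smooth_pder; case: tp.
- move=> x t; rewrite chi_shift -mulrBr normrM.
  case: (chi01 x) => ->; last by rewrite normr1 mul1r.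
  by rewrite normr0 mul0r (le_trans _ (lip x t)).
- move=> x; rewrite normrM (ger0_norm (rbump_ge0 m r x)).
  case: (chi01 x) => ->; first by rewrite normr0 mul0r ler01.
  by rewrite normr1 mul1r rbump_le1.
- by move=> x h; apply: supp; move: h; apply: contraNneq => ->; rewrite mulr0.
- apply: leb2_aeT => x.
  have /is_derive_line H := is_derive_dir (perp n) x.
  apply/is_derive_line; have := is_deriveM (is_derive_cst (chi x) 0 (1:R)) H.
  rewrite scaler0 addr0; congr is_derive; apply/funext => t.
  by rewrite /= chi_shift.
by move=> _ E; rewrite /Rintegral E.
Qed.

Let J := - \int[leb2]_(x in Om) (chi x * dir n x).

(** On a square of half side [r / 8] around [m + (r / 2) n] the normal derivative
of the bump is at least of order [1 / r]. *)
Let J_lower : expR (-4) * r / 32 <= J.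
Proof.
pose q := m + (r / 2) *: n; pose e := r / 8.
have e0 : 0 <= e by rewrite divr_ge0// ltW.
pose B := cbox (q.1 - e) (q.1 + e) (q.2 - e) (q.2 + e).
have mB : measurable B by exact: measurable_cbox.
have r2 : 0 < r ^+ 2 by rewrite exprn_gt0.
have Bd x : B x -> r / 4 <= dot (x - m) n /\ dot (x - m) (x - m) <= 3 / 4 * r ^+ 2.
  move=> [? ? ? ?]; set y := x - q.
  have S (s : R) : - e <= s -> s <= e -> s ^+ 2 <= r ^+ 2 / 64.
    move=> s1 s2; have -> : r ^+ 2 / 64 = e ^+ 2 by rewrite /e; field.
    rewrite -[leLHS]real_normK ?num_real//.
    by rewrite lerXn2r ?nnegrE ?ler_norml ?s1.
  have y2 : dot y y <= r ^+ 2 / 32.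
    have h1 : y.1 ^+ 2 <= r ^+ 2 / 64 by exact: (S (x.1 - q.1) ltac:(lra) ltac:(lra)).
    have h2 : y.2 ^+ 2 <= r ^+ 2 / 64 by exact: (S (x.2 - q.2) ltac:(lra) ltac:(lra)).
    by rewrite /dot -!expr2; move: h1 h2; move: (y.1 ^+ 2) (y.2 ^+ 2) (r ^+ 2) => ? ? ?; lra.
  have xm : x - m = y + (r / 2) *: n by rewrite /y /q opprD addrA subrK.
  clearbody y.
  have yn : `|dot y n| <= r / 4.
    have := cauchy_schwarz y n; rewrite {2}/enorm n1 sqrtr1 mulr1 => h.
    apply: le_trans h _; rewrite -(ler_pXn2r (n := 2)) ?nnegrE ?enorm_ge0//; last first.
      by rewrite divr_ge0// ltW.
    rewrite sqr_enorm (le_trans y2)// expr_div_n; lra.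
  have e1 : dot (x - m) n = dot y n + r / 2.
    by rewrite xm dotC dotDr dotZr n1 mulr1 dotC.
  have e2 : dot (x - m) (x - m) = dot y y + r * dot y n + r ^+ 2 / 4.
    by rewrite xm sqr_dotD n1; field.
  rewrite e1 e2; move: yn; rewrite ler_norml => /andP[yn1 yn2]; split; first lra.
  have : r * dot y n <= r * (r / 4) by rewrite ler_pM2l.
  have -> : r * (r / 4) = r ^+ 2 / 4 by field.
  lra.
have BO : B `<=` Om.
  by move=> x /Bd[_ h]; apply: dOm; rewrite /disc /=; apply: le_trans h _; lra.
have J0 x : 0 <= - 1 * (chi x * dir n x).
  rewrite dirE /chi indicE; have [/set_mem h|_] := boolP (x \in _); last by rewrite mul0r mulr0.
  have := h; rewrite /half_plane /= dotC => h'.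
  have /andP[b0 _] := rbump'_bounds m r x.
  have -> : -1 * (1%:R * (- (2 / r ^+ 2) * dot (x - m) n * rbump' m r x)) =
    2 / r ^+ 2 * dot (x - m) n * rbump' m r x by ring.
  by rewrite !mulr_ge0 ?invr_ge0 ?(ltW r2) ?(ltW h').
have ig := integrableZ2 oOm (-1) (integrable_chi_dir n).
have -> : J = \int[leb2]_(x in Om) (- 1 * (chi x * dir n x)).
  by rewrite RintZ// mulN1r.
apply: le_trans (Rint_subset mB mOm BO ig (fun x _ => J0 x)).
have EB : leb2 B = (r ^+ 2 / 16)%:E by rewrite leb2_square//; congr EFin; rewrite /e; field.
have [ic E] := integrable_cst_fin (expR (-4) / (2 * r)) mB EB.
have -> : expR (-4) * r / 32 = \int[leb2]_(x in B) (expR (-4) / (2 * r)).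
  by rewrite E; field; rewrite gt_eqF.
apply: (@le_Rintegral _ _ _ leb2) => //.
  exact: (@integrableS _ _ _ leb2 Om).
move=> x Bx; have [h1 h2] := Bd x Bx.
have hx : x \in half_plane n m.
  by apply/mem_set; rewrite /half_plane /= dotC; apply: lt_le_trans h1; rewrite divr_gt0.
have [_ b] := rbump_lower r0 h2.
rewrite dirE /chi indicE hx.
have -> : -1 * (1%:R * (- (2 / r ^+ 2) * dot (x - m) n * rbump' m r x)) =
    2 / r ^+ 2 * (dot (x - m) n * rbump' m r x) by ring.
have -> : expR (-4) / (2 * r) = 2 / r ^+ 2 * (r / 4 * expR (-4)).
  by field; rewrite gt_eqF.
have q0 : 0 <= 2 / r ^+ 2 by rewrite divr_ge0// ltW.
have q1 : 0 <= r / 4 by rewrite divr_ge0// ltW.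
by rewrite (ler_wpM2l q0)// (ler_pM q1 (expR_ge0 _) h1 b).
Qed.

(** Here [J] stands for the integral of the bump over the diameter, which is minus
the integral of its normal derivative over the half disc; the integral of the
tangential derivative vanishes. *)
Lemma half_disc_flux : exists2 J : R, expR (-4) * r / 32 <= J &
  forall j, \int[leb2]_(x in Om) (\1_(half_plane n m) x * pder j (rbump m r) x) =
    - J * crd j n.
Proof.
exists J => // j; rewrite -/chi.
transitivity (\int[leb2]_(x in Om)
   (crd j n * (chi x * dir n x) + crd j (perp n) * (chi x * dir (perp n) x))).
  apply: eq_Rintegral => x _; rewrite /dir.
  have : n.1 * n.1 + n.2 * n.2 = 1 by exact: n1.
  case: (ord2P j) => ->; rewrite /crd /perp /=; move: (pder 0 _ x) (pder 1 _ x) => a b N.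
    by transitivity (chi x * ((n.1 * n.1 + n.2 * n.2) * a)); [rewrite N mul1r|ring].
  by transitivity (chi x * ((n.1 * n.1 + n.2 * n.2) * b)); [rewrite N mul1r|ring].
rewrite RintD//; last 2 first.
- exact: integrableZ2.
- exact: integrableZ2.
by rewrite !RintZ// tangential_flux mulr0 addr0 /J opprK mulrC.
Qed.

End half_disc_flux.

(** * Discrete displacements and pressures *)

Lemma crdD {R : realType} (i : 'I_2) (x y : pt R) : crd i (x + y) = crd i x + crd i y.
Proof. by rewrite /crd; case: ifP. Qed.

Lemma crdB {R : realType} (i : 'I_2) (x y : pt R) : crd i (x - y) = crd i x - crd i y.
Proof. by rewrite /crd; case: ifP. Qed.

Lemma crd_mxpt {R : realType} (A : 'M[R]_2) x i :
  crd i (mxpt A x) = dot (A i 0, A i 1) x.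
Proof.
by case: (ord2P i) => ->; rewrite /mxpt /crd /= sum_ord2 /dot /crd /=.
Qed.

Lemma dot_basis {R : realType} (x : pt R) i : dot x (basis i) = crd i x.
Proof.
by rewrite /dot /Defs.basis /crd; case: ifP => _ /=; rewrite mulr0 mulr1 ?addr0 ?add0r.
Qed.

Lemma crd_continuous {R : realType} (i : 'I_2) : continuous (@crd R i).
Proof.
rewrite (_ : crd i = dot (basis i)); first exact: dot_continuous.
by apply/funext => x; rewrite dotC dot_basis.
Qed.

Section discrete_fields.
Context (R : realType) (Om : set (pt R)) (T : mesh R).
Hypotheses (oOm : open Om) (bOm : bounded_set Om).
Hypothesis mT : conforming_mesh Om T.

(** The choice of an affine extension on each triangle gives one matrix per
triangle for both the classical and the weak gradient. *)
Lemma P1_gradient (v : pt R -> pt R) : P1 Om T v ->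
  exists A : cell R -> 'M[R]_2,
    [/\ forall i, H1 Om (component i v),
        forall K x, K \in T -> elt K x -> cgrad v x = A K
      & {ae leb2, forall x, Om x -> forall K, K \in T -> elt K x ->
          wgrad Om v x = A K}].
Proof.
move=> [cv affv].
have /choice[Ab HAb] (K : cell R) : exists Ab : 'M[R]_2 * pt R, K \in T ->
    forall x, hull K x -> v x = mxpt Ab.1 x + Ab.2.
  have [KT|KT] := boolP (K \in T); last by exists (0, 0).
  by have [A [b H]] := affv _ KT; exists (A, b).
pose A K := (Ab K).1; pose b K := (Ab K).2.
have vE i K x : K \in T -> hull K x ->
    component i v x = crd i (b K) + dot (A K i 0, A K i 1) x.
  by move=> KT xK; rewrite /component (HAb K KT x xK) crdD crd_mxpt addrC.
have civ i : {within closure Om, continuous (component i v)}.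
  move=> x; apply: continuous_comp; [exact: cv|exact: crd_continuous].
have AE K i j : dot (A K i 0, A K i 1) (basis j) = A K i j.
  by rewrite dot_basis; case: (ord2P j) => ->.
exists A; split=> [i|K x KT xK|].
- exact: (@piecewise_affine_H1 _ _ _ oOm bOm mT (component i v)
    (fun K => crd i (b K)) (fun K => (A K i 0, A K i 1)) (vE i) (civ i)).
- apply/matrixP => i j; rewrite mxE /pder -AE.
  apply: derive_val; have := is_derive_dot (A K i 0, A K i 1) x (basis j).
  have N : \forall y \near x, crd i (b K) + dot (A K i 0, A K i 1) y = component i v y.
    apply: (@filterS _ (nbhs x) (nbhs_filter x) (elt K)).
      by move=> y /elt_sub_hull yK; rewrite (vE i K).
    by apply: open_nbhs_nbhs; split => //; exact: open_elt.
  move=> H; have H2 := is_deriveD (is_derive_cst (crd i (b K)) x (basis j)) H.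
  by rewrite add0r in H2; apply: near_eq_is_derive H2.
- have := @ae_matrix R (fun i j x => Om x -> wD Om j (component i v) x =
    pw_pder T (fun K => (A K i 0, A K i 1)) j x).
  move=> /(_ (fun i => @wD_piecewise_affine _ _ _ oOm bOm mT (component i v)
    (fun K => crd i (b K)) (fun K => (A K i 0, A K i 1)) (vE i) (civ i))).
  apply: leb2_ae_imp => x H Ox K KT xK; apply/matrixP => i j.
  by rewrite mxE H// (pw_pder_elt mT _ _ KT xK) AE.
Qed.

Lemma Qh_values (q : pt R -> R) : Qh Om T q ->
  exists P : cell R -> R, forall K x, K \in T -> elt K x -> q x = P K.
Proof.
move=> [_ H].
have /choice[P HP] (K : cell R) : exists c : R, K \in T -> forall x, elt K x -> q x = c.
  have [KT|KT] := boolP (K \in T); last by exists 0.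
  by have [c Hc] := H _ KT; exists c.
by exists P => K x KT; exact: HP.
Qed.

Lemma wgradB (u v : pt R -> pt R) :
  (forall i, H1 Om (component i u)) -> (forall i, H1 Om (component i v)) ->
  (forall i, H1 Om (component i (fun x => u x - v x))) /\
  {ae leb2, forall x, Om x ->
    wgrad Om (fun x => u x - v x) x = wgrad Om u x - wgrad Om v x}.
Proof.
move=> Hu Hv.
have E i : component i (fun x => u x - v x) = (fun x => component i u x - component i v x).
  by apply/funext => x; rewrite /component crdB.
split=> [i|]; first by rewrite E; exact: H1B.
have := @ae_matrix R (fun i j x => Om x -> wD Om j (component i (fun x => u x - v x)) x =
  wD Om j (component i u) x - wD Om j (component i v) x).
have D i j : {ae leb2, forall x, Om x -> wD Om j (component i (fun x => u x - v x)) x =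
  wD Om j (component i u) x - wD Om j (component i v) x} by rewrite E; exact: wDB.
move=> /(_ D); apply: leb2_ae_imp => x H Ox.
by apply/matrixP => i j; rewrite !mxE H.
Qed.

End discrete_fields.

Lemma frobBl {R : realType} (A B V : 'M[R]_2) : frob (A - B) V = frob A V - frob B V.
Proof.
rewrite !frobE !mxE; move: (A 0 0) (A 0 1) (A 1 0) (A 1 1) (B 0 0) (B 0 1) (B 1 0) (B 1 1).
by move: (V 0 0) (V 0 1) (V 1 0) (V 1 1) => *; ring.
Qed.

(** * The constants *)

(** The square of the lower bound of the bumps is the common denominator; the
numerators come from [eta_R2_bound] and [eta_edge_bound]. *)
Definition volume_constant {R : realType} (gam : R) : R :=
  (2048 * gam ^+ 2 + 4096 * 4096 * gam ^+ 4) / expR (-4) ^+ 2.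

Definition edge_constant {R : realType} (gam : R) : R :=
  (4096 + 4096 * (128 * 128) * gam ^+ 2) / expR (-4) ^+ 2.

Lemma volume_terms_ge0 {R : realType} (gam : R) :
  0 <= 2048 * gam ^+ 2 / expR (-4) ^+ 2 /\
  0 <= 4096 * 4096 * gam ^+ 4 / expR (-4) ^+ 2.
Proof.
have b0 : 0 <= (expR (-4) ^+ 2 : R)^-1 by rewrite invr_ge0 exprn_ge0 ?expR_ge0.
have g4 : 0 <= gam ^+ 4 by rewrite (_ : gam ^+ 4 = (gam ^+ 2) ^+ 2) ?sqr_ge0 -?exprM.
split; apply: mulr_ge0 b0; first by apply: mulr_ge0 (sqr_ge0 gam); exact: ler0n.
by apply: mulr_ge0 g4; apply: mulr_ge0; exact: ler0n.
Qed.

Lemma volume_constant_ge0 {R : realType} (gam : R) : 0 <= volume_constant gam.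
Proof.
by have [h1 h2] := volume_terms_ge0 gam; rewrite /volume_constant (mulrDl (2048 * gam ^+ 2)) addr_ge0.
Qed.

Lemma edge_constant_ge0 {R : realType} (gam : R) : 0 <= edge_constant gam.
Proof.
apply: mulr_ge0; last by rewrite invr_ge0 exprn_ge0 ?expR_ge0.
apply: addr_ge0; first exact: ler0n.
by apply: mulr_ge0 (sqr_ge0 gam); apply: mulr_ge0; [|apply: mulr_ge0]; exact: ler0n.
Qed.

(** The factor 16 is the one of [face_overlap], and 8 that of the constraint. *)
Definition efficiency_constant {R : realType} (gam : R) : R :=
  volume_constant gam + 16 * edge_constant gam * (1 + volume_constant gam) + 8.

Lemma efficiency_constant_gt0 {R : realType} (gam : R) : 0 < efficiency_constant gam.
Proof.
rewrite /efficiency_constant; move: (volume_constant_ge0 gam) (edge_constant_ge0 gam).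
move: (volume_constant _) (edge_constant _) => a b a0 b0.
by rewrite ltr_wpDl ?ltr0n// addr_ge0// mulr_ge0 ?mulr_ge0 ?addr_ge0.
Qed.

Lemma sqrtrD_le {R : realType} (a b : R) : 0 <= a -> 0 <= b ->
  Num.sqrt (a + b) <= Num.sqrt a + Num.sqrt b.
Proof.
move=> a0 b0; have ab : 0 <= a + b by exact: addr_ge0.
have s0 : 0 <= Num.sqrt a + Num.sqrt b by apply: addr_ge0; exact: sqrtr_ge0.
rewrite -(@ler_pXn2r _ 2) ?nnegrE ?sqrtr_ge0//.
rewrite sqr_sqrtr// sqrrD !sqr_sqrtr// addrAC lerDl.
by rewrite mulrn_wge0// mulr_ge0 ?sqrtr_ge0.
Qed.

(** * Residuals inside a triangle *)

Lemma frob_tens {R : realType} (S : 'M[R]_2) c phi x :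
  frob S (tens c phi x) = (S 0 0 * c.1 + S 1 0 * c.2) * pder 0 phi x +
    (S 0 1 * c.1 + S 1 1 * c.2) * pder 1 phi x.
Proof.
rewrite frobE /tens !mxE /crd /=.
by move: (pder 0 _ x) (pder 1 _ x) (S 0 0) (S 0 1) (S 1 0) (S 1 1) => *; ring.
Qed.

(** A constant stress is in equilibrium. *)
Lemma frob_tens_const {R : realType} (Om : set (pt R)) (S : 'M[R]_2) c phi :
  open Om -> bounded_set Om -> test_fun Om phi ->
  \int[leb2]_(x in Om) frob S (tens c phi x) = 0.
Proof.
move=> oOm bOm tp; under eq_Rintegral do rewrite frob_tens.
have ip i : leb2.-integrable Om (EFin \o pder i phi).
  by apply: L2_integrable => //; apply: test_fun_L2 => //; exact: test_fun_pder.
have I0 i : \int[leb2]_(x in Om) pder i phi x = 0.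
  rewrite Rintegral_setT_zero; last by move=> x; exact: test_fun_pder_zero.
  by have [_ E] := integral_pder0 i tp; rewrite /Rintegral E.
rewrite RintD//; [|exact: integrableZ2|exact: integrableZ2].
by rewrite !RintZ// !I0 !mulr0 addr0.
Qed.

Section residual_bounds.
Context (R : realType) (Om : set (pt R)) (T : mesh R).
Hypotheses (oOm : open Om) (bOm : bounded_set Om) (lip : lipschitz_boundary Om).
Hypothesis mT : conforming_mesh Om T.
Let mOm : measurable Om := open_measurable2 oOm.
Variables (F : formulation) (mu lam : R) (f g fh u uh : pt R -> pt R) (p ph : pt R -> R).
Hypotheses (mu0 : 0 < mu) (Lf : forall i, L2 Om (component i f)).
Hypothesis Lfh : forall i, L2 Om (component i fh).
Hypothesis sol : weak_solution F mu lam Om f g u p.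
Hypothesis Lph : L2 Om ph.
Variables (A : cell R -> 'M[R]_2) (P : cell R -> R) (fK : cell R -> pt R).
Hypothesis H1uh : forall i, H1 Om (component i uh).
Hypothesis wgrad_uh : {ae leb2, forall x, Om x -> forall K, K \in T -> elt K x ->
  wgrad Om uh x = A K}.
Hypothesis phE : forall K x, K \in T -> elt K x -> ph x = P K.
Hypothesis fhE : forall K x, K \in T -> elt K x -> fh x = fK K.

Local Notation E := (wgrad Om (fun x => u x - uh x)).
Local Notation ep := (fun x => p x - ph x).
Local Notation Sh := (fun x => stress F mu (wgrad Om uh x) (ph x)).
Local Notation Se := (fun x => stress F mu (E x) (ep x)).
Definition error_density x : R := 2 * mu * frob (E x) (E x) + (2 * mu)^-1 * ep x ^+ 2.
Local Notation Z := error_density.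

Let H1u : forall i, H1 Om (component i u).
Proof. by case: sol => H _ _ _ i; case: (H i). Qed.

Let Lp : L2 Om p. Proof. by case: sol. Qed.

Let LE : L2m Om E. Proof. exact: L2m_wgrad (wgradB oOm bOm H1u H1uh).1. Qed.

Let Lep : L2 Om ep. Proof. exact: L2B. Qed.

Let LSh : L2m Om Sh. Proof. by apply: L2m_stress => //; exact: L2m_wgrad. Qed.

Let LSe : L2m Om Se. Proof. exact: L2m_stress. Qed.

Let iZ : leb2.-integrable Om (EFin \o Z).
Proof.
apply: integrableD2 => //; apply: integrableZ2 => //; first exact: frob_integrable.
exact: (L2M mOm Lep Lep).
Qed.

Lemma error_density_ge0 x : 0 <= Z x.
Proof.
by rewrite addr_ge0// mulr_ge0 ?sqr_ge0 ?frob_ge0 ?invr_ge0 ?mulr_ge0// ltW.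
Qed.

(** The momentum balance for the error: the discrete stress differs from the exact
one by the stress of the error. *)
Lemma error_identity c phi : test_fun Om phi ->
  \int[leb2]_(x in Om) frob (Sh x) (tens c phi x) =
  \int[leb2]_(x in Om) (dot (f x) c * phi x) -
  \int[leb2]_(x in Om) frob (Se x) (tens c phi x).
Proof.
move=> tp; have Lt := L2m_tens oOm bOm c tp.
have iSh := frob_integrable oOm LSh Lt; have iSe := frob_integrable oOm LSe Lt.
rewrite -(weak_identity oOm bOm c Lf sol tp); apply/eqP; rewrite eq_sym subr_eq -RintD//.
apply/eqP; apply: Rint_ae_eq => //; last 2 first.
- exact: integrableD2.
- apply: leb2_ae_imp (wgradB oOm bOm H1u H1uh).2 => x H Ox.
  by rewrite (H Ox) stressB frobBl addrC subrK.
by apply: frob_integrable => //; apply: L2m_stress => //; exact: L2m_wgrad.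
Qed.

(** Lower bound of the bumps on the inner part of their discs. *)
Let beta : R := expR (-4).
Let beta0 : 0 < beta. Proof. exact: expR_gt0. Qed.

Let iSS : leb2.-integrable Om (EFin \o (fun x => frob (Se x) (Se x))).
Proof. exact: frob_integrable. Qed.

Let stress_density m r : 0 < r -> disc m r `<=` Om ->
  \int[leb2]_(x in disc m r) frob (Se x) (Se x) <=
  8 * mu * \int[leb2]_(x in disc m r) Z x.
Proof.
move=> r0 dO; have md := measurable_disc m r.
have I (h : pt R -> R) : leb2.-integrable Om (EFin \o h) ->
    leb2.-integrable (disc m r) (EFin \o h).
  by move=> ih; apply: (@integrableS _ _ _ leb2 Om).
rewrite -(@RintegralZl _ _ _ leb2 _ _ (8 * mu) md (I _ iZ)).
apply: (@le_Rintegral _ _ _ leb2) => //; first exact: I.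
  exact: (I (fun x => 8 * mu * Z x) (integrableZ2 oOm _ iZ)).
by move=> x _; exact: frob_stress_le.
Qed.

Let Lff : forall i, L2 Om (component i (fun x => f x - fh x)).
Proof.
move=> i; have := L2B mOm (Lf i) (Lfh i); congr L2; apply/funext => x.
by rewrite /component crdB.
Qed.

(** The discrete stress is constant on the disc, so the volume residual [fK K]
balances the stress of the error up to the oscillation of the load. *)
Lemma interior_residual_bound K m r : K \in T -> 0 < r -> disc m r `<=` elt K ->
  dot (fK K) (fK K) <=
    8 / (beta ^+ 2 * r ^+ 2) *
      \int[leb2]_(x in disc m r) dot (f x - fh x) (f x - fh x) +
    2048 * mu / (beta ^+ 2 * r ^+ 4) * \int[leb2]_(x in disc m r) Z x.
Proof.
move=> KT r0 dK; set c := fK K; set J1 := Rintegral _ _ _; set J2 := Rintegral _ _ _.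
have dO : disc m r `<=` Om := subset_trans dK (elt_sub_domain oOm lip mT KT).
have tp := test_fun_rbump r0 dO.
have Lphi := test_fun_L2 oOm bOm tp.
have equil : \int[leb2]_(x in Om) frob (Sh x) (tens c (rbump m r) x) = 0.
  rewrite -(frob_tens_const (stress F mu (A K) (P K)) c oOm bOm tp).
  have Lt := L2m_tens oOm bOm c tp.
  apply: Rint_ae_eq => //; first exact: frob_integrable.
    apply: frob_integrable => // i j; apply: L2_cst => //.
  apply: leb2_ae_imp wgrad_uh => x H Ox.
  have [xd|xd] := pselect (disc m r x); last by rewrite !frob_tens_off.
  by rewrite (H Ox K KT (dK _ xd)) (phE KT (dK _ xd)).
have := error_identity c tp; rewrite equil => /esym/eqP; rewrite subr_eq0 => /eqP bal.
have Ldot (w : pt R -> pt R) : (forall i, L2 Om (component i w)) ->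
    L2 Om (fun x => dot (w x) c).
  move=> Lw; rewrite /dot; have := L2D mOm (L2Z mOm c.1 (Lw 0)) (L2Z mOm c.2 (Lw 1)).
  by congr L2; apply/funext => x; rewrite /component /crd /=; ring.
have split_load : dot c c * \int[leb2]_(x in Om) rbump m r x =
    \int[leb2]_(x in Om) (dot (f x) c * rbump m r x) -
    \int[leb2]_(x in Om) (dot (f x - fh x) c * rbump m r x).
  apply/eqP; rewrite eq_sym subr_eq -RintZ//; last exact: L2_integrable.
  rewrite -RintD//; last 2 first.
  - by apply: integrableZ2 => //; exact: L2_integrable.
  - exact: (L2M mOm (Ldot _ Lff) Lphi).
  apply/eqP/eq_Rintegral => x _; have [xd|xd] := pselect (disc m r x).
    by rewrite (fhE KT (dK _ xd)) -/c [dot (f x - c) c]dotC dotBr [dot c (f x)]dotC; ring.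
  rewrite (rbump_support r0 _).1 ?mulr0 ?addr0//.
  by apply: ltW; rewrite ltNge; apply/negP.
have lowb := integral_rbump_lower oOm bOm r0 dO.
(* The two parameters are chosen such that each of the terms in |c|^2 is a
   quarter of the lower bound beta r^2 |c|^2. *)
have t1 : 0 < 4 / beta by rewrite divr_gt0.
have t2 : 0 < 128 / (beta * r ^+ 2) by rewrite divr_gt0// mulr_gt0// exprn_gt0.
have := load_bound oOm bOm r0 dO c t1 Lff.
have := stress_bound oOm bOm r0 dO c t2 LSe; rewrite -bal -/J1.
have := stress_density r0 dO; rewrite -/J2.
move: split_load lowb (dot_ge0 c).
set x1 := Rintegral _ _ _; set x2 := Rintegral _ _ _; set x3 := Rintegral _ _ _.
set x4 := Rintegral _ _ _; set cc := dot c c => e1 e2 cc0 e3 e4 e5.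
have h1 : cc * (beta * r ^+ 2) <= x2 - x3 by rewrite -e1 ler_wpM2l.
have h2 : x2 - x3 <= `|x2| + `|x3|.
  by rewrite (le_trans (ler_norm _))// ler_normB.
have k1 : 32 * cc / (128 / (beta * r ^+ 2)) = cc * (beta * r ^+ 2) / 4.
  by field; rewrite !gt_eqF.
have k2 : r ^+ 2 * cc / (4 / beta) = cc * (beta * r ^+ 2) / 4.
  by field; rewrite gt_eqF.
have k3 : 128 / (beta * r ^+ 2) * x4 <= 128 / (beta * r ^+ 2) * (8 * mu * J2).
  by rewrite ler_wpM2l// ltW.
have h3 : cc * (beta * r ^+ 2) / 2 <= 4 / beta * J1 + 128 / (beta * r ^+ 2) * (8 * mu * J2).
  rewrite k1 in e4; rewrite k2 in e5.
  move: h1 h2 k3 e4 e5; move: (128 / _ * _) (128 / _ * _) (4 / _ * _) (cc * _).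
  by move: `|x2| `|x3| (x2 - x3) => *; lra.
have q0 : 0 < 2 / (beta * r ^+ 2) by rewrite divr_gt0// mulr_gt0// exprn_gt0.
have := ler_wpM2l (ltW q0) h3.
have -> : 2 / (beta * r ^+ 2) * (cc * (beta * r ^+ 2) / 2) = cc.
  by field; rewrite !gt_eqF.
move=> /le_trans; apply; rewrite le_eqVlt; apply/orP; left; apply/eqP.
by field; rewrite !gt_eqF.
Qed.

(** * Residuals on an edge *)

Lemma enormD (x y : pt R) : enorm (x + y) <= enorm x + enorm y.
Proof.
rewrite le_enorm ?addr_ge0 ?enorm_ge0//.
have := sqr_dotD x y 1; rewrite scale1r => ->.
have := le_trans (ler_norm _) (cauchy_schwarz x y).
have := sqr_enorm x; have := sqr_enorm y; nra.
Qed.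

(** The disc of twice the radius is covered by the two triangles, so the smaller
one lies in the interior of the closure of the domain, which is the domain. *)
Lemma edge_patch (gam : R) K Ed :
  (forall K, K \in T -> h_ K <= gam * indiam (hull K)) ->
  K \in T -> Ed \in faces K -> ~~ boundary_edge Om Ed ->
  0 < gam /\ exists K1 K2, let r := len Ed / (16 * gam) in
    [/\ [/\ K1 \in T, Ed \in faces K1 & side K1 Ed = 1],
        [/\ K2 \in T, Ed \in faces K2 & side K2 Ed = -1],
        len Ed <= h_ K1 /\ len Ed <= h_ K2,
        0 < r /\ disc (mid Ed) r `<=` Om
      & forall x, disc (mid Ed) r x ->
          (0 < dot (nrm Ed) (x - mid Ed) -> elt K1 x) /\
          (dot (nrm Ed) (x - mid Ed) < 0 -> elt K2 x)].
Proof.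
move=> reg KT EK nb; have [_ E2] := facesP _ _ EK.
have [gam0 _] := inscribed_disc (mesh_triangle mT KT) (reg _ KT).
split => //; have l0 := len_gt0 E2.
have [K1 [K2 [K1T K2T EK1 EK2 [s1 s2]]]] := interior_edge_pair oOm mT KT EK nb.
exists K1, K2 => /=; set r := len Ed / _.
have r0 : 0 < r by rewrite divr_gt0// mulr_gt0.
have lh K' : K' \in T -> Ed \in faces K' -> len Ed <= h_ K'.
  move=> K'T /facesP[/fsubsetP sE _].
  by apply: dist_le_diam; apply: vertex_hull; apply: sE; [exact: ptB_in|exact: ptA_in].
have small K' : K' \in T -> Ed \in faces K' ->
    forall v, v \in K' -> enorm (glambda K' v) * (2 * r) <= 4^-1.
  move=> K'T EK' v vK'; have tK := mesh_triangle mT K'T.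
  have [_ [x0 [d [d0 hd Hd]]]] := inscribed_disc tK (reg _ K'T).
  have := glambda_bound tK vK' d0 Hd.
  have : 2 * r <= d / 4.
    rewrite /r mulrA ler_pdivrMr ?mulr_gt0//.
    have := le_trans (lh _ K'T EK') hd; lra.
  by move=> /(ler_wpM2l (enorm_ge0 (glambda K' v))); lra.
have half K' x : K' \in T -> Ed \in faces K' -> enorm (x - mid Ed) <= 2 * r ->
   (0 < side K' Ed * dot (nrm Ed) (x - mid Ed) -> elt K' x) /\
   (0 <= side K' Ed * dot (nrm Ed) (x - mid Ed) -> hull K' x).
  move=> K'T EK' xr; rewrite dot_nrm_mid.
  exact: half_disc (mesh_triangle mT K'T) EK' (small _ K'T EK') xr.
split => //.
- by split; apply: lh.
- split => // x /(discE _ _ (ltW r0)) xr.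
  apply: (lipschitz_regular_open oOm lip).
  apply: (@filterS _ (nbhs x) (nbhs_filter x) _ _ _ (nbhs_edisc x r0)) => z /= zr.
  have zm : enorm (z - mid Ed) <= 2 * r.
    rewrite -(subrK x z) -addrA; apply: le_trans (enormD _ _) _; lra.
  have [_ rT _] := mT; rewrite -rT.
  have [c|c] := leP 0 (dot (nrm Ed) (z - mid Ed)).
    by exists K1 => //; apply: (half K1 z K1T EK1 zm).2; rewrite s1 mul1r.
  by exists K2 => //; apply: (half K2 z K2T EK2 zm).2; rewrite s2 mulN1r oppr_ge0 ltW.
- move=> x /(discE _ _ (ltW r0)) xr.
  have xm : enorm (x - mid Ed) <= 2 * r by lra.
  split => c; first by apply: (half K1 x K1T EK1 xm).1; rewrite s1 mul1r.
  by apply: (half K2 x K2T EK2 xm).1; rewrite s2 mulN1r oppr_gt0.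
Qed.

Lemma hull_sub_closure_elt K : K \in T -> hull K `<=` closure (elt K).
Proof.
move=> KT x xK B xB; have tK := mesh_triangle mT KT.
case: (tK) => _ [x0 x0K].
have [e e0 He] := nbhs_line (x0 - x) xB.
have [t t0 te] : exists2 t : R, 0 < t <= 1 & `|t| < e.
  exists (Num.min 1 (e / 2)).
    by rewrite lt_min ltr01 divr_gt0//= ge_min lexx.
  rewrite gtr0_norm ?lt_min ?ltr01 ?divr_gt0// gt_min; apply/orP; right.
  by rewrite ltr_pdivrMr// ltr_pMr// ltr1n.
case/andP: t0 => t0 t1.
exists (x + t *: (x0 - x)); split; last by apply: He; exact: ltW.
apply/(eltP _ tK) => v vK.
rewrite lambdaD dotZr -lambdaB.
have := (hullP _ tK).1 xK v vK; have := (eltP _ tK).1 x0K v vK; nra.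
Qed.

Lemma trace_from_const (V : normedModType R) K (w : pt R -> V) x c :
  K \in T -> hull K x -> (forall y, elt K y -> w y = c) -> trace_from K w x = c.
Proof.
move=> KT xK wc; rewrite /trace_from.
have PF : ProperFilter (within (elt K) (nbhs x)).
  by apply: within_nbhs_proper; exact: hull_sub_closure_elt KT _ xK.
apply: lim_near_cst => //; apply: (@filterS _ (nbhs x) (nbhs_filter x) setT) => //.
  by move=> y _ yK; exact: wc.
exact: (@filterT _ _ (nbhs_filter x)).
Qed.

Let sig K := stress F mu (A K) (P K).

Lemma mxptBl (S S' : 'M[R]_2) x : mxpt (S - S') x = mxpt S x - mxpt S' x.
Proof. by apply: pt_eq; rewrite /mxpt /= !sum_ord2 !mxE; ring. Qed.

(** The value of the edge residual, when [n] points from [K2] into [K1]. *)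
Definition stress_jump K1 K2 n : pt R := - (2^-1 *: mxpt (sig K1 - sig K2) n).

Lemma edge_residualE K1 K2 Ed t :
  (forall K x, K \in T -> elt K x -> cgrad uh x = A K) ->
  K1 \in T -> Ed \in faces K1 -> side K1 Ed = 1 ->
  K2 \in T -> Ed \in faces K2 -> side K2 Ed = -1 ->
  ~~ boundary_edge Om Ed -> 0 <= t -> t <= 1 ->
  edge_residual F mu Om T uh ph Ed (ptA Ed + t *: (ptB Ed - ptA Ed)) =
  stress_jump K1 K2 (nrm Ed).
Proof.
move=> cg K1T EK1 s1 K2T EK2 s2 nb t0 t1; set x := _ + _.
have xK K : K \in T -> Ed \in faces K -> hull K x.
  move=> KT /facesP[/fsubsetP sE E2]; have tK := mesh_triangle mT KT.
  apply/(hullP _ tK) => v vK; rewrite lambdaD dotZr -lambdaB.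
  have := (hullP _ tK).1 (vertex_hull (sE _ (ptA_in E2))) v vK.
  have := (hullP _ tK).1 (vertex_hull (sE _ (ptB_in E2))) v vK; nra.
have tr K : K \in T -> Ed \in faces K -> trace_from K
    (fun y => - mxpt (stress F mu (cgrad uh y) (ph y)) (nrm Ed)) x = - mxpt (sig K) (nrm Ed).
  move=> KT EK; apply: (trace_from_const KT (xK K KT EK)) => y yK.
  by rewrite (cg K y KT yK) (phE KT yK).
rewrite /edge_residual (negbTE nb) /jump.
rewrite (sum_interior_edge _ mT K1T K2T EK1 EK2 s1 s2) s1 s2 !tr//.
by rewrite /stress_jump scale1r scaleN1r opprK mxptBl -scalerN opprB addrC.
Qed.

Lemma line_int_edge_residual K1 K2 Ed :
  (forall K x, K \in T -> elt K x -> cgrad uh x = A K) ->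
  K1 \in T -> Ed \in faces K1 -> side K1 Ed = 1 ->
  K2 \in T -> Ed \in faces K2 -> side K2 Ed = -1 ->
  ~~ boundary_edge Om Ed -> let c := stress_jump K1 K2 (nrm Ed) in
  line_int Ed (fun x => let r := edge_residual F mu Om T uh ph Ed x in dot r r) =
  len Ed * dot c c.
Proof.
move=> cg K1T EK1 s1 K2T EK2 s2 nb c; rewrite /line_int; congr (_ * _).
rewrite (_ : Rintegral _ _ _ = \int[lebesgue_measure]_(t in `[0%R, 1%R]) (dot c c)).
  rewrite Rintegral_cst//= lebesgue_measure_itv /= lte_fin ltr01.
  by rewrite -EFinD /= subr0 mulr1.
apply: eq_Rintegral => t /set_mem /=; rewrite in_itv /= => /andP[t0 t1].
by rewrite (edge_residualE cg K1T EK1 s1 K2T EK2 s2 nb t0 t1).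
Qed.

Lemma ae_stress_across_edge K1 K2 n m c r : n != 0 ->
  K1 \in T -> K2 \in T -> 0 < r ->
  (forall x, disc m r x -> (0 < dot n (x - m) -> elt K1 x) /\
                           (dot n (x - m) < 0 -> elt K2 x)) ->
  {ae leb2, forall x, Om x -> frob (Sh x) (tens c (rbump m r) x) =
    frob (sig K2) (tens c (rbump m r) x) +
    \1_(half_plane n m) x * frob (sig K1 - sig K2) (tens c (rbump m r) x)}.
Proof.
move=> n0 K1T K2T r0 sides.
apply: leb2_ae_imp (leb2_ae_and wgrad_uh (ae_off_line (dot n m) n0)) => x [H off] Ox.
have [xd|xd] := pselect (disc m r x); last by rewrite !frob_tens_off// mulr0 addr0.
have [pos neg] := sides x xd; rewrite indicE.
have [c0|c0|c0] := ltgtP 0 (dot n (x - m)).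
- rewrite mem_set// mul1r frobBl addrC subrK.
  by rewrite (H Ox K1 K1T (pos c0)) (phE K1T (pos c0)).
- rewrite memNset ?mul0r ?addr0; last by rewrite /half_plane /= => /(lt_trans c0); rewrite ltxx.
  by rewrite (H Ox K2 K2T (neg c0)) (phE K2T (neg c0)).
- by exfalso; apply: off; apply/eqP; rewrite -subr_eq0 -dotBr c0.
Qed.

(** The stress is [sig K2] plus the indicator of a half plane times the difference
of the two stresses; the first part is in equilibrium and the second one is
evaluated by [half_disc_flux]. *)
Lemma flux_across_edge K1 K2 n m r : dot n n = 1 ->
  K1 \in T -> K2 \in T -> 0 < r -> disc m r `<=` Om ->
  (forall x, disc m r x -> (0 < dot n (x - m) -> elt K1 x) /\
                           (dot n (x - m) < 0 -> elt K2 x)) ->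
  forall c, c = stress_jump K1 K2 n ->
  beta * r / 16 * dot c c <=
  \int[leb2]_(x in Om) frob (Sh x) (tens c (rbump m r) x).
Proof.
move=> n1 K1T K2T r0 dO sides _ ->; set c := stress_jump _ _ _; set D := sig K1 - sig K2.
have n0 : n != 0.
  by apply/eqP => n0; move/eqP: n1; rewrite n0 /dot /= !mulr0 addr0 eq_sym oner_eq0.
have tp := test_fun_rbump r0 dO; have Lt := L2m_tens oOm bOm c tp.
have [J J0 JE] := half_disc_flux oOm bOm n1 r0 dO.
have L2chi : L2 Om (\1_(half_plane n m) : pt R -> R).
  apply: (@L2_bounded _ _ mOm _ 1).
  - exact: leb2_bounded_fin.
  - by apply: measurable_funTS; apply: measurable_indic; exact: measurable_half_plane.
  - by move=> x _; rewrite indicE; case: (_ \in _); rewrite ?normr0 ?normr1 ?ler01.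
have ichi j : leb2.-integrable Om
    (EFin \o (fun x => \1_(half_plane n m) x * pder j (rbump m r) x)).
  by apply: (L2M mOm L2chi); apply: test_fun_L2 => //; exact: test_fun_pder.
have chiI k j : \int[leb2]_(x in Om)
    (k * (\1_(half_plane n m) x * pder j (rbump m r) x)) = k * (- J * crd j n).
  by rewrite RintZ// JE.
pose a j := D 0 j * c.1 + D 1 j * c.2.
have chiE x : \1_(half_plane n m) x * frob D (tens c (rbump m r) x) =
    a 0 * (\1_(half_plane n m) x * pder 0 (rbump m r) x) +
    a 1 * (\1_(half_plane n m) x * pder 1 (rbump m r) x).
  rewrite frob_tens -/(a 0) -/(a 1); move: (pder 0 _ x) (pder 1 _ x) (a 0) (a 1) (\1__ x).
  by move=> *; ring.
have iconst (S : 'M[R]_2) : leb2.-integrable Om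
    (EFin \o (fun x => frob S (tens c (rbump m r) x))).
  by apply: frob_integrable => // i j; exact: L2_cst.
have -> : \int[leb2]_(x in Om) frob (Sh x) (tens c (rbump m r) x) =
    2 * J * dot c c.
  transitivity (\int[leb2]_(x in Om) (frob (sig K2) (tens c (rbump m r) x) +
    (a 0 * (\1_(half_plane n m) x * pder 0 (rbump m r) x) +
     a 1 * (\1_(half_plane n m) x * pder 1 (rbump m r) x)))).
    apply: Rint_ae_eq => //; first exact: frob_integrable.
      by apply: integrableD2 => //; apply: integrableD2 => //; exact: integrableZ2.
    apply: leb2_ae_imp (ae_stress_across_edge c n0 K1T K2T r0 sides) => x H Ox.
    by rewrite (H Ox) -chiE.
  rewrite RintD//; last by apply: integrableD2 => //; exact: integrableZ2.
  rewrite frob_tens_const// add0r RintD//; [|exact: integrableZ2|exact: integrableZ2].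
  transitivity (a 0 * (- J * crd 0 n) + a 1 * (- J * crd 1 n)).
    by congr (_ + _); exact: chiI.
  have cE1 : 2 * c.1 = - (D 0 0 * n.1 + D 0 1 * n.2).
    by rewrite /c /stress_jump /mxpt /= sum_ord2 -/D /crd /= /GRing.scale /=; field.
  have cE2 : 2 * c.2 = - (D 1 0 * n.1 + D 1 1 * n.2).
    by rewrite /c /stress_jump /mxpt /= sum_ord2 -/D /crd /= /GRing.scale /=; field.
  have -> : 2 * J * dot c c = J * (c.1 * (2 * c.1) + c.2 * (2 * c.2)).
    by rewrite /dot; ring.
  rewrite cE1 cE2 /a /crd /=; move: (c.1) (c.2) (D 0 0) (D 0 1) (D 1 0) (D 1 1).
  by move=> *; ring.
rewrite ler_wpM2r ?dot_ge0//; move: J0; rewrite -/beta; lra.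
Qed.

(** The momentum balance bounds the flux by the load and by the stress of the
error; half of the flux is absorbed. *)
Lemma jump_residual_bound K1 K2 n m r : dot n n = 1 ->
  K1 \in T -> K2 \in T -> 0 < r -> disc m r `<=` Om ->
  (forall x, disc m r x -> (0 < dot n (x - m) -> elt K1 x) /\
                           (dot n (x - m) < 0 -> elt K2 x)) ->
  forall c, c = stress_jump K1 K2 n ->
  dot c c <= 2048 / beta ^+ 2 * \int[leb2]_(x in disc m r) dot (f x) (f x) +
    2048 * 256 * mu / (beta ^+ 2 * r ^+ 2) * \int[leb2]_(x in disc m r) Z x.
Proof.
move=> n1 K1T K2T r0 dO sides c cE; set J1 := Rintegral _ _ _; set J2 := Rintegral _ _ _.
have tp := test_fun_rbump r0 dO.
have := flux_across_edge n1 K1T K2T r0 dO sides cE; rewrite (error_identity c tp).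
(* Again each of the terms in |c|^2 is a quarter of the lower bound. *)
have t1 : 0 < 64 * r / beta by rewrite divr_gt0// mulr_gt0.
have t2 : 0 < 2048 / (beta * r).
  by apply: divr_gt0; [rewrite ltr0n|exact: mulr_gt0].
have := load_bound oOm bOm r0 dO c t1 Lf.
have := stress_bound oOm bOm r0 dO c t2 LSe; rewrite -/J1.
have := stress_density r0 dO; rewrite -/J2; move: (dot_ge0 c).
set x1 := Rintegral _ _ _; set x2 := Rintegral _ _ _; set x3 := Rintegral _ _ _.
set cc := dot c c => cc0 e1 e2 e3 h1.
have h2 : x3 - x2 <= `|x3| + `|x2|.
  by rewrite (le_trans (ler_norm _))// ler_normB.
have k1 : 32 * cc / (2048 / (beta * r)) = beta * r / 16 * cc / 4.
  by field; rewrite !gt_eqF.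
have k2 : r ^+ 2 * cc / (64 * r / beta) = beta * r / 16 * cc / 4.
  by field; rewrite !gt_eqF.
have k3 : 2048 / (beta * r) * x1 <= 2048 / (beta * r) * (8 * mu * J2).
  by apply: ler_wpM2l; [exact: ltW|exact: e1].
have h3 : beta * r / 16 * cc / 2 <= 64 * r / beta * J1 + 2048 / (beta * r) * (8 * mu * J2).
  rewrite k1 in e2; rewrite k2 in e3.
  move: h1 h2 k3 e2 e3; move: (2048 / _ * _) (2048 / _ * _) (64 * r / _ * _) (_ * cc).
  by move: `|x2| `|x3| (x3 - x2) => *; lra.
have q0 : 0 < 32 / (beta * r) by rewrite divr_gt0// mulr_gt0.
have := ler_wpM2l (ltW q0) h3.
have -> : 32 / (beta * r) * (beta * r / 16 * cc / 2) = cc.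
  by field; rewrite !gt_eqF.
move=> /le_trans; apply; rewrite le_eqVlt; apply/orP; left; apply/eqP.
by field; rewrite !gt_eqF.
Qed.

(** * Bounds of the terms of the estimator *)

Lemma Rint_indic (B : set (pt R)) (w : pt R -> R) : B `<=` Om ->
  \int[leb2]_(x in B) w x = \int[leb2]_(x in Om) (\1_B x * w x).
Proof.
move=> BO; rewrite (Rint_restrict BO (g := fun x => \1_B x * w x)).
  by apply: eq_Rintegral => x xB; rewrite indicE xB mul1r.
by move=> x nB; rewrite indicE memNset// mul0r.
Qed.

Lemma integrable_indic (B : set (pt R)) (w : pt R -> R) : measurable B ->
  leb2.-integrable Om (EFin \o w) ->
  leb2.-integrable Om (EFin \o (fun x => \1_B x * w x)).
Proof.
move=> mB iw; apply: (@le_integrable _ _ _ leb2 _ mOm _ (EFin \o w)) => //.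
  apply/measurable_EFinP; apply: measurable_funM.
    by apply: measurable_funTS; exact: measurable_indic.
  by apply/measurable_EFinP; exact: (measurable_int _ iw).
move=> x _ /=; rewrite lee_fin normrM indicE.
by case: (_ \in _); rewrite ?normr1 ?normr0 ?mul1r ?mul0r.
Qed.

Lemma sum_Rint_elements (w : pt R -> R) : leb2.-integrable Om (EFin \o w) ->
  (forall x, Om x -> 0 <= w x) ->
  \sum_(K <- T) \int[leb2]_(x in elt K) w x <= \int[leb2]_(x in Om) w x.
Proof.
move=> iw w0.
have mE (K : cell R) : measurable (elt K) by apply: open_measurable2; exact: open_elt.
have [iS ->] : leb2.-integrable Om (EFin \o (fun x => \sum_(K <- T) (\1_(elt K) x * w x))) /\
    \sum_(K <- T) \int[leb2]_(x in elt K) w x =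
    \int[leb2]_(x in Om) \sum_(K <- T) (\1_(elt K) x * w x).
  have : all (fun K => K \in T) (enum_fset T) by apply/allP.
  elim: (enum_fset T) => [_|K s IH /= /andP[KT /IH[iS sE]]].
    split; last by under eq_Rintegral do rewrite big_nil; rewrite big_nil Rintegral_cst//= mul0r.
    rewrite (_ : _ \o _ = cst 0%E); first exact: integrable0.
    by apply/funext => x /=; rewrite big_nil.
  have iK := integrable_indic (mE K) iw.
  split.
    have := integrableD2 oOm iK iS; congr (_.-integrable _ _).
    by apply/funext => x /=; rewrite big_cons.
  rewrite big_cons sE (Rint_indic w (elt_sub_domain oOm lip mT KT)).
  by rewrite -RintD//; apply: eq_Rintegral => x _; rewrite big_cons.
apply: (@le_Rintegral _ _ _ leb2) => // x Ox.
rewrite -mulr_suml ler_piMl ?w0//.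
have [[K KT xK]|nK] := pselect (exists2 K, K \in T & elt K x).
  rewrite (big_rem K KT) /= indicE mem_set// big_seq big1 ?addr0// => K'.
  rewrite mem_rem_uniq ?fset_uniq// inE => /andP[KK' K'T].
  rewrite indicE memNset// => xK'.
  by move/eqP: KK'; apply; exact: (elt_disjoint mT K'T KT xK' xK).
rewrite big_seq big1 ?ler01// => K KT; rewrite indicE memNset// => xK.
by apply: nK; exists K.
Qed.

Lemma Rint_two_elements (B : set (pt R)) K1 K2 (w : pt R -> R) : measurable B -> B `<=` Om ->
  K1 \in T -> K2 \in T -> leb2.-integrable Om (EFin \o w) ->
  (forall x, 0 <= w x) ->
  {ae leb2, forall x, B x -> elt K1 x \/ elt K2 x} ->
  \int[leb2]_(x in B) w x <=
  \int[leb2]_(x in elt K1) w x + \int[leb2]_(x in elt K2) w x.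
Proof.
move=> mB BO K1T K2T iw w0 cov.
have mE (K : cell R) : measurable (elt K) by apply: open_measurable2; exact: open_elt.
have O1 := elt_sub_domain oOm lip mT K1T; have O2 := elt_sub_domain oOm lip mT K2T.
rewrite (Rint_indic w BO) (Rint_indic w O1) (Rint_indic w O2).
have i1 := integrable_indic (mE K1) iw; have i2 := integrable_indic (mE K2) iw.
have iB := integrable_indic mB iw.
have p0 (D : set (pt R)) x : 0 <= \1_D x * w x by rewrite mulr_ge0// indicE ler0n.
rewrite -RintD// /Rintegral fine_le//.
- exact: (@integrable_fin_num _ _ _ leb2).
- by apply: (@integrable_fin_num _ _ _ leb2) => //; exact: integrableD2.
apply: (@ae_ge0_le_integral _ _ _ leb2) => //.
- by move=> x _; rewrite lee_fin.
- exact: (measurable_int _ iB).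
- by move=> x _; rewrite lee_fin addr_ge0.
- exact: (measurable_int _ (integrableD2 oOm i1 i2)).
apply: leb2_ae_imp cov => x cov _; rewrite lee_fin -mulrDl ler_wpM2r//.
rewrite [X in X <= _]indicE; have [/set_mem xB|_] := boolP (x \in B); last first.
  by rewrite addr_ge0// indicE ler0n.
have g0 (D : set (pt R)) : 0 <= \1_D x :> R by rewrite indicE ler0n.
case: (cov xB) => xK; first by rewrite [\1_(elt K1) x]indicE mem_set// lerDl g0.
by rewrite [\1_(elt K2) x]indicE mem_set// lerDr g0.
Qed.

Let osc K := (h_ K / Num.sqrt (2 * mu)) ^+ 2 *
  \int[leb2]_(x in elt K) dot (f x - fh x) (f x - fh x).
Let IZ K := \int[leb2]_(x in elt K) Z x.

Let scaled_h K : (h_ K / Num.sqrt (2 * mu)) ^+ 2 = h_ K ^+ 2 / (2 * mu).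
Proof. by rewrite expr_div_n sqr_sqrtr// mulr_ge0// ltW. Qed.

Let measurable_elt (K : cell R) : measurable (elt K).
Proof. by apply: open_measurable2; exact: open_elt. Qed.

Let integrable_elt K (w : pt R -> R) : K \in T -> leb2.-integrable Om (EFin \o w) ->
  leb2.-integrable (elt K) (EFin \o w).
Proof.
move=> KT iw; apply: (@integrableS _ _ _ leb2 Om) => //.
  exact: (measurable_elt K).
exact: elt_sub_domain KT.
Qed.

Let isqdiff : leb2.-integrable Om (EFin \o (fun x => dot (f x - fh x) (f x - fh x))).
Proof. exact: L2_dot. Qed.

Let area_elt K : K \in T ->
  0 <= \int[leb2]_(x in elt K) dot (fh x) (fh x) <= 4 * h_ K ^+ 2 * dot (fK K) (fK K).
Proof.
move=> KT; have tK := mesh_triangle mT KT; have h0 := h_gt0 tK.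
case: (tK) => _ [x0 /elt_sub_hull x0K].
have le4 : (leb2 (elt K) <= (4 * h_ K ^+ 2)%:E)%E.
  rewrite -(leb2_square x0.1 x0.2 (ltW h0)).
  apply: (@le_measure _ _ _ leb2) => //; rewrite ?inE.
  - exact: measurable_elt.
  - exact: measurable_cbox.
  - by apply: subset_trans (hull_sub_box x0K); exact: elt_sub_hull.
have a0 : 0 <= fine (leb2 (elt K)) by apply: fine_ge0; exact: (measure_ge0 leb2).
have aE : leb2 (elt K) = (fine (leb2 (elt K)))%:E.
  rewrite fineK// ge0_fin_numE; first exact: le_lt_trans le4 (ltry _).
  exact: (measure_ge0 leb2).
have a4 : fine (leb2 (elt K)) <= 4 * h_ K ^+ 2 by rewrite -lee_fin -aE.
rewrite (_ : Rintegral _ _ _ = \int[leb2]_(x in elt K) dot (fK K) (fK K)).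
  have [_ ->] := integrable_cst_fin (dot (fK K) (fK K)) (measurable_elt K) aE.
  by rewrite mulr_ge0 ?dot_ge0//= mulrC ler_wpM2r ?dot_ge0.
by apply: eq_Rintegral => x /set_mem xK; rewrite (fhE KT xK).
Qed.

Lemma eta_R2_bound (gam : R) K : K \in T -> h_ K <= gam * indiam (hull K) ->
  eta_R2 mu fh K <= (2048 * gam ^+ 2 / beta ^+ 2) * osc K +
    (4096 * 4096 * gam ^+ 4 / beta ^+ 2) * IZ K.
Proof.
move=> KT hK; have tK := mesh_triangle mT KT; have h0 := h_gt0 tK.
have [g0 [x0 [d [d0 hd Hd]]]] := inscribed_disc tK hK.
pose r := d / 4; have r0 : 0 < r by apply: divr_gt0.
have dK : disc x0 r `<=` elt K.
  move=> x /(discE _ _ (ltW r0)) xr.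
  apply: (@filterS _ (nbhs x) (nbhs_filter x) _ _ _ (nbhs_edisc x r0)) => z /= zr.
  apply: Hd; rewrite -(subrK x z) -addrA; apply: le_trans (enormD _ _) _.
  by move: zr xr; rewrite /r; lra.
have md := measurable_disc x0 r.
have := interior_residual_bound KT r0 dK.
have O0 := Rint_subset md (measurable_elt K) dK (integrable_elt KT isqdiff)
  (fun x _ => dot_ge0 (f x - fh x)).
have Z0 := Rint_subset md (measurable_elt K) dK (integrable_elt KT iZ)
  (fun x _ => error_density_ge0 x).
have /andP[_ ar] := area_elt KT.
rewrite /eta_R2 /osc !scaled_h -/(IZ K); rewrite -/(IZ K) in Z0.
move: O0 Z0 ar; set x1 := Rintegral _ _ _; set x2 := Rintegral _ _ _.
set x3 := Rintegral _ _ _; set x4 := Rintegral _ _ _; set z := IZ K; set cc := dot _ _.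
move=> O0 Z0 ar bd.
have x10 : 0 <= x1 by apply: (@Rintegral_ge0 _ _ _ leb2) => x _; exact: dot_ge0.
have x30 : 0 <= x3 by apply: (@Rintegral_ge0 _ _ _ leb2) => x _; exact: error_density_ge0.
pose q := h_ K / r.
have q0 : 0 <= q by apply: divr_ge0; exact: ltW.
have q8 : q <= 8 * gam by rewrite /q ler_pdivrMr// /r; move: hd; lra.
have hq : h_ K = q * r by rewrite /q divfK// gt_eqF.
have q2 : q ^+ 2 <= 64 * gam ^+ 2.
  have -> : 64 * gam ^+ 2 = (8 * gam) ^+ 2 by rewrite exprMn; congr (_ * _); rewrite expr2; ring.
  by rewrite ler_pXn2r ?nnegrE// mulr_ge0// ltW.
have q4 : q ^+ 4 <= 4096 * gam ^+ 4.
  have -> : q ^+ 4 = q ^+ 2 * q ^+ 2 by ring.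
  have -> : 4096 * gam ^+ 4 = (64 * gam ^+ 2) * (64 * gam ^+ 2) by ring.
  by apply: ler_pM => //; exact: sqr_ge0.
have s1 : cc <= 8 / (beta ^+ 2 * r ^+ 2) * x2 + 2048 * mu / (beta ^+ 2 * r ^+ 4) * z.
  have p1 : 0 <= 8 / (beta ^+ 2 * r ^+ 2).
    by apply: divr_ge0; [rewrite ler0n|apply: mulr_ge0; apply: exprn_ge0; exact: ltW].
  have p2 : 0 <= 2048 * mu / (beta ^+ 2 * r ^+ 4).
    apply: divr_ge0; first by apply: mulr_ge0; [rewrite ler0n|exact: ltW].
    by apply: mulr_ge0; apply: exprn_ge0; exact: ltW.
  exact: le_trans bd (lerD (ler_wpM2l p1 O0) (ler_wpM2l p2 Z0)).
have hm0 : 0 <= h_ K ^+ 2 / (2 * mu).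
  by apply: divr_ge0; [exact: sqr_ge0|apply: mulr_ge0 => //; exact: ltW].
have h40 : 0 <= 4 * h_ K ^+ 2 by apply: mulr_ge0 => //; exact: sqr_ge0.
apply: le_trans (ler_wpM2l hm0 (le_trans ar (ler_wpM2l h40 s1))) _.
have z0 : 0 <= z by apply: le_trans Z0.
have y0 : 0 <= h_ K ^+ 2 / (2 * mu) * x2 by apply: mulr_ge0 => //; exact: le_trans O0.
have -> : h_ K ^+ 2 / (2 * mu) * (4 * h_ K ^+ 2 *
   (8 / (beta ^+ 2 * r ^+ 2) * x2 + 2048 * mu / (beta ^+ 2 * r ^+ 4) * z)) =
   32 * q ^+ 2 / beta ^+ 2 * (h_ K ^+ 2 / (2 * mu) * x2) +
   4096 * q ^+ 4 / beta ^+ 2 * z.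
  by rewrite hq; field; rewrite !gt_eqF.
have b20 : 0 <= (beta ^+ 2)^-1 by rewrite invr_ge0 exprn_ge0// ltW.
have c1 : 32 * q ^+ 2 <= 2048 * gam ^+ 2.
  have -> : 2048 * gam ^+ 2 = 32 * (64 * gam ^+ 2) by ring.
  by apply: ler_wpM2l; first rewrite ler0n.
have c2 : 4096 * q ^+ 4 <= 4096 * 4096 * gam ^+ 4.
  have -> : 4096 * 4096 * gam ^+ 4 = 4096 * (4096 * gam ^+ 4) by ring.
  by apply: ler_wpM2l; first rewrite ler0n.
exact: lerD (ler_wpM2r y0 (ler_wpM2r b20 c1)) (ler_wpM2r z0 (ler_wpM2r b20 c2)).
Qed.

Let Y K := osc K + eta_R2 mu fh K + IZ K.

Let osc_ge0 K : 0 <= osc K.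
Proof.
apply: mulr_ge0; first exact: sqr_ge0.
by apply: (@Rintegral_ge0 _ _ _ leb2) => x _; exact: dot_ge0.
Qed.

Let eta_R2_ge0 K : 0 <= eta_R2 mu fh K.
Proof.
apply: mulr_ge0; first exact: sqr_ge0.
by apply: (@Rintegral_ge0 _ _ _ leb2) => x _; exact: dot_ge0.
Qed.

Let IZ_ge0 K : 0 <= IZ K.
Proof. by apply: (@Rintegral_ge0 _ _ _ leb2) => x _; exact: error_density_ge0. Qed.

Let Y_ge0 K : 0 <= Y K.
Proof. by rewrite !addr_ge0. Qed.

(** The edge bound involves the load itself, hence both the oscillation and the
volume residual. *)
Let load_elt (l : R) K : K \in T -> 0 <= l -> l <= h_ K ->
  l ^+ 2 / (2 * mu) * \int[leb2]_(x in elt K) dot (f x) (f x) <=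
  2 * (osc K + eta_R2 mu fh K).
Proof.
move=> KT l0 lh; rewrite /osc /eta_R2 !scaled_h.
have m0 : 0 <= (2 * mu)^-1 by rewrite invr_ge0 mulr_ge0// ltW.
have ih := integrable_elt KT (L2_dot oOm Lfh Lfh); have id := integrable_elt KT isqdiff.
have mK := measurable_elt K.
have le2 : \int[leb2]_(x in elt K) dot (f x) (f x) <=
    2 * (\int[leb2]_(x in elt K) dot (f x - fh x) (f x - fh x) +
         \int[leb2]_(x in elt K) dot (fh x) (fh x)).
  rewrite -(@RintegralD _ _ _ leb2)// -(@RintegralZl _ _ _ leb2)//; last first.
    exact: (@integrableD _ _ _ leb2 _ mK _ _ id ih).
  apply: (@le_Rintegral _ _ _ leb2) => //.
  - exact: integrable_elt KT (L2_dot oOm Lf Lf).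
  - apply: (integrable_elt KT); apply: (integrableZ2 oOm 2).
    exact: (integrableD2 oOm isqdiff (L2_dot oOm Lfh Lfh)).
  move=> x _; rewrite /dot /=; move: (f x) (fh x) => [a b] [c d] /=.
  have := sqr_ge0 (a - 2 * c); have := sqr_ge0 (b - 2 * d); nra.
move: le2; set x1 := Rintegral _ _ _; set x2 := Rintegral _ _ _; set x3 := Rintegral _ _ _.
move=> le2.
have x1_0 : 0 <= x1 by apply: (@Rintegral_ge0 _ _ _ leb2) => x _; exact: dot_ge0.
have l2 : l ^+ 2 / (2 * mu) <= h_ K ^+ 2 / (2 * mu).
  by apply: ler_wpM2r => //; rewrite ler_pXn2r// nnegrE// (le_trans l0).
have h2 : 0 <= h_ K ^+ 2 / (2 * mu) by apply: mulr_ge0 => //; exact: sqr_ge0.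
apply: le_trans (ler_wpM2r x1_0 l2) _; apply: le_trans (ler_wpM2l h2 le2) _.
by rewrite le_eqVlt; apply/orP; left; apply/eqP; ring.
Qed.

Lemma line_int_boundary Ed : boundary_edge Om Ed ->
  line_int Ed (fun x => let r := edge_residual F mu Om T uh ph Ed x in dot r r) = 0.
Proof.
move=> bE; rewrite /line_int (_ : Rintegral _ _ _ =
    \int[lebesgue_measure]_(t in `[0%R, 1%R]) (0 : R)).
  by rewrite Rintegral_cst// mul0r mulr0.
by apply: eq_Rintegral => t _; rewrite /edge_residual bE /dot /= mulr0 addr0.
Qed.

Lemma eta_edge_bound (gam : R) K Ed :
  (forall K, K \in T -> h_ K <= gam * indiam (hull K)) ->
  (forall K x, K \in T -> elt K x -> cgrad uh x = A K) ->
  K \in T -> Ed \in faces K ->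
  len Ed / (2 * mu) *
    line_int Ed (fun x => let r := edge_residual F mu Om T uh ph Ed x in dot r r) <=
  (4096 + 4096 * (128 * 128) * gam ^+ 2) / beta ^+ 2 *
    \sum_(K' <- T | (Ed `<=` K')%fset) Y K'.
Proof.
move=> reg cg KT EK; have [_ E2] := facesP _ _ EK.
have b20 : 0 <= (beta ^+ 2)^-1 by rewrite invr_ge0 exprn_ge0// ltW.
have g20 : 0 <= 4096 * (128 * 128) * gam ^+ 2.
  apply: mulr_ge0; last exact: sqr_ge0.
  by apply: mulr_ge0; [exact: ler0n|apply: mulr_ge0; exact: ler0n].
have C0 : 0 <= (4096 + 4096 * (128 * 128) * gam ^+ 2) / beta ^+ 2.
  by apply: mulr_ge0 b20; apply: addr_ge0 g20; exact: ler0n.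
have [bE|nb] := boolP (boundary_edge Om Ed).
  rewrite (line_int_boundary bE).
  by rewrite mulr0; apply: mulr_ge0 C0 _; apply: sumr_ge0.
have [g0 [K1 [K2 [[K1T EK1 s1] [K2T EK2 s2] [l1 l2] [r0 dO] sides]]]] :=
  edge_patch reg KT EK nb.
rewrite (sum_interior_edge _ mT K1T K2T EK1 EK2 s1 s2).
rewrite (line_int_edge_residual cg K1T EK1 s1 K2T EK2 s2 nb).
have n1 := dot_nrm_nrm E2.
have n0 : nrm Ed != 0.
  by apply/eqP => n0; move/eqP: n1; rewrite n0 /dot /= !mulr0 addr0 eq_sym oner_eq0.
have := jump_residual_bound n1 K1T K2T r0 dO sides erefl.
set cc := dot _ _; set r := len Ed / _ in r0 dO sides *.
have l0 := len_gt0 E2.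
have cov : {ae leb2, forall x, disc (mid Ed) r x -> elt K1 x \/ elt K2 x}.
  apply: leb2_ae_imp (ae_off_line (dot (nrm Ed) (mid Ed)) n0) => x off xd.
  have [pos neg] := sides x xd.
  have [c0|c0|c0] := ltgtP 0 (dot (nrm Ed) (x - mid Ed)); [by left; exact: pos|by right; exact: neg|].
  by exfalso; apply: off; apply/eqP; rewrite -subr_eq0 -dotBr c0.
have md := measurable_disc (mid Ed) r.
have Z1 := Rint_two_elements md dO K1T K2T iZ error_density_ge0 cov.
have f1 := Rint_two_elements md dO K1T K2T (L2_dot oOm Lf Lf) (fun x => dot_ge0 (f x)) cov.
have b1 := load_elt K1T (ltW l0) l1; have b2 := load_elt K2T (ltW l0) l2.
rewrite -/(IZ K1) -/(IZ K2) in Z1.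
move: Z1 f1 b1 b2; set x1 := Rintegral _ _ _; set x2 := Rintegral _ _ _.
set x3 := Rintegral _ _ _; set x4 := Rintegral _ _ _.
move=> Z1 f1 b1 b2 bd.
have m0 : 0 <= len Ed ^+ 2 / (2 * mu).
  by apply: divr_ge0; [exact: sqr_ge0|apply: mulr_ge0 => //; exact: ltW].
have lr : len Ed = 16 * gam * r by rewrite /r mulrC divfK// gt_eqF// mulr_gt0.
have e1 : len Ed / (2 * mu) * (len Ed * cc) = len Ed ^+ 2 / (2 * mu) * cc by ring.
rewrite e1; apply: le_trans (ler_wpM2l m0 bd) _.
have e2 : len Ed ^+ 2 / (2 * mu) * (2048 / beta ^+ 2 * x2 +
    2048 * 256 * mu / (beta ^+ 2 * r ^+ 2) * x1) =
    2048 / beta ^+ 2 * (len Ed ^+ 2 / (2 * mu) * x2) +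
    4096 * (128 * 128) * gam ^+ 2 / beta ^+ 2 * x1.
  by rewrite lr; field; rewrite !gt_eqF.
have f2 : len Ed ^+ 2 / (2 * mu) * x2 <=
    2 * (osc K1 + eta_R2 mu fh K1) + 2 * (osc K2 + eta_R2 mu fh K2).
  by apply: le_trans (ler_wpM2l m0 f1) _; rewrite mulrDr lerD.
have p1 : 0 <= 2048 / beta ^+ 2 by apply: mulr_ge0 b20; exact: ler0n.
have p2 : 0 <= 4096 * (128 * 128) * gam ^+ 2 / beta ^+ 2 by exact: (mulr_ge0 g20 b20).
rewrite e2; apply: le_trans (lerD (ler_wpM2l p1 f2) (ler_wpM2l p2 Z1)) _.
rewrite /Y; set o1 := osc K1; set o2 := osc K2; set h1 := eta_R2 _ _ K1; set h2 := eta_R2 _ _ K2.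
set i1 := IZ K1; set i2 := IZ K2; move: g20 p2; set q := 4096 * (128 * 128) * gam ^+ 2 => g20 p2.
have i0 : 0 <= i1 + i2 by apply: addr_ge0; exact: IZ_ge0.
have oh0 : 0 <= o1 + h1 + o2 + h2.
  by do !apply: addr_ge0; [exact: osc_ge0|exact: eta_R2_ge0|exact: osc_ge0|exact: eta_R2_ge0].
have -> : 2048 / beta ^+ 2 * (2 * (o1 + h1) + 2 * (o2 + h2)) + q / beta ^+ 2 * (i1 + i2) =
  4096 / beta ^+ 2 * (o1 + h1 + o2 + h2) + q / beta ^+ 2 * (i1 + i2) by ring.
have -> : (4096 + q) / beta ^+ 2 * (o1 + h1 + i1 + (o2 + h2 + i2)) =
  4096 / beta ^+ 2 * (o1 + h1 + o2 + h2) + q / beta ^+ 2 * (i1 + i2) +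
  (4096 / beta ^+ 2 * (i1 + i2) + q / beta ^+ 2 * (o1 + h1 + o2 + h2)) by ring.
rewrite lerDl; apply: addr_ge0; apply: mulr_ge0; [|exact: i0| |exact: oh0].
  by apply: mulr_ge0 b20; exact: ler0n.
exact: p2.
Qed.

(** * Summation over the mesh *)

(** Exchanging the sums, a triangle is counted once for each of its at most 8
faces and each of the at most 2 triangles that share the face. *)
Lemma face_overlap (y : cell R -> R) : (forall K, 0 <= y K) ->
  \sum_(K <- T) \sum_(Ed <- faces K) \sum_(K' <- T | (Ed `<=` K')%fset) y K' <=
  16 * \sum_(K <- T) y K.
Proof.
move=> y0.
under eq_bigr do rewrite (exchange_big_dep predT)//=.
rewrite exchange_big /= mulr_sumr !big_seq; apply: ler_sum => K' K'T.
have swap K : K \in T -> \sum_(Ed <- faces K | (Ed `<=` K')%fset) y K' =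
    \sum_(Ed <- faces K' | (Ed `<=` K)%fset) y K'.
  move=> _; rewrite -big_filter -[RHS]big_filter; apply: perm_big; apply: uniq_perm.
  - by rewrite filter_uniq// fset_uniq.
  - by rewrite filter_uniq// fset_uniq.
  - move=> Ed; rewrite !mem_filter; apply/andP/andP => -[h /facesP[h1 h2]];
      by split => //; apply/facesP.
rewrite big_seq (eq_bigr _ swap) -big_seq (exchange_big_dep predT)//=.
have le2 Ed : Ed \in faces K' -> \sum_(K <- T | (Ed `<=` K)%fset) y K' <= 2 * y K'.
  move=> /facesP[_ E2]; rewrite big_const_seq iter_addr_0 -[y K' *+ _]mulr_natl.
  by rewrite ler_wpM2r// ler_nat; exact: card_edge_elements mT E2.
rewrite big_seq; apply: le_trans (ler_sum _ le2) _.
rewrite -big_seq big_const_seq iter_addr_0 count_predT -[_ *+ _]mulr_natl mulrA.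
rewrite ler_wpM2r// -[2]/(2%:R) -natrM ler_nat.
have : (size (enum_fset (faces K')) <= 8)%N.
  have [K3 _] := mesh_triangle mT K'T.
  have c8 : #|` fpowerset K'| = 8%N by rewrite card_fpowerset K3.
  rewrite -c8; apply: fsubset_leq_card; apply/fsubsetP => Ed /facesP[sE _].
  by rewrite fpowersetE.
by move=> h; rewrite (leq_trans (leq_mul h (leqnn 2))).
Qed.

Let kap := kappa F mu lam.
Let mass := \int[leb2]_(x in Om) (ep x ^+ 2).
Let EN := 2 * mu * \int[leb2]_(x in Om) frob (E x) (E x) + (2 * mu)^-1 * mass +
  kap^-1 * mass.

Let iep : leb2.-integrable Om (EFin \o (fun x => ep x ^+ 2)).
Proof. exact: (L2M mOm Lep Lep). Qed.

Let iEE : leb2.-integrable Om (EFin \o (fun x => frob (E x) (E x))).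
Proof. exact: frob_integrable. Qed.

Let mass_ge0 : 0 <= mass.
Proof. by apply: (@Rintegral_ge0 _ _ _ leb2) => x _; exact: sqr_ge0. Qed.

Let EE_ge0 : 0 <= \int[leb2]_(x in Om) frob (E x) (E x).
Proof. by apply: (@Rintegral_ge0 _ _ _ leb2) => x _; exact: frob_ge0. Qed.

Hypothesis lam0 : 0 < lam.
Let kap0 : 0 < kap. Proof. by rewrite /kap; case: F => //=; exact: addr_gt0. Qed.

Let sum_IZ : \sum_(K <- T) IZ K <= EN.
Proof.
apply: le_trans (sum_Rint_elements iZ (fun x _ => error_density_ge0 x)) _.
rewrite /EN (RintD oOm (integrableZ2 oOm _ iEE) (integrableZ2 oOm _ iep)).
rewrite (RintZ oOm _ iEE) (RintZ oOm _ iep) -/mass lerDl.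
by apply: mulr_ge0 => //; rewrite invr_ge0 ltW.
Qed.

(** The exact solution satisfies its constraint in L^2, as is seen by testing
    the constraint with its own residual. *)
Let exact_constraint :
  \int[leb2]_(x in Om) ((wdiv Om u x + kap^-1 * p x) ^+ 2) = 0.
Proof.
have Lq : L2 Om (fun x => wdiv Om u x + kap^-1 * p x).
  apply: L2D => //; first by apply: L2_mxtrace => //; exact: L2m_wgrad.
  exact: L2Z.
have Ld : L2 Om (wdiv Om u) by apply: L2_mxtrace => //; exact: L2m_wgrad.
have [_ _ _ /(_ _ Lq)] := sol; rewrite /b_form /c_form -/kap.
have i1 := L2M mOm Lq Ld; have i2 := L2M mOm Lp Lq.
rewrite -(RintZ oOm _ i2) => /eqP; rewrite subr_eq0 => /eqP e.
have -> : \int[leb2]_(x in Om) ((wdiv Om u x + kap^-1 * p x) ^+ 2) =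
   \int[leb2]_(x in Om) ((wdiv Om u x + kap^-1 * p x) * wdiv Om u x +
     kap^-1 * (p x * (wdiv Om u x + kap^-1 * p x))).
  by apply: eq_Rintegral => x _; ring.
by rewrite (RintD oOm i1 (integrableZ2 oOm _ i2)) -e addrN.
Qed.

(** The residual of the constraint is minus the one of the error. *)
Let discrete_constraint :
  \int[leb2]_(x in Om) ((wdiv Om uh x + kap^-1 * ph x) ^+ 2) <=
  8 * \int[leb2]_(x in Om) frob (E x) (E x) + 4 * kap^-1 ^+ 2 * mass.
Proof.
pose q x := wdiv Om u x + kap^-1 * p x.
pose e x := \tr (E x) + kap^-1 * ep x.
have Lq : L2 Om q.
  apply: L2D => //; first by apply: L2_mxtrace => //; exact: L2m_wgrad.
  exact: L2Z.
have Le : L2 Om e by apply: L2D => //; [exact: L2_mxtrace|exact: L2Z].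
have Lqh : L2 Om (fun x => wdiv Om uh x + kap^-1 * ph x).
  apply: L2D => //; first by apply: L2_mxtrace => //; exact: L2m_wgrad.
  exact: L2Z.
have Lqe : L2 Om (fun x => q x - e x) by exact: L2B.
have -> : \int[leb2]_(x in Om) ((wdiv Om uh x + kap^-1 * ph x) ^+ 2) =
    \int[leb2]_(x in Om) ((q x - e x) ^+ 2).
  apply: Rint_ae_eq => //; [exact: (L2M mOm Lqh Lqh)|exact: (L2M mOm Lqe Lqe)|].
  apply: leb2_ae_imp (wgradB oOm bOm H1u H1uh).2 => x H Ox.
  rewrite /q /e (H Ox) /wdiv raddfB /=; congr (_ ^+ 2).
  by move: (\tr _) (\tr _) (p x) (ph x) => *; ring.
have iq := L2M mOm Lq Lq.
apply: (@le_trans _ _ (\int[leb2]_(x in Om) (2 * (q x ^+ 2) +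
    (8 * frob (E x) (E x) + 4 * kap^-1 ^+ 2 * ep x ^+ 2)))); last first.
  rewrite (RintD oOm (integrableZ2 oOm 2 iq)); last first.
    by apply: integrableD2 => //; exact: integrableZ2.
  rewrite (RintZ oOm 2 iq) [X in 2 * X]exact_constraint mulr0 add0r.
  rewrite (RintD oOm (integrableZ2 oOm _ iEE) (integrableZ2 oOm _ iep)).
  by rewrite (RintZ oOm _ iEE) (RintZ oOm _ iep).
apply: (@le_Rintegral _ _ _ leb2) => //.
- exact: (L2M mOm Lqe Lqe).
- exact: (integrableD2 oOm (integrableZ2 oOm 2 iq)
    (integrableD2 oOm (integrableZ2 oOm _ iEE) (integrableZ2 oOm _ iep))).
move=> x _; rewrite /e mxtrace2 frobE.
set a := q x; set b := kap^-1 * _; have -> : kap^-1 ^+ 2 = kap^-1 * kap^-1 by [].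
have -> : 4 * (kap^-1 * kap^-1) * (p x - ph x) ^+ 2 = 4 * b ^+ 2 by rewrite /b; ring.
move: (E x 0 0) (E x 0 1) (E x 1 0) (E x 1 1) a b => c d s t a b.
have := sqr_ge0 (a + (c + t + b)); have := sqr_ge0 (c + t - b); have := sqr_ge0 (c - t).
have := sqr_ge0 d; have := sqr_ge0 s; nra.
Qed.

(** Uses [rho_d <= 2 mu] for the divergence and [rho_d <= kap] for the pressure. *)
Let sum_eta_J2 : (forall K x, K \in T -> elt K x -> cgrad uh x = A K) ->
  \sum_(K <- T) eta_J2 mu kap uh ph K <= 8 * EN.
Proof.
move=> cg.
pose w x := (wdiv Om uh x + kap^-1 * ph x) ^+ 2.
have Lqh : L2 Om (fun x => wdiv Om uh x + kap^-1 * ph x).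
  apply: L2D => //; first by apply: L2_mxtrace => //; exact: L2m_wgrad.
  exact: L2Z.
have iw : leb2.-integrable Om (EFin \o w) by exact: (L2M mOm Lqh Lqh).
set rho := (kap^-1 + (2 * mu)^-1)^-1.
have JE K : K \in T -> eta_J2 mu kap uh ph K = rho * \int[leb2]_(x in elt K) w x.
  move=> KT; rewrite /eta_J2 -/rho; congr (_ * _).
  transitivity (\int[leb2]_(x in elt K) ((\tr (A K) + P K / kap) ^+ 2)).
    by apply: eq_Rintegral => x /set_mem xK; rewrite (cg K x KT xK) (phE KT xK).
  apply: (@Rint_ae_eq R (elt K) (@open_elt R K) (fun=> (\tr (A K) + P K / kap) ^+ 2) w);
    [|exact: integrable_elt|].
    apply: (integrable_elt KT); apply: L2_integrable => //; exact: L2_cst.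
  apply: leb2_ae_imp wgrad_uh => x H xK; have Ox := elt_sub_domain oOm lip mT KT xK.
  by rewrite /w /wdiv (H Ox K KT xK) (phE KT xK) mulrC.
rewrite big_seq (eq_bigr _ JE) -big_seq -mulr_sumr.
have m2 : 0 < 2 * mu by rewrite mulr_gt0.
have rho0 : 0 < rho by rewrite invr_gt0 addr_gt0// invr_gt0.
have rho_mu : rho <= 2 * mu.
  by rewrite /rho -[leRHS]invrK lef_pV2 ?posrE ?addr_gt0 ?invr_gt0// lerDr invr_ge0 ltW.
have rho_kap : rho <= kap.
  by rewrite /rho -[leRHS]invrK lef_pV2 ?posrE ?addr_gt0 ?invr_gt0// lerDl invr_ge0 ltW.
have := sum_Rint_elements iw (fun x _ => sqr_ge0 _).
move=> /le_trans/(_ discrete_constraint)/(ler_wpM2l (ltW rho0))/le_trans; apply.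
rewrite /EN; move: EE_ge0 mass_ge0; set e := Rintegral _ _ _; set m := mass => e0 mm0.
have h1 : rho * e <= 2 * mu * e by rewrite ler_wpM2r.
have km0 : 0 <= kap^-1 * m by rewrite mulr_ge0// invr_ge0 ltW.
have h2 : rho * (kap^-1 ^+ 2 * m) <= kap^-1 * m.
  have -> : kap^-1 * m = kap * (kap^-1 ^+ 2 * m) by field; rewrite gt_eqF.
  by rewrite ler_wpM2r// mulr_ge0// exprn_ge0// invr_ge0 ltW.
have h3 : 0 <= (2 * mu)^-1 * m by rewrite mulr_ge0// invr_ge0 ltW.
have -> : rho * (8 * e + 4 * kap^-1 ^+ 2 * m) =
  8 * (rho * e) + 4 * (rho * (kap^-1 ^+ 2 * m)) by ring.
by move: h1 h2 h3 km0; lra.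
Qed.

Let sum_eta (CR CE : R) : 0 <= CR -> 0 <= CE ->
  (forall K x, K \in T -> elt K x -> cgrad uh x = A K) ->
  (forall K, K \in T -> eta_R2 mu fh K <= CR * (osc K + IZ K)) ->
  (forall K Ed, K \in T -> Ed \in faces K -> len Ed / (2 * mu) *
     line_int Ed (fun x => let r := edge_residual F mu Om T uh ph Ed x in dot r r) <=
     CE * \sum_(K' <- T | (Ed `<=` K')%fset) Y K') ->
  \sum_(K <- T) (eta_R2 mu fh K + eta_E2 F mu Om T uh ph K + eta_J2 mu kap uh ph K) <=
  (CR + 16 * CE * (1 + CR) + 8) * (EN + \sum_(K <- T) osc K).
Proof.
move=> CR0 CE0 cg bR bE; set O := \sum_(K <- T) osc K.
have O0 : 0 <= O by apply: sumr_ge0.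
have sZ := sum_IZ.
have EN0 : 0 <= EN by apply: le_trans sZ; apply: sumr_ge0.
have hR : \sum_(K <- T) eta_R2 mu fh K <= CR * (EN + O).
  rewrite big_seq; apply: le_trans (ler_sum _ bR) _.
  by rewrite -big_seq -mulr_sumr ler_wpM2l// big_split [leRHS]addrC lerD2l.
have hY : \sum_(K <- T) Y K <= (1 + CR) * (EN + O).
  rewrite !big_split /= mulrDl mul1r; move: hR sZ; rewrite -/O; lra.
have hE : \sum_(K <- T) eta_E2 F mu Om T uh ph K <= 16 * CE * (1 + CR) * (EN + O).
  have /le_trans -> // : \sum_(K <- T) eta_E2 F mu Om T uh ph K <=
      CE * \sum_(K <- T) \sum_(Ed <- faces K) \sum_(K' <- T | (Ed `<=` K')%fset) Y K'.
    rewrite mulr_sumr !big_seq; apply: ler_sum => K KT.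
    by rewrite mulr_sumr /eta_E2 !big_seq; apply: ler_sum => Ed EK; exact: bE EK.
  have -> : 16 * CE * (1 + CR) * (EN + O) = CE * (16 * ((1 + CR) * (EN + O))) by ring.
  by apply: ler_wpM2l => //; apply: le_trans (face_overlap Y_ge0) _; rewrite ler_wpM2l.
have hJ := sum_eta_J2 cg.
rewrite !big_split /= (mulrDl (CR + _)) (mulrDl CR).
apply: lerD; first exact: lerD.
by apply: le_trans hJ _; rewrite ler_wpM2l// lerDl.
Qed.

Lemma efficiency (gam : R) :
  (forall K, K \in T -> h_ K <= gam * indiam (hull K)) ->
  (forall K x, K \in T -> elt K x -> cgrad uh x = A K) ->
  estimator F mu lam Om T fh uh ph <=
    Num.sqrt (efficiency_constant gam) *
      (energy_norm mu kap Om (fun x => u x - uh x) ep + oscillation mu T f fh).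
Proof.
move=> reg cg.
have bR K : K \in T -> eta_R2 mu fh K <= volume_constant gam * (osc K + IZ K).
  move=> KT; apply: le_trans (eta_R2_bound KT (reg K KT)) _.
  have [c1 c2] := volume_terms_ge0 gam.
  have := mulr_ge0 c1 (IZ_ge0 K); have := mulr_ge0 c2 (osc_ge0 K).
  rewrite /volume_constant -/beta (mulrDl (2048 * gam ^+ 2)).
  by move: (_ / _) (_ / _) (osc K) (IZ K) => a b o z h1 h2; lra.
have := sum_eta (volume_constant_ge0 gam) (edge_constant_ge0 gam) cg bR
  (fun K Ed => eta_edge_bound reg cg).
rewrite -/(efficiency_constant gam).
have O0 : 0 <= \sum_(K <- T) osc K by apply: sumr_ge0.
have EN0 : 0 <= EN by apply: le_trans sum_IZ; apply: sumr_ge0.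
rewrite /estimator -/kap /energy_norm -/mass -/EN /oscillation.
have C0 := ltW (efficiency_constant_gt0 gam).
move: C0; set C := efficiency_constant gam; set S := \sum_(K <- T) _; set O := \sum_(K <- T) _.
move=> C0 h.
apply: le_trans (ler_wsqrtr h) _; rewrite (sqrtrM _ C0).
exact: ler_wpM2l (sqrtr_ge0 C) _ _ (sqrtrD_le EN0 O0).
Qed.

End residual_bounds.

Theorem theorem4p2 (R : realType) (Om : set (pt R)) (I : Type)
    (T : I -> mesh R) (Mh : I -> {fset mesh R}) :
  lipschitz_polygon Om ->
  (forall h, conforming_mesh Om (T h)) ->
  shape_regular T ->
  (forall h, macro_partition Om (T h) (Mh h)) ->
  finitely_many_classes Mh ->
  exists C : R, 0 < C /\
    forall (F : formulation) (mu1 mu2 mu lam : R) (h : I)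
      (f g fh u uh : pt R -> pt R) (p ph : pt R -> R),
      0 < mu1 -> mu1 < mu -> mu < mu2 -> 0 < lam ->
      (forall i, L2 Om (component i f)) ->
      affine_on (boundary Om) g ->
      is_L2_projection Om (T h) f fh ->
      weak_solution F mu lam Om f g u p ->
      discrete_solution F mu lam Om (T h) (Mh h) f g uh ph ->
      estimator F mu lam Om (T h) fh uh ph <=
        C * (energy_norm mu (kappa F mu lam) Om
               (fun x => u x - uh x) (fun x => p x - ph x)
             + oscillation mu (T h) f fh).
Proof.
move=> [[oOm _ _ bOm] [lip _]] mT [gam reg] _ _.
exists (Num.sqrt (efficiency_constant gam)).
split; first by rewrite sqrtr_gt0; exact: efficiency_constant_gt0.
move=> F mu1 mu2 mu lam h f g fh u uh p ph mu10 mu1m _ lam0 Lf _ [Qfh _] sol [[Puh _] Qph _ _].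
have mu0 : 0 < mu := lt_trans mu10 mu1m.
have [A [H1uh cgE wgE]] := P1_gradient oOm bOm (mT h) Puh.
have [P PE] := Qh_values Qph.
have /choice[fK fKE] (i : 'I_2) := Qh_values (Qfh i).
have fhE K x : K \in T h -> elt K x -> fh x = (fK 0 K, fK 1 K).
  by move=> KT xK; apply: pt_eq; rewrite /= -(fKE _ K x KT xK).
exact: (efficiency oOm bOm lip (mT h) mu0 Lf (fun i => (Qfh i).1) sol Qph.1 H1uh wgE
  PE fhE lam0 (reg h) cgE).
Qed.
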